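(* For any $n,m\in\mathbb{N}$, the two-sided Brinkmann conjugacy problem for monomorphisms of $F_n\times\mathbb{Z}^m$ is decidable. That is, for any $n,m\in\mathbb{N}$, there is an algorithm that, given two elements $x,y\in F_n\times\mathbb{Z}^m$ and an injective endomorphism $\Phi$ of $F_n\times\mathbb{Z}^m$, decides whether there exist some $r,s\in\mathbb{N}$ such that $(x)\Phi^r$ and $(y)\Phi^s$ are conjugate in $F_n\times\mathbb{Z}^m$ and, in case they exist, computes one such pair $(r,s)\in\mathbb{N}^2$.
   Context: $\mathbb{N}=\{0,1,2,\dots\}$. $F_n$ denotes the free group of rank $n$ and $\mathbb{Z}^m$ the free-abelian group of rank $m$. The group $F_n\times\mathbb{Z}^m$ is given by the finite presentation $\langle x_1,\dots,x_n,t_1,\dots,t_m \mid t_it_j=t_jt_i,\ t_ix_k=x_kt_i,\ i,j\in[1,m],\ k\in[1,n]\rangle$. Elements are given to the algorithm as words in the generators (and inverses), and endomorphisms are given as the list of words representing the images of the generators. A monomorphism of a group is an injective endomorphism. Homomorphisms act on the right: $(x)\Phi$ is the image of $x$ under $\Phi$, and $\Phi^k$ is the $k$-fold composition, with $\Phi^0=\mathrm{id}$. *)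

(* Defs.v *)
From HB Require Import structures.
From mathcomp Require Import all_boot.
From mathcomp Require Import boolp.

Set Implicit Arguments.
Unset Strict Implicit.
Unset Printing Implicit Defensive.

Local Open Scope group_scope.
Local Open Scope quotient_scope.

(** * Partial recursive functions *)

(* A code may be applied to argument lists of any length, so no arity is
   attached to it.  The recursion and minimisation variables come first. *)
Inductive recfun :=
| RZero
| RSucc
| RProj of nat
| RComp of recfun & seq recfun
| RRec of recfun & recfun
| RMu of recfun.

(* [reval p args y]: the computation of [p] on [args] halts with result [y]. *)
Inductive reval : recfun -> seq nat -> nat -> Prop :=
| reval_zero args : reval RZero args 0
| reval_succ x args : reval RSucc (x :: args) x.+1
| reval_proj i args : i < size args -> reval (RProj i) args (nth 0 args i)
| reval_comp f gs args ys z :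
    size ys = size gs ->
    (forall i, i < size gs -> reval (nth RZero gs i) args (nth 0 ys i)) ->
    reval f ys z ->
    reval (RComp f gs) args z
| reval_rec0 f g args y :
    reval f args y -> reval (RRec f g) (0 :: args) y
| reval_recS f g k args y z :
    reval (RRec f g) (k :: args) y ->
    reval g (k :: y :: args) z ->
    reval (RRec f g) (k.+1 :: args) z
| reval_mu f args k (val : nat -> nat) :
    reval f (k :: args) 0 ->
    (forall j, j < k -> reval f (j :: args) (val j).+1) ->
    reval (RMu f) args k.

Lemma reval_fun p args y z : reval p args y -> reval p args z -> y = z.
Proof.
move=> H; elim: H z => {p args y}.
- by move=> args z H; inversion H.
- by move=> x args z H; inversion H.
- by move=> i args _ z H; inversion H.
- move=> f gs args ys z sz _ IHg _ IHf z' H; inversion H; subst.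
  apply: IHf; suff -> : ys = ys0 by [].
  apply: (@eq_from_nth _ 0); first by rewrite sz.
  by move=> i; rewrite sz => ilt; apply: IHg => //; eauto.
- by move=> f g args y _ IH z H; inversion H; subst; apply: IH.
- move=> f g k args y z _ IHy _ IHz z' H; inversion H; subst.
  apply: IHz; suff -> : y = y0 by [].
  exact: IHy.
- move=> f args k val _ IH0 _ IH z H; inversion H; subst.
  case: (ltngtP k z) => // h.
  + match goal with H : forall j, _ -> reval f _ _ |- _ =>
      by have /IH0 := H _ h end.
  + match goal with H : reval f (z :: args) 0 |- _ =>
      by have := IH _ h _ H end.
Qed.

(** * Groups given by presentations *)

Section Presentation.

Variable X : choiceType.

(* [(a, false)] stands for [a] and [(a, true)] for its formal inverse. *)
Definition letter : Type := (X * bool)%type.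
Definition word : Type := seq letter.

Definition letter_inv (l : letter) : letter := (l.1, ~~ l.2).
Definition word_inv (w : word) : word := rev (map letter_inv w).

Variable R : word -> word -> Prop.

Inductive pres_eq : word -> word -> Prop :=
| pres_refl u : pres_eq u u
| pres_sym u v : pres_eq u v -> pres_eq v u
| pres_trans u v w : pres_eq u v -> pres_eq v w -> pres_eq u w
| pres_cat u u' v v' :
    pres_eq u u' -> pres_eq v v' -> pres_eq (u ++ v) (u' ++ v')
| pres_cancel l : pres_eq [:: l; letter_inv l] [::]
| pres_rel u v : R u v -> pres_eq u v.

Definition pres_eqb : rel word := fun u v => `[< pres_eq u v >].

Lemma pres_eqb_refl : reflexive pres_eqb.
Proof. by move=> u; apply/asboolP; apply: pres_refl. Qed.

Lemma pres_eqb_sym : symmetric pres_eqb.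
Proof. by move=> u v; apply/asboolP/asboolP; apply: pres_sym. Qed.

Lemma pres_eqb_trans : transitive pres_eqb.
Proof.
by move=> v u w /asboolP uv /asboolP vw; apply/asboolP; apply: pres_trans vw.
Qed.

Canonical pres_equiv :=
  EquivRel pres_eqb pres_eqb_refl pres_eqb_sym pres_eqb_trans.

Definition pgroup := {eq_quot pres_equiv}.
HB.instance Definition _ := Choice.on pgroup.

Definition welt (w : word) : pgroup := \pi_({eq_quot pres_equiv}) w.

Lemma weltP u v : welt u = welt v <-> pres_eq u v.
Proof.
split; first by move/eqmodP/asboolP.
by move=> h; apply/eqmodP/asboolP.
Qed.

Definition wrepr (x : pgroup) : word := repr (x : {eq_quot pres_equiv}).

Lemma wreprK x : welt (wrepr x) = x.
Proof. exact: reprK. Qed.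

Lemma letter_invK : involutive letter_inv.
Proof. by case=> a b; rewrite /letter_inv /= negbK. Qed.

Lemma word_invK : involutive word_inv.
Proof.
by move=> w; rewrite /word_inv map_rev revK mapK //; apply: letter_invK.
Qed.

Lemma word_inv_cat u v : word_inv (u ++ v) = word_inv v ++ word_inv u.
Proof. by rewrite /word_inv map_cat rev_cat. Qed.

Lemma pres_mulV w : pres_eq (w ++ word_inv w) [::].
Proof.
elim: w => [|l w IH]; first exact: pres_refl.
rewrite -cat1s word_inv_cat -catA (catA w).
apply: pres_trans (pres_cancel l); rewrite -[X in pres_eq _ X]/([:: l] ++ _).
apply: pres_cat; first exact: pres_refl.
rewrite -[X in pres_eq _ X]cat0s.
by apply: pres_cat; [|apply: pres_refl].
Qed.

Lemma pres_mulVl w : pres_eq (word_inv w ++ w) [::].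
Proof. by have := pres_mulV (word_inv w); rewrite word_invK. Qed.

Lemma pres_inv u v : pres_eq u v -> pres_eq (word_inv u) (word_inv v).
Proof.
move=> uv; apply: (@pres_trans _ (word_inv u ++ (v ++ word_inv v))).
  rewrite -[X in pres_eq X _]cats0.
  by apply: pres_cat; [apply: pres_refl | apply/pres_sym/pres_mulV].
rewrite catA -[X in pres_eq _ X]cat0s; apply: pres_cat; last exact: pres_refl.
apply: pres_trans (pres_mulVl u).
by apply: pres_cat; [apply: pres_refl | apply: pres_sym].
Qed.

Definition pone : pgroup := welt [::].
Definition pmul (x y : pgroup) : pgroup := welt (wrepr x ++ wrepr y).
Definition pinv (x : pgroup) : pgroup := welt (word_inv (wrepr x)).

Lemma pmulE u v : pmul (welt u) (welt v) = welt (u ++ v).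
Proof. by apply/weltP; apply: pres_cat; apply/weltP; rewrite wreprK. Qed.

Lemma pinvE u : pinv (welt u) = welt (word_inv u).
Proof. by apply/weltP; apply: pres_inv; apply/weltP; rewrite wreprK. Qed.

Lemma pmulA : associative pmul.
Proof.
move=> x y z; rewrite -(wreprK x) -(wreprK y) -(wreprK z).
by rewrite !pmulE catA.
Qed.

Lemma pmul1 : left_id pone pmul.
Proof. by move=> x; rewrite -(wreprK x) pmulE. Qed.

Lemma pmulr1 : right_id pone pmul.
Proof. by move=> x; rewrite -(wreprK x) pmulE cats0. Qed.

Lemma pmulV : left_inverse pone pinv pmul.
Proof.
move=> x; rewrite -(wreprK x) pinvE pmulE.
by apply/weltP; apply: pres_mulVl.
Qed.

Lemma pmulrV : right_inverse pone pinv pmul.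
Proof.
move=> x; rewrite -(wreprK x) pinvE pmulE.
by apply/weltP; apply: pres_mulV.
Qed.

HB.instance Definition _ :=
  isGroup.Build pgroup pmulA pmul1 pmulr1 pmulV pmulrV.

Lemma welt_cat u v : welt (u ++ v) = welt u * welt v.
Proof. by rewrite -pmulE. Qed.

Lemma welt_inv u : welt (word_inv u) = (welt u)^-1.
Proof. by rewrite -pinvE. Qed.

End Presentation.

(** * The group F_n x Z^m *)

Section FreeTimesFreeAbelian.

Variables n m : nat.

(* x_1, ..., x_n, t_1, ..., t_m are numbered consecutively from 0. *)
Definition xgen (k : 'I_n) : word 'I_(n + m) := [:: (lshift m k, false)].
Definition tgen (i : 'I_m) : word 'I_(n + m) := [:: (rshift n i, false)].

Inductive FZ_rel : word 'I_(n + m) -> word 'I_(n + m) -> Prop :=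
| FZ_tt i j : FZ_rel (tgen i ++ tgen j) (tgen j ++ tgen i)
| FZ_tx i k : FZ_rel (tgen i ++ xgen k) (xgen k ++ tgen i).

Definition FZword := word 'I_(n + m).
Definition FZ := pgroup FZ_rel.

Definition FZelt (w : FZword) : FZ := welt FZ_rel w.

Definition endo_words := (n + m).-tuple FZword.

Definition represents (ws : endo_words) (Phi : FZ -> FZ) :=
  forall i : 'I_(n + m), Phi (FZelt [:: (i, false)]) = FZelt (tnth ws i).

(* The encodings below use the bijection [CodeSeq.code : seq nat -> nat]. *)
Definition code_word (w : FZword) : nat :=
  CodeSeq.code [seq (l.1 : nat).*2 + l.2 | l : letter 'I_(n + m) <- w]%N.

Definition code_endo (ws : endo_words) : nat :=
  CodeSeq.code [seq code_word w | w <- ws].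

End FreeTimesFreeAbelian.

Definition code_answer (out : option (nat * nat)) : nat :=
  if out is Some (r, s) then CodeSeq.code [:: r; s] else CodeSeq.code [::].

(** * The two-sided Brinkmann conjugacy problem *)

Section Brinkmann.

Variable G : groupType.

Definition conjugate (x y : G) := exists z : G, x ^ z = y.

Definition Brinkmann_pair (Phi : G -> G) (x y : G) (r s : nat) :=
  conjugate (iter r Phi x) (iter s Phi y).

Definition Brinkmann_answer (Phi : G -> G) (x y : G)
    (out : option (nat * nat)) :=
  match out with
  | Some (r, s) => Brinkmann_pair Phi x y r s
  | None => ~ exists r s, Brinkmann_pair Phi x y r s
  end.

End Brinkmann.

(* [P] is run on codes of words for [x], [y] and the images of the generators;
   nothing is required of it on inputs that do not define a monomorphism. *)
Definition solves_two_sided_BrCP (n m : nat) (P : recfun) :=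
  forall (x y : FZword n m) (ws : endo_words n m)
         (Phi : {multiplicative FZ n m -> FZ n m}),
    represents ws Phi -> injective Phi ->
    exists out : option (nat * nat),
      reval P [:: code_word x; code_word y; code_endo ws] (code_answer out) /\
      Brinkmann_answer Phi (FZelt x) (FZelt y) out.

(* Main.v *)
(* Conjugacy in F_n x Z^m amounts to conjugacy of the F_n-components together
   with equality of the exponent sums.  For n >= 2 an injective Phi kills the
   F_n-component of every (t_j)Phi, because commutation is transitive on the
   nontrivial elements of F_n; so Phi induces an endomorphism of F_n.

   Conjugacy in F_n is expressed by trace identities tr rho(u) = tr rho(v) for
   all representations rho of finitely many fixed dimensions: ping-pong
   representations reduce them to traces of products of arbitrary matrices
   attached to the letters, and suitable matrices turn these into products of
   discrete Fourier coefficients, which determine a word up to rotation.  The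
   ideals of trace identities valid after applying Phi^s form a chain of primes,
   whose length is bounded by a transcendence degree; hence if (x)Phi^r ~ (y)Phi^s
   with r = s + k, then (x)Phi^(s0 + k) ~ (y)Phi^s0 for a constant s0.

   To bound k, set y' = (y)Phi^s0.  The cyclic Magnus coefficients of (u)Phi^i,
   as functions of i, satisfy linear recurrences whose characteristic roots are
   products of eigenvalues of the abelianisation of Phi, so the roots of unity
   among them have order dividing an explicit d.  If (y')Phi^d ~ y', then k can
   be reduced modulo d.  Otherwise a Magnus coefficient of explicitly bounded
   degree separates the two; it gives integer sequences e, g with
   e(i + k) = g(i) and g(d) <> g(0).  For large k, Kronecker's theorem forces
   the characteristic roots involved to be roots of unity, so e is polynomial
   on residue classes modulo d and, not being constant there, outgrows g.

   All bounds are towers of exponentials of fixed height in the input, so an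
   exhaustive search below such a tower decides the problem. *)

Require Import Defs.
From mathcomp Require Import all_boot all_order all_algebra all_field zify ring.
From mathcomp Require Import perm boolp.
From mathcomp.real_closed Require Import mxtens.

Set Implicit Arguments.
Unset Strict Implicit.
Unset Printing Implicit Defensive.

Import Order.TTheory GRing.Theory Num.Theory.

(** * Units modulo d *)

(** Traces in a fixed list of dimensions express conjugacy by polynomial identities on products of
    general linear groups, so the constant [s0] depends on [n] and [m] only, not on the words. The
    number 7 arises as follows: every residue modulo a divisor of the length is a sum of at most 3
    units, and one step of the argument that recognises a character on the Fourier support compares
    3 terms with 1 + 3. Traces alone do not bound [k], as substitution acts nonlinearly on
    representations; on truncated Magnus series it acts by an integer matrix, whence the linear
    recurrences. The two criteria are linked by deforming a representation to the trivial one, which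
    also yields the explicit degree of a separating coefficient. For [n <= 1] the group is abelian
    and [Phi] may mix the two factors, so conditions on the [F_n]-component are guarded by [2 <= n]
    and exponent sums do the rest. *)

Lemma exists_avoiding (s : seq nat) (f : nat -> nat) :
  uniq s -> all prime s -> exists u, forall p, p \in s -> u = f p %[mod p].
Proof.
elim: s => [|p s IH] /=; first by exists 0.
case/andP=> psN us /andP[pp pr]; have [u hu] := IH us pr.
have co : coprime p (\prod_(q <- s) q).
  rewrite prime_coprime //; apply/negP; rewrite big_seq.
  elim/big_ind: _ => [|a b ha hb|q qs].
  - by rewrite dvdn1 => /eqP p1; rewrite p1 in pp.
  - by rewrite Euclid_dvdM // => /orP[/ha|/hb].
  - by rewrite dvdn_prime2 ?(allP pr _ qs) // => /eqP E; move: psN; rewrite E qs.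
exists (chinese p (\prod_(q <- s) q) (f p) u) => q; rewrite inE => /orP[/eqP->|qs].
  by rewrite chinese_modl.
rewrite -(hu _ qs).
have dv : q %| \prod_(q <- s) q by rewrite (big_rem q) //= dvdn_mulr.
by rewrite -(modn_dvdm _ dv) chinese_modr // modn_dvdm.
Qed.

Lemma coprime_primes d u : 0 < d ->
  (forall p, p \in primes d -> ~~ (p %| u)) -> coprime d u.
Proof.
move=> d0 h; apply/negPn/negP=> nc.
have g1 : 1 < gcdn d u.
  by rewrite ltn_neqAle gcdn_gt0 d0 andbT eq_sym; move: nc; rewrite /coprime.
have pg := pdiv_prime g1.
have := h (pdiv (gcdn d u)).
rewrite mem_primes pg d0 /= (dvdn_trans (pdiv_dvd _) (dvdn_gcdl _ _)).
by rewrite (dvdn_trans (pdiv_dvd _) (dvdn_gcdr _ _)) => /(_ isT).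
Qed.

(** Modulo each prime [p] dividing [d], [u] must avoid 0 and [x]. A residue is left whenever
    [p >= 3]; for [p = 2] it has to be 1, which forces [x] to be even. *)
Lemma sum_of_two_units d x : 0 < d -> odd d || ~~ odd x ->
  exists u w, [/\ coprime d u, coprime d w & u + w = x %[mod d]].
Proof.
move=> d0 hx.
pose f p := if x %% p == 1 then 2 else 1.
have [|u hu] := @exists_avoiding (primes d) f (primes_uniq d).
  by apply/allP=> p; rewrite mem_primes => /andP[].
have np p : p \in primes d -> ~~ (p %| u) /\ u <> x %[mod p].
  move=> pd; have := hu _ pd; rewrite /dvdn => ->.
  have := pd; rewrite mem_primes d0 /= => /andP[pp dp].
  have p1 := prime_gt1 pp.
  have h1 : 1 %% p = 1 by rewrite modn_small.
  case: (ltngtP p 2) => [|p2|p2]; first lia.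
    rewrite /f; case: (x %% p =P 1) => hx1; rewrite ?(modn_small p2) ?h1 ?hx1; split=> //.
    by move=> E; apply: hx1.
  subst p; have xe : x %% 2 = 0.
    by move: hx dp; rewrite dvdn2 => /orP[->//|/negbTE]; rewrite modn2 => ->.
  by rewrite /f xe.
(* The second unit is [x - u] modulo [d], written without subtraction. *)
exists u, (x + u * d.-1); split.
- by apply: coprime_primes => // p /np[].
- apply: coprime_primes => // p pd; have [_ ne] := np p pd; apply/negP=> dv; apply: ne.
  have dp : p %| d by move: pd; rewrite mem_primes => /and3P[].
  have: x + u * d = u %[mod p].
    have -> : x + u * d = (x + u * d.-1) + u by rewrite -{1}(prednK d0) mulnS; lia.
    by rewrite -modnDml (eqP dv).
  by rewrite -modnDmr -modnMmr (eqP dp) muln0 mod0n addn0.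
- have -> : u + (x + u * d.-1) = u * d + x by rewrite -{2}(prednK d0) mulnS; lia.
  by rewrite -modnDml modnMl.
Qed.

(** When [d] is even and [x] is odd, one summand is spent on 1. *)
Lemma sum_of_three_units d x : 0 < d ->
  exists us, [/\ size us <= 3, all (coprime d) us & sumn us = x %[mod d]].
Proof.
move=> d0; case h: (odd d || ~~ odd x).
  have [u [w [cu cw e]]] := sum_of_two_units d0 h.
  by exists [:: u; w]; split; rewrite //= ?cu ?cw ?addn0.
case: x h => [|x h]; first by rewrite orbT.
have h2 : odd d || ~~ odd x by move: h => /=; lia.
have [u [w [cu cw e]]] := sum_of_two_units d0 h2.
exists [:: 1; u; w]; split; rewrite //= ?coprimen1 ?cu ?cw ?addn0 //.
by rewrite -add1n -modnDmr e modnDmr.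
Qed.

(** * Simultaneous congruences with moduli that are not coprime *)

Lemma crt_gcd m n a b : 0 < m -> 0 < n -> a = b %[mod gcdn m n] ->
  exists x, x = a %[mod m] /\ x = b %[mod n].
Proof.
move=> m0 n0 e.
have [c hc] : exists c, b + n * a = a + gcdn m n * c.
  have le : a <= b + n * a by rewrite (leq_trans (leq_pmull a n0)) ?leq_addl.
  have : gcdn m n %| b + n * a - a.
    rewrite -eqn_mod_dvd // -modnDml -e modnDml -modnDmr -modnMml.
    by rewrite (eqP (dvdn_gcdr m n)) mul0n mod0n addn0.
  by case/dvdnP=> c hc; exists c; lia.
case: (egcdnP n m0) => u v euv _.
exists (a + m * (u * c)); split.
  by rewrite -modnDmr modnMr addn0.
have -> : a + m * (u * c) = b + n * (a + v * c).
  have -> : m * (u * c) = (u * m) * c by lia.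
  by rewrite euv; lia.
by rewrite -modnDmr modnMr addn0.
Qed.

Lemma gcdn_lcml a b d : gcdn (lcmn a b) d = lcmn (gcdn a d) (gcdn b d).
Proof. exact: (@Order.meetUl _ natdvd). Qed.

Lemma eqn_mod_lcm a b m n :
  m == n %[mod a] -> m == n %[mod b] -> m == n %[mod lcmn a b].
Proof.
wlog le : m n / n <= m.
  by case: (leqP n m) => [h|/ltnW h] H; [|rewrite ![m %% _ == _]eq_sym]; apply: H.
by rewrite !eqn_mod_dvd // dvdn_lcm => -> ->.
Qed.

Lemma eqn_mod_pmul2l_dvd k a b g l : 0 < k -> k * g %| l ->
  k * a == k * b %[mod l] -> a == b %[mod g].
Proof.
move=> k0 dv; wlog le : a b / b <= a.
  case: (leqP b a) => [h|/ltnW h] H; first exact: H.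
  by move=> e; rewrite eq_sym; apply: H; rewrite // eq_sym.
rewrite !eqn_mod_dvd ?leq_mul2l ?le ?orbT // -mulnBr => /(dvdn_trans dv).
by rewrite dvdn_pmul2l.
Qed.

(** Two congruences merge when they agree modulo the gcd; compatibility passes to the lcm of the
    moduli already merged because gcd distributes over lcm. *)
Lemma crt_compatible (s : seq (nat * nat)) :
  (forall x, x \in s -> 0 < x.1) ->
  (forall x y, x \in s -> y \in s -> x.2 = y.2 %[mod gcdn x.1 y.1]) ->
  exists j, forall x, x \in s -> j = x.2 %[mod x.1].
Proof.
move=> p0; pose L := foldr (fun x : nat * nat => lcmn x.1) 1.
elim: s p0 => [|[d j] s IH] p0 comp; first by exists 0.
have [||J HJ] := IH; first by move=> x xs; apply: p0; rewrite inE xs orbT.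
  by move=> x y xs ys; apply: comp; rewrite inE ?xs ?ys orbT.
have L0 (t : seq (nat * nat)) : (forall x, x \in t -> 0 < x.1) -> 0 < L t.
  elim: t => //= x t IHt h; rewrite lcmn_gt0 h ?mem_head // IHt // => y yt.
  by apply: h; rewrite inE yt orbT.
have dL (t : seq (nat * nat)) x : x \in t -> x.1 %| L t.
  elim: t => //= y t IHt; rewrite inE => /orP[/eqP->|/IHt h]; first exact: dvdn_lcml.
  exact: dvdn_trans h (dvdn_lcmr _ _).
have key (t : seq (nat * nat)) : {subset t <= s} -> J = j %[mod gcdn (L t) d].
  elim: t => [|x t IHt] sub /=; first by rewrite gcd1n !modn1.
  rewrite gcdn_lcml; apply/eqP.
  have h1 : J == j %[mod gcdn x.1 d].
    have xs : x \in s by apply: sub; rewrite mem_head.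
    have /(_ _ _)/esym := comp (d, j) x; rewrite mem_head inE xs orbT => /(_ isT isT) /= h.
    rewrite gcdnC -h gcdnC -[X in X == _](modn_dvdm _ (dvdn_gcdl x.1 d)) HJ //.
    by rewrite modn_dvdm ?dvdn_gcdl.
  have h2 : J == j %[mod gcdn (L t) d].
    by apply/eqP/IHt => y yt; apply: sub; rewrite inE yt orbT.
  exact: eqn_mod_lcm.
have [|||x [hx1 hx2]] := @crt_gcd (L s) d J j.
- by apply: L0 => x xs; apply: p0; rewrite inE xs orbT.
- exact: (p0 (d, j) (mem_head _ _)).
- exact: key.
exists x => y; rewrite inE => /orP[/eqP->//|ys].
by rewrite -(modn_dvdm _ (dL _ _ ys)) hx1 modn_dvdm ?dL // HJ.
Qed.

(** * Rotations and Fourier products *)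

Local Open Scope ring_scope.

Definition dft (z : algC) (s : seq nat) (k : nat) : algC :=
  \sum_(p < size s) (nth 0%N s p)%:R * z ^+ (k * p).

Section Dft.

Variables (l : nat) (z : algC).
Hypothesis (l0 : (0 < l)%N) (pz : l.-primitive_root z).

Lemma dft_rot1 s k : size s = l -> z ^+ k * dft z (rot 1 s) k = dft z s k.
Proof.
case: s => [|x s] sz; first by rewrite /dft /= !big_ord0 mulr0.
rewrite /dft size_rot rot1_cons /= big_ord_recr big_ord_recl /= mulrDr addrC.
congr (_ + _).
  rewrite nth_rcons ltnn eqxx mulrCA -exprD -mulnS muln0 expr0; congr (_ * _).
  by move: sz => /= ->; rewrite mulnC exprM (prim_expr_order pz) expr1n.
rewrite big_distrr /=; apply: eq_bigr => i _.
by rewrite nth_rcons ltn_ord mulrCA -exprD -mulnS.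
Qed.

Lemma dft_iter_rot s k i : size s = l ->
  z ^+ (i * k) * dft z (iter i (rot 1) s) k = dft z s k.
Proof.
move=> sz; elim: i => [|i IH]; first by rewrite mul0n expr0 mul1r.
rewrite mulSn exprD [z ^+ k * _]mulrC -mulrA iterS dft_rot1 //.
by elim: (i) => //= j; rewrite size_rot.
Qed.

(** Equal transforms make a polynomial of degree below [l] vanish at all [l] roots of unity. *)
Lemma dft_inj s t : size s = l -> size t = l ->
  (forall k, dft z s k = dft z t k) -> s = t.
Proof.
move=> ss st H; apply: (@eq_from_nth _ 0%N) => [|i]; rewrite ?ss ?st // => il.
pose p : {poly algC} := \poly_(i < l) ((nth 0%N s i)%:R - (nth 0%N t i)%:R).
have p0 : p = 0.
  apply: (@roots_geq_poly_eq0 _ p [seq z ^+ (k : 'I_l) | k : 'I_l]).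
  - apply/allP=> _ /mapP[k _ ->]; apply/rootP; rewrite horner_poly.
    transitivity (dft z s k - dft z t k); last by rewrite H subrr.
    rewrite /dft ss st -sumrB; apply: eq_bigr => j _.
    by rewrite mulrBl exprM.
  - rewrite map_inj_uniq ?enum_uniq // => k k' /eqP.
    by rewrite (eq_prim_root_expr pz) !modn_small // => /eqP /val_inj.
  - by rewrite size_map size_enum_ord size_poly.
have /eqP := congr1 (fun q : {poly algC} => q`_i) p0.
by rewrite coef_poly il coef0 subr_eq0 eqr_nat => /eqP.
Qed.

(* Galois conjugation permutes the values of the transform at e * c. *)
Lemma dft_unit0 s e c : size s = l -> (e %| l)%N -> coprime (l %/ e) c ->
  (dft z s (e * c) == 0) = (dft z s e == 0).
Proof.
move=> ss el co; rewrite coprime_sym in co.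
have [nu hnu] := Qn_aut_exists co.
have -> : dft z s (e * c) = nu (dft z s e); last by rewrite fmorph_eq0.
rewrite /dft rmorph_sum; apply: eq_bigr => p _ /=.
rewrite rmorphM /= rmorph_nat; congr (_ * _).
rewrite hnu; first by rewrite -exprM mulnAC.
by rewrite -exprM mulnAC (mulnC e) divnK // exprM (prim_expr_order pz) expr1n.
Qed.

(** Each frequency is a divisor [e] of [l] times a unit modulo [l %/ e], so by [dft_unit0] the
    support of a transform is determined by the divisors in it. *)
Lemma gcd_decomposition k : let e := gcdn k l in
  exists c, k = (e * c)%N /\ coprime (l %/ e) c.
Proof.
move=> e; have e0 : (0 < e)%N by rewrite gcdn_gt0 l0 orbT.
have [ek el] : (e %| k /\ e %| l)%N by rewrite dvdn_gcdl dvdn_gcdr.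
exists (k %/ e)%N; rewrite [(e * _)%N]mulnC divnK //; split=> //.
rewrite /coprime -(eqn_pmul2l e0) muln1 muln_gcdr ![(e * (_ %/ _))%N]mulnC.
by rewrite !divnK // gcdnC.
Qed.

Lemma coprime_predl e : (e %| l)%N -> coprime (l %/ e) l.-1.
Proof.
move=> el; apply: (@coprime_dvdl _ l); first by rewrite -{2}(divnK el) dvdn_mulr.
by rewrite -{1}(prednK l0) coprimeSn.
Qed.

Lemma dft_opp0 s k : size s = l -> (dft z s (k * l.-1) == 0) = (dft z s k == 0).
Proof.
move=> ss; have [c [kc co]] := gcd_decomposition k; move: kc co.
move: (gcdn k l) (dvdn_gcdr k l) => e el -> co.
by rewrite -mulnA !dft_unit0 // coprimeMr co coprime_predl.
Qed.

(** A rotation multiplies the transform by a character, which zero-sum products of coefficients do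
    not see. Conversely, the quotient [h] of the transforms has to be recognised as [z ^+ (J * k)]
    on the support, although the support need not be a subgroup. *)
Lemma dft_rotation s t : size s = l -> size t = l ->
  (forall ks : seq nat, (size ks <= 7)%N -> (l %| sumn ks)%N ->
    \prod_(k <- ks) dft z s k = \prod_(k <- ks) dft z t k) ->
  exists i, s = iter i (rot 1) t.
Proof.
move=> ss st H; pose A := dft z s; pose B := dft z t.
have ll k : (l %| k + k * l.-1)%N by rewrite -mulnS prednK // dvdn_mull.
have AB0 k : (B k == 0) = (A k == 0).
  have := H [:: k; (k * l.-1)%N] isT; rewrite /= addn0 => /(_ (ll k)).
  rewrite !big_cons !big_nil !mulr1 => /(congr1 (fun x => x == 0)).
  by rewrite !mulf_eq0 !dft_opp0 // !orbb.
pose h k := B k / A k.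
(* Zero-sum tuples of length at most 7 give the relations between values of h. *)
have hmul ks1 ks2 : (size ks1 + size ks2 <= 7)%N ->
    all (fun k => A k != 0) (ks1 ++ ks2) -> sumn ks1 = sumn ks2 %[mod l] ->
    \prod_(k <- ks1) h k = \prod_(k <- ks2) h k.
  rewrite all_cat => sz /andP[a1 a2] e.
  have h1 ks : (size ks <= 7)%N -> all (fun k => A k != 0) ks ->
      (l %| sumn ks)%N -> \prod_(k <- ks) h k = 1.
    move=> szk /allP aa dv; rewrite big_split /= prodfV -H // divff //.
    by rewrite prodf_seq_neq0; apply/allP=> k /aa ->.
  have neg k : A k != 0 -> h (k * l.-1)%N * h k = 1.
    move=> Ak; have := h1 [:: (k * l.-1)%N; k] isT.
    by rewrite /= dft_opp0 // Ak addn0 addnC ll !big_cons big_nil mulr1; apply.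
  have P : \prod_(k <- ks2) h (k * l.-1)%N * \prod_(k <- ks2) h k = 1.
    rewrite -big_split big_seq big1 // => k /(allP a2); exact: neg.
  have Q : \prod_(k <- ks1) h k * \prod_(k <- ks2) h (k * l.-1)%N = 1.
    have := h1 (ks1 ++ [seq (k * l.-1)%N | k <- ks2]).
    rewrite size_cat size_map big_cat big_map /= all_cat a1 all_map /=; apply=> //.
      by apply/allP=> k /(allP a2) /=; rewrite dft_opp0.
    have -> : sumn (ks1 ++ [seq k * l.-1 | k <- ks2]%N) = (sumn ks1 + sumn ks2 * l.-1)%N.
      by rewrite sumn_cat; congr (_ + _)%N; elim: (ks2) => //= k ks ->; rewrite mulnDl.
    by rewrite /dvdn -modnDml e modnDml -/(dvdn _ _) ll.
  by rewrite -[RHS]mul1r -[X in X * _]Q -mulrA P mulr1.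
have AS e c : (e %| l)%N -> coprime (l %/ e) c -> A e != 0 -> A (e * c)%N != 0.
  by move=> el co; rewrite /A dft_unit0.
have ASs e us : (e %| l)%N -> A e != 0 -> all (coprime (l %/ e)) us ->
    all (fun k => A k != 0) [seq (e * c)%N | c <- us].
  by move=> el Ae /allP co; rewrite all_map; apply/allP=> c /co cc /=; exact: AS el cc Ae.
have sume e us : sumn [seq (e * c)%N | c <- us] = (e * sumn us)%N.
  by elim: us => [|c us /= ->]; rewrite ?muln0 // mulnDr.
have mode e x y : (e %| l)%N -> x = y %[mod l %/ e] -> (e * x = e * y %[mod l])%N.
  by move=> el exy; rewrite -(divnK el) [(_ %/ _ * _)%N]mulnC -!muln_modr exy.
(* On the multiples of a divisor e in the support, h is a character. *)
have hpow e x us : (e %| l)%N -> A e != 0 -> (size us <= 3)%N ->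
    all (coprime (l %/ e)) us -> sumn us = x %[mod l %/ e] ->
    \prod_(c <- us) h (e * c)%N = h e ^+ x.
  move=> el Ae; have d0 : (0 < l %/ e)%N by rewrite divn_gt0 ?(dvdn_gt0 l0 el) // dvdn_leq.
  elim: x us => [|x IH] us us3 co su.
    rewrite -(big_map (muln e) xpredT h) (@hmul _ [::]) ?big_nil // ?size_map ?cats0 ?ASs //=.
      by rewrite addn0 (leq_trans us3).
    by rewrite sume (mode _ _ 0%N el su) muln0.
  have [vs [vs3 cov sv]] := sum_of_three_units x d0.
  rewrite -(big_map (muln e) xpredT h).
  (* Up to 3 terms from [us] against [e] and up to 3 terms from [vs]: here the bound 7 is
     attained. *)
  rewrite (@hmul _ (e :: [seq (e * c)%N | c <- vs])) ?big_cons ?big_map ?(IH vs) ?exprS //.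
  - by rewrite /= !size_map; lia.
  - by rewrite all_cat ASs //= Ae ASs.
  - rewrite sume /= sume -mulnS; apply: mode => //.
    by rewrite su -add1n -modnDmr -sv modnDmr add1n.
pose E := [seq e <- divisors l | A e != 0].
have EP e : e \in E -> (e %| l)%N /\ A e != 0.
  by rewrite mem_filter -dvdn_divisors // => /andP[].
have d0 e : (e %| l)%N -> (0 < l %/ e)%N.
  by move=> el; rewrite divn_gt0 ?(dvdn_gt0 l0 el) // dvdn_leq.
(* The exponent [j e] matters only modulo [l %/ e], the order of [z ^+ e]. *)
pose j e := find (fun j => h e == z ^+ (e * j)) (iota 0 l).
have jP e : e \in E -> h e = z ^+ (e * j e).
  move=> /EP[el Ae]; have pe : (l %/ e).-primitive_root (z ^+ e).
    have := exp_prim_root pz e; rewrite (_ : gcdn e l = e) // gcdnC.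
    exact/gcdn_idPr.
  have [|i hi] := prim_rootP pe (x := h e).
    by rewrite -(@hpow e (l %/ e)%N [::]) ?big_nil //= modnn mod0n.
  have hs : has (fun j => h e == z ^+ (e * j)) (iota 0 l).
    apply/hasP; exists (nat_of_ord i); last by rewrite hi exprM.
    by rewrite mem_iota /= add0n (leq_trans (ltn_ord i)) ?leq_div.
  have /eqP := nth_find 0%N hs; rewrite nth_iota ?add0n //.
  by move: hs; rewrite has_find size_iota.
have [||J HJ] := @crt_compatible [seq ((l %/ e)%N, j e) | e <- E].
- by move=> _ /mapP[e /EP[el _] ->] /=; exact: d0.
- move=> _ _ /mapP[e eE ->] /mapP[e' eE' ->] /=.
  have [[el Ae] [el' Ae']] := (EP _ eE, EP _ eE').
  set L := lcmn e e'; have [eL eL'] : (e %| L /\ e' %| L)%N by rewrite dvdn_lcml dvdn_lcmr.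
  have Ll : (L %| l)%N by rewrite dvdn_lcm el.
  have zh a : a \in E -> (a %| L)%N -> z ^+ (L * j a) = h a ^+ (L %/ a).
    by move=> aE aL; rewrite jP // -exprM -{1}(divnK aL) mulnC mulnA mulnAC (mulnC _ a) mulnC.
  (* [L] may lie outside the support, where [h] carries no information. The two powers are compared
     instead through sums of at most 3 units, multiplied by [e] and by [e']. *)
  have Eh : h e ^+ (L %/ e) = h e' ^+ (L %/ e').
    have [us [us3 cou su]] := sum_of_three_units (L %/ e) (d0 _ el).
    have [vs [vs3 cov sv]] := sum_of_three_units (L %/ e') (d0 _ el').
    rewrite -(hpow _ _ us) // -(hpow _ _ vs) //.
    rewrite -(big_map (muln e) xpredT h) -(big_map (muln e') xpredT h).
    apply: hmul; first by rewrite !size_map; exact: (leq_trans (leq_add us3 vs3) (isT : 3 + 3 <= 7)%N).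
      by rewrite all_cat !ASs.
    rewrite !sume (mode _ _ _ el su) (mode _ _ _ el' sv).
    by rewrite -!(mulnC (_ %/ _)%N) !divnK.
  have : (L * j e = L * j e' %[mod l])%N.
    by apply/eqP; rewrite -(eq_prim_root_expr pz) !zh // Eh eqxx.
  have L0 : (0 < L)%N by apply: dvdn_gt0 Ll.
  move/eqP=> LL; apply/eqP; apply: eqn_mod_pmul2l_dvd L0 _ LL.
  have dvg a : (a %| l)%N -> (gcdn (l %/ e) (l %/ e') %| l %/ a)%N -> (a * gcdn (l %/ e) (l %/ e') %| l)%N.
    by move=> al; rewrite -[X in (_ * _ %| X)%N](divnK al) mulnC dvdn_pmul2r // (dvdn_gt0 l0 al).
  by rewrite muln_lcml dvdn_lcm !dvg ?dvdn_gcdl ?dvdn_gcdr.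
have BJ k : B k = z ^+ (J * k) * A k.
  case: (eqVneq (A k) 0) => [Ak|Ak].
    by rewrite Ak mulr0; apply/eqP; rewrite AB0 Ak.
  have [c [kc co]] := gcd_decomposition k; move: Ak kc co.
  move: (gcdn k l) (dvdn_gcdr k l) => e el Ak kc co; move: Ak; rewrite kc => Ak.
  have Ae : A e != 0 by move: Ak; rewrite /A dft_unit0.
  have eE : e \in E by rewrite mem_filter Ae -dvdn_divisors.
  rewrite -(divfK Ak (B _)) -/(h _); congr (_ * _).
  have -> : h (e * c)%N = h e ^+ c.
    by rewrite -(hpow e c [:: c]) ?big_seq1 //= ?co ?addn0.
  rewrite jP // -exprM; apply/eqP; rewrite (eq_prim_root_expr pz) mulnCA mulnA.
  apply/eqP; rewrite -modnMml -(mode e J (j e)) ?modnMml ?(mulnC J) //.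
  by apply: (HJ ((l %/ e)%N, j e)); apply/mapP; exists e.
exists J; apply: dft_inj => //; first by elim: (J) => //= i; rewrite size_rot.
move=> k; apply: (mulfI (x := z ^+ (J * k))); last by rewrite dft_iter_rot // -/(B k) BJ.
by rewrite expf_neq0 // (prim_root_eq0 pz) -lt0n.
Qed.

End Dft.

(** * Traces of tensor products *)

Lemma mxtrace_tens (R : comNzRingType) m n (A : 'M[R]_m) (B : 'M[R]_n) :
  \tr (A *t B) = \tr A * \tr B.
Proof. by rewrite /mxtrace mulr_sum; apply: eq_bigr => i _; rewrite mxE. Qed.

Lemma tens1mx1 (R : comNzRingType) m n : (1%:M : 'M[R]_m) *t (1%:M : 'M_n) = 1%:M.
Proof.
apply/matrixP=> i j; case: (mxtens_indexP i) => i0 i1; case: (mxtens_indexP j) => j0 j1.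
by rewrite tensmxE !mxE (can_eq (@mxtens_indexK _ _)) -natrM mulnb.
Qed.

Lemma unitmx_tens (R : comUnitRingType) m n (A : 'M[R]_m) (B : 'M[R]_n) :
  A \in unitmx -> B \in unitmx -> A *t B \in unitmx.
Proof.
move=> Au Bu; suff /mulmx1_unit[] : (invmx A *t invmx B) *m (A *t B) = 1%:M by [].
by rewrite tensmx_mul !mulVmx // tens1mx1.
Qed.

Section MxEval.

Variables (R : nzRingType) (T : Type) (N : nat).
Implicit Types (f : T -> 'M[R]_N) (u v : seq T).

Definition mxev f u : 'M[R]_N := foldr (fun l A => f l *m A) 1%:M u.

Lemma mxev_cat f u v : mxev f (u ++ v) = mxev f u *m mxev f v.
Proof. by elim: u => [|l u /= ->]; rewrite ?mul1mx // mulmxA. Qed.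

Lemma eq_mxev f g u : f =1 g -> mxev f u = mxev g u.
Proof. by move=> fg; elim: u => //= l u ->; rewrite fg. Qed.

End MxEval.

Lemma mxev_tens (R : comNzRingType) (T : Type) m n (f : T -> 'M[R]_m) (g : T -> 'M[R]_n) u :
  mxev (fun l => f l *t g l) u = mxev f u *t mxev g u.
Proof.
elim: u => [|l u IH] /=; last by rewrite IH tensmx_mul.
by rewrite tens1mx1.
Qed.

(** The value 0 is left out because [ping t] below involves [t^-1]. *)
Lemma poly_eq_horner (p q : {poly algC}) :
  (forall x, x != 0 -> p.[x] = q.[x]) -> p = q.
Proof.
move=> H; apply/eqP; rewrite -subr_eq0; apply/eqP.
apply: (@roots_geq_poly_eq0 _ _ [seq i.+1%:R | i <- iota 0 (size (p - q))]).
- by apply/allP=> _ /mapP[i _ ->]; rewrite rootE !hornerE H ?subrr // pnatr_eq0.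
- by rewrite map_inj_uniq ?iota_uniq // => i j /eqP; rewrite eqr_nat => /eqP [].
- by rewrite size_map size_iota.
Qed.

Section CoefMatrix.

Variables (R : comNzRingType) (N : nat).

Definition mxcoef j (A : 'M[{poly R}]_N) : 'M[R]_N := map_mx (coefp j) A.

Lemma mxcoef_XnM j k (C : 'M[R]_N) (Q : 'M[{poly R}]_N) :
  mxcoef j ('X^k *: map_mx polyC C *m Q) = if (k <= j)%N then C *m mxcoef (j - k) Q else 0.
Proof.
apply/matrixP=> a b; rewrite -scalemxAl !mxE /= coefXnM ltnNge.
case: leqP => _ /=; rewrite ?mxE // coef_sum.
by apply: eq_bigr => i _; rewrite !mxE /= coefCM.
Qed.

Lemma mxcoefD j (A B : 'M[{poly R}]_N) : mxcoef j (A + B) = mxcoef j A + mxcoef j B.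
Proof. by apply/matrixP=> a b; rewrite !mxE /= coefD. Qed.

Lemma mxcoef1 j : mxcoef j 1%:M = (j == 0%N)%:R%:M.
Proof. by apply/matrixP=> a b; rewrite !mxE /= coefMn coef1 mulrnAC; case: (a == b). Qed.

Lemma coef_mxtrace j (A : 'M[{poly R}]_N) : (\tr A)`_j = \tr (mxcoef j A).
Proof. by rewrite /mxtrace coef_sum; apply: eq_bigr => i _; rewrite mxE. Qed.

End CoefMatrix.

(** * Extracting Fourier products from traces of invertible matrices *)

Section CyclicSeparation.

Variables (T : eqType) (wt : T -> nat).

(** This recursion, rather than [2 ^ r], makes matrices of size [tdim r.+1] convertible to tensor
    products of a matrix of size 2 with one of size [tdim r]. *)
Fixpoint tdim r := if r is r'.+1 then (2 * tdim r')%N else 1%N.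

Section Clock.

Variables (l : nat) (z : algC).
Hypothesis (l0 : (0 < l)%N) (pz : l.-primitive_root z).

(** Along a word, the diagonal counts positions in powers of [z ^+ k] while the upper corner
    accumulates the Fourier sum. *)
Definition clock k t : 'M[algC]_2 :=
  \matrix_(i, j) (if i == 0 then if j == 0 then 1 else (wt t)%:R
                  else if j == 0 then 0 else (z ^+ k)^-1).

Let z0 k : z ^+ k != 0.
Proof. by rewrite expf_neq0 // (prim_root_eq0 pz) -lt0n. Qed.

Lemma clock_word k w : let P := mxev (clock k) w in
  P 1 1 = z ^- (k * size w) /\ P 0 1 * z ^+ (k * size w) = z ^+ k * dft z (map wt w) k.
Proof.
elim: w => [|t w [IH1 IH2]] /=.
  by rewrite !mxE muln0 /= expr0 invr1 mul0r /dft big_ord0 mulr0.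
rewrite !mxE !big_ord_recl !big_ord0 !mxE /= !addr0.
have E : lift 0 (0 : 'I_1) = 1 :> 'I_2 by apply/val_inj.
rewrite E mul0r mul1r add0r IH1 mulnS exprD invfM; split=> //.
rewrite mulrDl mulrCA IH2 /dft /= big_ord_recl /= muln0 expr0 mulr1 mulrDr addrC.
congr (_ + _).
  by rewrite -mulrA [X in _ * X]mulrCA mulVf ?z0 // mulr1 mulrC.
rewrite !big_distrr /=; apply: eq_bigr => i _.
by rewrite mulnS exprD add0n; ring.
Qed.

Fixpoint clocks (ks : seq nat) t : 'M[algC]_(tdim (size ks)) :=
  if ks is k :: ks' then clock k t *t clocks ks' t else 1%:M.

(** The trace against [delta_mx 1 0] reads off the upper corner; tensor factors multiply the
    corners. *)
Fixpoint return_mx r : 'M[algC]_(tdim r) :=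
  if r is r'.+1 then delta_mx 1 0 *t return_mx r' else 1%:M.

Lemma tr_return ks w : size w = l ->
  \tr (return_mx (size ks) *m mxev (clocks ks) w) =
  \prod_(k <- ks) (z ^+ k * dft z (map wt w) k).
Proof.
move=> sw; elim: ks => [|k ks IH] /=.
  rewrite big_nil mul1mx; have -> : mxev (fun=> 1%:M) w = 1%:M :> 'M[algC]_1.
    by elim: (w) => //= t s ->; rewrite mul1mx.
  by rewrite mxtrace1.
rewrite mxev_tens tensmx_mul mxtrace_tens IH big_cons; congr (_ * _).
have [_] := clock_word k w; rewrite sw [(k * l)%N]mulnC exprM (prim_expr_order pz) expr1n mulr1 => <-.
rewrite /mxtrace !big_ord_recl big_ord0 !mxE !big_ord_recl !big_ord0 !mxE /=.
by rewrite !mul0r !add0r mul1r addr0 !addr0; congr (mxev _ _ _ _); apply/val_inj.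
Qed.

End Clock.

Section Perturbation.

Variables (N : nat) (B : T -> 'M[algC]_N) (R : 'M[algC]_N).

(** This is [1 + 'X R] times [B t]. The coefficient of ['X] in a product has exactly one factor [R],
    so a singular matrix is reached through invertible ones. The powers ['X^0] and ['X^1] are
    written out to match [mxcoef_XnM]. *)
Definition pencil t : 'M[{poly algC}]_N :=
  'X^0 *: map_mx polyC (B t) + 'X^1 *: map_mx polyC (R *m B t).

Lemma pencil_coef j t (Q : 'M[{poly algC}]_N) : mxcoef j (pencil t *m Q) =
  B t *m mxcoef j Q + (if (0 < j)%N then R *m B t *m mxcoef j.-1 Q else 0).
Proof. by rewrite mulmxDl mxcoefD !mxcoef_XnM leq0n subn0 subn1. Qed.

Lemma pencil_coef0 w : mxcoef 0 (mxev pencil w) = mxev B w.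
Proof. by elim: w => [|t w IH] /=; rewrite ?mxcoef1 // pencil_coef addr0 IH. Qed.

(** The prefix [v] collects the letters already read, so that the induction produces whole rotations
    when started from the empty prefix. *)
Lemma pencil_coef1 v w : \tr (mxev B v *m mxcoef 1 (mxev pencil w)) =
  \sum_(p < size w) \tr (R *m mxev B (drop p w ++ v ++ take p w)).
Proof.
elim: w v => [|t w IH] v /=.
  by rewrite mxcoef1 big_ord0 /= -scalemx1 scale0r mulmx0 mxtrace0.
rewrite pencil_coef pencil_coef0 mulmxDr mxtraceD big_ord_recl /= addrC; congr (_ + _).
  by rewrite cats0 mxtrace_mulC mxev_cat !mulmxA.
have -> : mxev B v *m (B t *m mxcoef 1 (mxev pencil w)) =
    mxev B (rcons v t) *m mxcoef 1 (mxev pencil w).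
  by rewrite -cats1 mxev_cat /= mulmx1 mulmxA.
by rewrite IH; apply: eq_bigr => p _; rewrite cat_rcons.
Qed.

Lemma pencil_horner x w : map_mx (horner_eval x) (mxev pencil w) =
  mxev (fun t => (1%:M + x *: R) *m B t) w.
Proof.
elim: w => [|t w IH] /=; first by rewrite map_mx1.
rewrite map_mxM IH; congr (_ *m _); apply/matrixP=> i j.
rewrite mulmxDl mul1mx -scalemxAl !mxE /= horner_evalE hornerD !hornerM expr0 expr1.
by rewrite hornerX !hornerC mul1r.
Qed.

End Perturbation.

Lemma return_sqr0 r : (0 < r)%N -> return_mx r *m return_mx r = 0.
Proof.
case: r => //= r _; rewrite tensmx_mul mul_delta_mx_0 // ?tens0mx //.
Qed.

Lemma rot_iter (w : seq T) p : (p <= size w)%N -> rot p w = iter p (rot 1) w.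
Proof. by elim: p => [|p IH] ps; rewrite ?rot0 // rotS // IH // ltnW. Qed.

(** A trace only gives access to the sum over all rotations. The zero-sum condition on [ks] makes
    its [l] terms equal, and the factor [l] cancels. *)
Lemma dft_products (u v : seq T) (ks : seq nat) (z : algC) :
  (0 < size u)%N -> size v = size u -> (size u).-primitive_root z ->
  (size u %| sumn ks)%N ->
  (forall E : T -> 'M[algC]_(tdim (size ks)), (forall t, E t \in unitmx) ->
    \tr (mxev E u) = \tr (mxev E v)) ->
  \prod_(k <- ks) dft z (map wt u) k = \prod_(k <- ks) dft z (map wt v) k.
Proof.
move=> l0 sv pz dv H; set l := size u in l0 sv pz dv.
(* Without frequencies [R] would be 1 instead of squaring to zero. *)
case: ks dv H => [|k0 ks0]; first by rewrite !big_nil.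
move: (k0 :: ks0) (isT : (0 < size (k0 :: ks0))%N) => {k0 ks0} ks ks0 dv H.
pose B := clocks z ks; pose R := return_mx (size ks).
have Bu t : B t \in unitmx.
  rewrite /B; elim: (ks) => [|k ks' IH] /=; first exact: unitmx1.
  apply: unitmx_tens => //; rewrite unitmxE unitfE (expand_det_col _ 0).
  rewrite !big_ord_recl big_ord0 /cofactor !det_mx11 !mxE /=.
  rewrite mul0r !addr0 mul1r expr0 mul1r invr_eq0.
  by rewrite expf_neq0 // (prim_root_eq0 pz) -lt0n.
have key w : size w = l ->
    \tr (mxcoef 1 (mxev (pencil B R) w)) = l%:R * \prod_(k <- ks) dft z (map wt w) k.
  move=> sw; have := pencil_coef1 B R [::] w; rewrite /= mul1mx => ->.
  rewrite sw mulr_natl -[l in RHS]card_ord -sumr_const; apply: eq_bigr => p _.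
  have pl : (p <= size w)%N by rewrite sw ltnW.
  rewrite -/(rot p w) (tr_return l0 pz) ?size_rot //.
  have zs i : \prod_(k <- ks) z ^+ (i * k) = 1.
    transitivity (z ^+ (i * sumn ks)); last first.
      by apply/eqP; rewrite -(prim_order_dvd pz) dvdn_mull.
    by elim: (ks) => [|k s IH]; rewrite ?big_nil ?muln0 // big_cons IH -exprD -mulnDr.
  rewrite big_split /= [X in X * _](eq_bigr (fun k => z ^+ (1 * k))); last by move=> k _; rewrite mul1n.
  rewrite zs mul1r -[LHS]mul1r -[X in X * _ = _](zs p) -big_split /=; apply: eq_bigr => k _.
  rewrite rot_iter //.
  have -> : map wt (iter p (rot 1) w) = iter p (rot 1) (map wt w).
    by elim: (nat_of_ord p) => //= i <-; rewrite map_rot.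
  by rewrite (dft_iter_rot pz) // size_map.
suff : l%:R * \prod_(k <- ks) dft z (map wt u) k = l%:R * \prod_(k <- ks) dft z (map wt v) k.
  by apply: mulfI; rewrite pnatr_eq0 -lt0n.
rewrite -!key // -!coef_mxtrace.
have -> : \tr (mxev (pencil B R) u) = \tr (mxev (pencil B R) v); last by [].
apply: poly_eq_horner => x _.
rewrite -!horner_evalE -!trace_map_mx !pencil_horner; apply: H => t.
rewrite unitmx_mul Bu andbT.
suff /mulmx1_unit[] : (1%:M + x *: R) *m (1%:M - x *: R) = 1%:M by [].
rewrite mulmxDl mul1mx mulmxBr mulmx1 -scalemxAl -scalemxAr return_sqr0 //.
by rewrite !scaler0 subr0 subrK.
Qed.

End CyclicSeparation.

(** * Ping-pong representations *)

Section Representations.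

Variables (R : comUnitRingType) (n N : nat).
Implicit Type rho : 'I_n -> 'M[R]_N.

Definition letter_mx rho (l : letter 'I_n) : 'M[R]_N :=
  if l.2 then invmx (rho l.1) else rho l.1.

Definition rep rho (w : word 'I_n) : 'M[R]_N := mxev (letter_mx rho) w.

Definition inv_rep rho := forall i, rho i \in unitmx.

End Representations.

Definition same_trace n N (u v : word 'I_n) :=
  forall rho : 'I_n -> 'M[algC]_N, inv_rep rho -> \tr (rep rho u) = \tr (rep rho v).

Section PingPong.

Variable n : nat.
Notation L := ('I_n * bool)%type.

Definition reduced_step (a b : L) := b != letter_inv a.
Definition cyc_reduced (w : word 'I_n) := cycle reduced_step w.

Lemma letter_inv_neq (l : L) : letter_inv l != l.
Proof. by case: l => i b; rewrite /letter_inv xpair_eqE eqxx /=; case: b. Qed.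

(** Every basis vector is sent to that of [l], except that of the inverse letter, which is killed:
    products survive along reduced words and vanish along the others. *)
Definition dmx (l : L) : 'M[algC]_#|{: L}| :=
  \matrix_(i, j) ((i == enum_rank l) && (j != enum_rank (letter_inv l)))%:R.

Lemma dmxM a b : dmx a *m dmx b = if b == letter_inv a then 0 else
  \matrix_(i, j) ((i == enum_rank a) && (j != enum_rank (letter_inv b)))%:R.
Proof.
apply/matrixP=> i j; rewrite !mxE (bigD1 (enum_rank b)) //= !mxE eqxx /=.
rewrite big1 ?addr0 => [|k kb]; last by rewrite !mxE (negbTE kb) mulr0.
rewrite (inj_eq enum_rank_inj); case: (b == letter_inv a); rewrite !mxE /= ?andbF ?mul0r //.
by rewrite andbT -natrM mulnb.
Qed.

Lemma dmx_word a w : path reduced_step a w -> mxev dmx (a :: w) =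
  \matrix_(i, j) ((i == enum_rank a) && (j != enum_rank (letter_inv (last a w))))%:R.
Proof.
elim: w a => [|b w IH] a; first by rewrite /= mulmx1.
move=> /= /andP[ab pw]; rewrite -[dmx b *m _]/(mxev dmx (b :: w)) IH //.
apply/matrixP=> i j; rewrite !mxE (bigD1 (enum_rank b)) //= !mxE eqxx /=.
rewrite big1 ?addr0 => [|k kb]; last by rewrite !mxE (negbTE kb) mulr0.
by rewrite (inj_eq enum_rank_inj) [b != _]ab andbT -natrM mulnb.
Qed.

Lemma tr_dmx_word a w : cyc_reduced (a :: w) -> \tr (mxev dmx (a :: w)) = 1.
Proof.
rewrite /cyc_reduced [cycle _ _]/= rcons_path => /andP[pw la]; rewrite dmx_word //.
rewrite /mxtrace (bigD1 (enum_rank a)) //= mxE eqxx /= (inj_eq enum_rank_inj).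
by rewrite [a != _]la big1 ?addr0 // => i ia; rewrite mxE (negbTE ia).
Qed.

Lemma dmx_idem l : dmx l *m dmx l = dmx l.
Proof. by rewrite dmxM eq_sym (negbTE (letter_inv_neq l)). Qed.

Lemma dmx_inv0 l : dmx l *m dmx (letter_inv l) = 0.
Proof. by rewrite dmxM eqxx. Qed.

Lemma dmx_inv0' l : dmx (letter_inv l) *m dmx l = 0.
Proof. by rewrite dmxM letter_invK eqxx. Qed.

Section Rep.

Variable m : nat.
Implicit Type X : 'M[algC]_m.
Notation N := (#|{: L}| * m)%N.

Definition rest l : 'M[algC]_N :=
  1%:M - dmx l *t 1%:M - dmx (letter_inv l) *t 1%:M.

Lemma rest_inv l : rest (letter_inv l) = rest l.
Proof. by rewrite /rest letter_invK addrAC. Qed.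

Lemma rest_mul l X : rest l *m (dmx l *t X) = 0.
Proof. by rewrite /rest !mulmxBl mul1mx !tensmx_mul mul1mx dmx_idem dmx_inv0' tens0mx subr0 subrr. Qed.

Lemma mul_rest l X : (dmx l *t X) *m rest l = 0.
Proof. by rewrite /rest !mulmxBr mulmx1 !tensmx_mul mulmx1 dmx_idem dmx_inv0 tens0mx subr0 subrr. Qed.

Lemma rest_mul' l X : rest l *m (dmx (letter_inv l) *t X) = 0.
Proof. by rewrite -rest_inv rest_mul. Qed.

Lemma mul_rest' l X : (dmx (letter_inv l) *t X) *m rest l = 0.
Proof. by rewrite -rest_inv mul_rest. Qed.

Variable E : L -> 'M[algC]_m.
Hypothesis Eu : forall l, E l \in unitmx.

(** Expansion by [t] towards [l], contraction towards its inverse, identity on a complement. [E l]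
    and [E (letter_inv l)] sit in different blocks, so inverse letters may carry unrelated
    matrices. *)
Definition ping t l : 'M[algC]_N := rest l + t *: (dmx l *t E l)
    + t^-1 *: (dmx (letter_inv l) *t invmx (E (letter_inv l))).

Lemma pingV t l : t != 0 -> ping t l *m ping t (letter_inv l) = 1%:M.
Proof.
move=> t0; rewrite /ping rest_inv letter_invK.
have hC : rest l *m rest l = rest l.
  by rewrite {2}/rest !mulmxBr mulmx1 rest_mul rest_mul' !subr0.
have h1 : rest l + dmx l *t 1%:M + dmx (letter_inv l) *t 1%:M = 1%:M.
  by rewrite /rest addrAC subrK subrK.
move: (rest l) (rest_mul l) (rest_mul' l) (mul_rest l) (mul_rest' l) hC h1.
move=> C e1 e2 e3 e4 hC <-; rewrite !mulmxDl !mulmxDr -!scalemxAl -!scalemxAr !scalerA.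
rewrite e1 e2 e3 e4 hC !tensmx_mul dmx_inv0 dmx_inv0' !dmx_idem !tens0mx.
by rewrite !scaler0 !addr0 !add0r mulfV // mulVf // !scale1r mulmxV // mulVmx.
Qed.

Definition ping_rep t (i : 'I_n) := ping t (i, false).

Lemma ping_rep_unit t : t != 0 -> inv_rep (ping_rep t).
Proof. by move=> t0 i; case: (mulmx1_unit (pingV (i, false) t0)). Qed.

Lemma ping_repE t l : t != 0 -> letter_mx (ping_rep t) l = ping t l.
Proof.
case: l => i [] // t0; rewrite /letter_mx /ping_rep /=.
have := pingV (i, false) t0; rewrite /letter_inv /= => h.
by rewrite -[RHS]mul1mx -(mulVmx (ping_rep_unit t0 i)) -mulmxA h mulmx1.
Qed.

(** ['X] times [ping], which clears [t^-1]: each letter has degree at most 2, with [dmx l *t E l] as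
    coefficient of ['X^2]. *)
Definition ping_poly l : 'M[{poly algC}]_N :=
  'X^1 *: map_mx polyC (rest l) + 'X^2 *: map_mx polyC (dmx l *t E l)
    + 'X^0 *: map_mx polyC (dmx (letter_inv l) *t invmx (E (letter_inv l))).

Lemma ping_poly_horner t w : t != 0 ->
  map_mx (horner_eval t) (mxev ping_poly w) = t ^+ size w *: rep (ping_rep t) w.
Proof.
move=> t0; elim: w => [|l w IH] /=; first by rewrite map_mx1 expr0 scale1r.
rewrite map_mxM IH ping_repE // exprS -scalemxAr [t * _]mulrC -scalerA; congr (_ *: _).
rewrite scalemxAl; congr (_ *m _); apply/matrixP=> i j.
rewrite /ping_poly !mxE /= horner_evalE !hornerD !hornerM !hornerXn !hornerC.
by rewrite !mulrDr !mulrA divff // expr1 expr0 expr2.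
Qed.

Lemma ping_poly_coef w j : (2 * size w <= j)%N ->
  mxcoef j (mxev ping_poly w) = if j == (2 * size w)%N then mxev (fun l => dmx l *t E l) w else 0.
Proof.
elim: w j => [|l w IH] j; last first.
  have -> : (2 * size (l :: w) = 2 + 2 * size w)%N by rewrite /= mulnS.
  move=> jw; rewrite /= 2!mulmxDl 2!mxcoefD !mxcoef_XnM.
  have -> : (0 < j)%N by lia.
  have -> : (1 < j)%N by lia.
  rewrite leq0n subn0 !IH; try lia.
  have -> : (j == 2 * size w)%N = false by lia.
  have -> : (j - 1 == 2 * size w)%N = false by lia.
  have -> : (j - 2 == 2 * size w)%N = (j == 2 + 2 * size w)%N by lia.
  by rewrite !mulmx0 add0r addr0; case: eqP; rewrite ?mulmx0.
by rewrite /= mxcoef1 muln0; case: eqP => _ //; rewrite -scalemx1 scale0r.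
Qed.

End Rep.

(** Growth in [t] detects the length. The leading coefficient then detects the trace of the
    [E]-product, because the ping-pong factor has trace 1 on a nonempty cyclically reduced word. *)
Lemma cyc_reduced_trace m (u v : seq L) : (0 < m)%N ->
  cyc_reduced u -> cyc_reduced v -> same_trace (#|{: L}| * m) u v ->
  size u = size v /\ forall E : L -> 'M[algC]_m, (forall l, E l \in unitmx) ->
    (0 < size u)%N -> \tr (mxev E u) = \tr (mxev E v).
Proof.
move=> m0 cu cv H.
have top (E : L -> 'M[algC]_m) (w : seq L) : cyc_reduced w -> (0 < size w)%N ->
    \tr (mxev (fun l => dmx l *t E l) w) = \tr (mxev E w) :> algC.
  by case: w => // a w cw _; rewrite mxev_tens mxtrace_tens tr_dmx_word // mul1r.
have key (E : L -> 'M[algC]_m) : (forall l, E l \in unitmx) ->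
    'X^(size v) * \tr (mxev (ping_poly E) u) = 'X^(size u) * \tr (mxev (ping_poly E) v).
  move=> Eu; apply: poly_eq_horner => t t0.
  rewrite !hornerM !hornerXn -!horner_evalE -!trace_map_mx !ping_poly_horner //.
  by rewrite !mxtraceZ (H _ (ping_rep_unit Eu t0)) mulrCA.
have one (w : seq L) : \tr (mxev (fun=> 1%:M : 'M[algC]_m) w) = m%:R.
  suff -> : mxev (fun=> 1%:M : 'M[algC]_m) w = 1%:M by rewrite mxtrace1.
  by elim: w => //= a w ->; rewrite mul1mx.
have u1 (l : L) : (1%:M : 'M[algC]_m) \in unitmx := unitmx1 _ _.
have coefE (E : L -> 'M[algC]_m) j (w w' : seq L) : ('X^(size w') * \tr (mxev (ping_poly E) w))`_j =
    if (j < size w')%N then 0 else \tr (mxcoef (j - size w') (mxev (ping_poly E) w)).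
  by rewrite coefXnM; case: ltnP; rewrite // coef_mxtrace.
have sz : size u = size v.
  wlog : u v cu cv H key / (size v < size u)%N.
    move=> W; case: (ltngtP (size v) (size u)) => // h; first exact: W.
    by apply/esym/W => // [rho hr|E Eu]; rewrite ?H ?key.
  (* This index is the leading one for [u], where [E = 1] gives the coefficient [m], and it lies
     beyond the degree of the side of the shorter word [v]. *)
  move=> lt; have := congr1 (fun p : {poly algC} => p`_(size v + 2 * size u)) (key _ u1).
  rewrite !coefE ltnNge leq_addr addKn ping_poly_coef // eqxx top //; last lia.
  rewrite one ltnNge (_ : (size u <= _)%N) /=; last lia.
  rewrite ping_poly_coef; last lia.
  rewrite ifN_eq; last lia.
  by rewrite mxtrace0 => /eqP; rewrite pnatr_eq0; case: (m) m0.
split=> // E Eu u0.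
have := congr1 (fun p : {poly algC} => p`_(size v + 2 * size u)) (key _ Eu).
rewrite !coefE ltnNge leq_addr addKn ping_poly_coef // eqxx top // /= => ->.
rewrite ltnNge (_ : (size u <= _)%N) /=; last lia.
by rewrite sz addKn ping_poly_coef // eqxx top // -sz.
Qed.

Lemma trace_separation (u v : seq L) : cyc_reduced u -> cyc_reduced v ->
  (forall r, (r <= 7)%N -> same_trace (#|{: L}| * tdim r) u v) ->
  exists i, u = iter i (rot 1) v.
Proof.
move=> cu cv H; have td r : (0 < tdim r)%N by elim: r => //= r; rewrite muln_gt0.
have [sz _] := cyc_reduced_trace (td 0%N) cu cv (H 0%N isT).
have [u0|] := posnP (size u).
  by exists 0%N; rewrite /= (size0nil u0) (size0nil (_ : size v = 0%N)) // -sz.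
move=> u0; have [z pz] := C_prim_root_exists u0.
pose wt (l : L) := nat_of_ord (enum_rank l).
have wt_inj : injective wt by move=> a b /val_inj /enum_rank_inj.
have [|||i hi] := @dft_rotation (size u) z u0 pz (map wt u) (map wt v).
- by rewrite size_map.
- by rewrite size_map.
- move=> ks k7 dv; apply: dft_products => // E Eu.
  by have [_] := cyc_reduced_trace (td (size ks)) cu cv (H _ k7); apply.
exists i; apply: (inj_map wt_inj); rewrite hi.
by elim: (i) => //= j ->; rewrite map_rot.
Qed.

End PingPong.

(** * Chains of vanishing ideals *)

Lemma big_tuple_cons (R : nmodType) (T : finType) n (F : seq T -> R) :
  \sum_(t : n.+1.-tuple T) F t = \sum_(x : T) \sum_(t : n.-tuple T) F (x :: t).
Proof.
rewrite pair_big /=.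
rewrite (reindex (fun p : T * n.-tuple T => [tuple of p.1 :: p.2])) //=.
exists (fun t : n.+1.-tuple T => (thead t, [tuple of behead t])) => [[x t] _|t _].
  by congr (_, _); apply/val_inj.
by apply/val_inj; rewrite /= [in RHS](tuple_eta t).
Qed.

Lemma big_tuple0 (R : nmodType) (T : finType) (F : seq T -> R) :
  \sum_(t : 0.-tuple T) F t = F [::].
Proof.
rewrite (bigD1 [tuple]) //= big1 ?addr0 // => t /eqP; case.
by rewrite tuple0.
Qed.

Section PolynomialFunctions.

Variables (X : Type) (I : finType) (coord : I -> X -> algC).

Inductive polyfun : (X -> algC) -> Prop :=
| pf_ext f g : f =1 g -> polyfun f -> polyfun g
| pf_const c : polyfun (fun=> c)
| pf_coord i : polyfun (coord i)
| pf_add f g : polyfun f -> polyfun g -> polyfun (fun x => f x + g x)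
| pf_mul f g : polyfun f -> polyfun g -> polyfun (fun x => f x * g x).

Lemma pf_exp f e : polyfun f -> polyfun (fun x => f x ^+ e).
Proof.
move=> pf; elim: e => [|e IH].
  by apply: pf_ext (pf_const 1) => x; rewrite expr0.
by apply: pf_ext (pf_mul pf IH) => x; rewrite exprS.
Qed.

Lemma pf_sum (J : Type) (s : seq J) (F : J -> X -> algC) :
  (forall j, polyfun (F j)) -> polyfun (fun x => \sum_(j <- s) F j x).
Proof.
move=> pF; elim: s => [|j s IH].
  by apply: pf_ext (pf_const 0) => x; rewrite big_nil.
by apply: pf_ext (pf_add (pF j) IH) => x; rewrite big_cons.
Qed.

Lemma pf_opp f : polyfun f -> polyfun (fun x => - f x).
Proof. by move=> pf; apply: pf_ext (pf_mul (pf_const (-1)) pf) => x; rewrite mulN1r. Qed.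

Definition monomial D (b : {ffun I -> 'I_D}) x := \prod_i coord i x ^+ b i.

(** Degrees are bounded in each coordinate separately, so that there are [D ^ #|I|] monomials for
    the dimension count. *)
Definition boxfun D f :=
  exists c : {ffun I -> 'I_D} -> algC, forall x, f x = \sum_b c b * monomial b x.

Lemma boxfun_sum D (J : finType) (F : J -> X -> algC) (a : J -> algC) f :
  (forall j, boxfun D (F j)) -> (forall x, f x = \sum_j a j * F j x) -> boxfun D f.
Proof.
move=> /boolp.choice [c hc] hf; exists (fun b => \sum_j a j * c j b) => x.
rewrite hf; under eq_bigr => j _ do rewrite hc big_distrr /=.
rewrite exchange_big /=; apply: eq_bigr => b _; rewrite big_distrl /=.
by apply: eq_bigr => j _; rewrite mulrA.
Qed.

Lemma boxfun_monomial D (e : I -> nat) : (forall i, e i < D)%N ->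
  boxfun D (fun x => \prod_i coord i x ^+ e i).
Proof.
move=> eD; pose b : {ffun I -> 'I_D} := [ffun i => Ordinal (eD i)].
exists (fun b' => (b' == b)%:R) => x.
rewrite (bigD1 b) //= eqxx mul1r [X in _ + X]big1 ?addr0 => [|b' /negbTE ->]; last first.
  by rewrite mul0r.
by apply: eq_bigr => i _; rewrite ffunE.
Qed.

Lemma boxfun_mul D1 D2 f g : boxfun D1 f -> boxfun D2 g ->
  boxfun (D1 + D2) (fun x => f x * g x).
Proof.
case=> c hc [c' hc'].
apply: (@boxfun_sum _ _ (fun p : {ffun I -> 'I_D1} * {ffun I -> 'I_D2} =>
   fun x => \prod_i coord i x ^+ (p.1 i + p.2 i)) (fun p => c p.1 * c' p.2)) => [p|x].
  by apply: boxfun_monomial => i; rewrite -addnS leq_add // ltnW.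
rewrite hc hc' big_distrlr pair_big /=; apply: eq_bigr => p _.
rewrite mulrACA; congr (_ * _); rewrite -big_split /=.
by apply: eq_bigr => i _; rewrite exprD.
Qed.

Lemma boxfun_le D1 D2 f : (D1 <= D2)%N -> boxfun D1 f -> boxfun D2 f.
Proof.
move=> le [c hc]; apply: (@boxfun_sum _ _ (fun b : {ffun I -> 'I_D1} =>
   fun x => \prod_i coord i x ^+ b i) c) => // b.
by apply: boxfun_monomial => i; rewrite (leq_trans (ltn_ord _)).
Qed.

Lemma boxfun_const D c : (0 < D)%N -> boxfun D (fun=> c).
Proof.
move=> D0; have [a ha] := @boxfun_monomial D (fun=> 0%N) (fun=> D0).
exists (fun b => c * a b) => x; under eq_bigr do rewrite -mulrA.
rewrite -big_distrr -ha /= big1 ?mulr1 // => i _; exact: expr0.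
Qed.

Lemma polyfun_box f : polyfun f -> exists D, boxfun D f.
Proof.
elim=> {f} [f g fg _ [D [c hc]]|c|i|f g _ [D hf] _ [D' hg]|f g _ [D hf] _ [D' hg]].
- by exists D, c => x; rewrite -fg.
- by exists 1%N; apply: boxfun_const.
- exists 2%N; have [|c hc] := @boxfun_monomial 2 (fun j => (j == i) : nat).
    by move=> j; case: eqP.
  exists c => x; rewrite -hc (bigD1 i) //= eqxx expr1 big1 ?mulr1 // => j /negbTE ->.
  exact: expr0.
- exists (D + D')%N.
  apply: (@boxfun_sum _ bool (fun b : bool => if b then f else g) (fun=> 1)) => [[]|x].
  + exact: boxfun_le (leq_addr _ _) hf.
  + exact: boxfun_le (leq_addl _ _) hg.
  + by rewrite big_bool /= !mul1r.
- by exists (D + D')%N; apply: boxfun_mul.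
Qed.

(** A polynomial in the functions [fs], with coefficients indexed by exponent lists, expanded one
    function at a time so that the lowest power of the first one can be split off. *)
Fixpoint nested D (fs : seq (X -> algC)) (c : seq 'I_D -> algC) x : algC :=
  if fs is f :: fs' then \sum_(e < D) f x ^+ e * nested fs' (fun s => c (e :: s)) x
  else c [::].

Fixpoint power_prod (fs : seq (X -> algC)) (s : seq nat) x : algC :=
  if (fs, s) is (f :: fs', e :: s') then f x ^+ e * power_prod fs' s' x else 1.

Lemma nestedE D fs (c : seq 'I_D -> algC) x : nested fs c x =
  \sum_(t : (size fs).-tuple 'I_D) c t * power_prod fs (map val t) x.
Proof.
elim: fs c => [|f fs IH] c /=; first by rewrite (big_tuple0 (fun t : seq 'I_D => c t * 1)) mulr1.
rewrite (big_tuple_cons _ (fun t : seq 'I_D => c t * power_prod (f :: fs) (map val t) x)).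
apply: eq_bigr => e _; rewrite IH big_distrr /=; apply: eq_bigr => t _.
by rewrite mulrCA.
Qed.

Lemma power_prod_box fs D E s : all (fun e => e <= E)%N s ->
  (forall f, List.In f fs -> boxfun D f) ->
  boxfun ((size fs).+1 * (E * D).+1) (power_prod fs s).
Proof.
elim: fs s => [|f fs IH] s; first by move=> _ _; apply: boxfun_const.
case: s => [|e s] /=; first by move=> _ _; apply: boxfun_const.
case/andP=> eE sE hf; have h1 := IH s sE (fun g gi => hf g (or_intror gi)).
have h2 : boxfun (E * D).+1 (fun x => f x ^+ e).
  apply: (@boxfun_le (e * D).+1); first by rewrite ltnS leq_mul2r eE orbT.
  elim: (e) => [|k IHk]; first exact: boxfun_const.
  apply: (@boxfun_le (D + (k * D).+1)); first by rewrite mulSn addnS.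
  have [c hc] := boxfun_mul (hf f (or_introl erefl)) IHk.
  by exists c => x; rewrite exprS hc.
by rewrite mulSn; apply: boxfun_mul.
Qed.

(** There are [D ^ (#|I| + 1)] products of powers below [D], all in the span of at most
    [(Q * D) ^ #|I|] monomials; a linear relation exists once [D] exceeds [Q ^ #|I|]. *)
Lemma algebraic_relation fs : size fs = #|I|.+1 ->
  (forall f, List.In f fs -> polyfun f) ->
  exists D (c : seq 'I_D -> algC), (forall x, nested fs c x = 0) /\
    exists t : (size fs).-tuple 'I_D, c t != 0.
Proof.
move=> sz pf; have [D0 hD0] : exists D, forall f, List.In f fs -> boxfun D f.
  elim: (fs) pf => [|f fs' IH] pf; first by exists 0%N.
  have [D1 h1] := polyfun_box (pf f (or_introl erefl)).
  have [D2 h2] := IH (fun g gi => pf g (or_intror gi)).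
  exists (D1 + D2)%N => g [<-|gi]; first exact: boxfun_le (leq_addr _ _) h1.
  exact: boxfun_le (leq_addl _ _) (h2 g gi).
pose Q := ((size fs).+1 * D0.+1)%N; pose D := (Q ^ #|I|).+1.
pose B := ((size fs).+1 * (D * D0).+1)%N.
have BQ : (B <= Q * D)%N by rewrite /B /Q -mulnA leq_mul2l /= mulSn [(D0 * D)%N]mulnC -add1n leq_add2r.
have cnt : (B ^ #|I| < D ^ #|I|.+1)%N.
  apply: (@leq_ltn_trans ((Q * D) ^ #|I|)); first by case: #|I| => // k; rewrite leq_exp2r.
  by rewrite expnMn expnS ltn_pmul2r ?expn_gt0.
have hb (t : (size fs).-tuple 'I_D) : boxfun B (power_prod fs (map val t)).
  by apply: power_prod_box hD0; apply/allP=> _ /mapP[e _ ->]; apply: ltnW; apply: ltn_ord.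
have [a ha] := boolp.choice hb.
pose M := \matrix_(i < #|{: (size fs).-tuple 'I_D}|, j < #|{: {ffun I -> 'I_B}}|)
  a (enum_val i) (enum_val j).
have : kermx M != 0.
  rewrite -mxrank_eq0 mxrank_ker subn_eq0 -ltnNge (leq_ltn_trans (rank_leq_col M)) //.
  by rewrite card_tuple card_ffun !card_ord sz.
case/rowV0Pn=> v /sub_kermxP vM v0.
exists D, (fun s => if insub s is Some t then v 0 (enum_rank (t : (size fs).-tuple 'I_D)) else 0).
split=> [x|].
  rewrite nestedE; under eq_bigr => t _ do rewrite valK ha big_distrr /=.
  rewrite exchange_big big1 //= => b _.
  have := congr1 (fun u : 'rV_#|{: {ffun I -> 'I_B}}| => u 0 (enum_rank b)) vM; rewrite !mxE => e0.
  rewrite -[RHS](mul0r (monomial b x)) -[X in _ = X * _]e0 big_distrl /=.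
  rewrite (reindex (@enum_val _ {: (size fs).-tuple 'I_D})) /=; last first.
    by apply: onW_bij; apply: enum_val_bij.
  by apply: eq_bigr => i _; rewrite !mxE enum_valK enum_rankK mulrA.
have /matrix0Pn[i [j vj]] := v0.
by exists (enum_val j); rewrite valK enum_valK; move: vj; rewrite ord1.
Qed.

End PolynomialFunctions.

(** * Stabilisation of an ascending chain of prime ideals *)

Section Stabilisation.

Variables (X : Type) (I : finType) (coord : I -> X -> algC).
Variables (good : X -> Prop) (T : X -> X) (x0 : X).
Hypothesis good0 : good x0.
Hypothesis goodT : forall x, good x -> good (T x).
Notation polyfun := (polyfun coord).
Hypothesis polyT : forall f, polyfun f -> polyfun (fun x => f (T x)).
Hypothesis domain : forall f g, polyfun f -> polyfun g ->
  (forall x, good x -> f x * g x = 0) ->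
  (forall x, good x -> f x = 0) \/ (forall x, good x -> g x = 0).

Definition vanish j (f : X -> algC) := forall x, good x -> f (iter j T x) = 0.

Lemma poly_iter j f : polyfun f -> polyfun (fun x => f (iter j T x)).
Proof. by elim: j f => // j IH f pf; apply: (IH (fun x => f (T x))); apply: polyT. Qed.

Lemma vanishS j f : vanish j f -> vanish j.+1 f.
Proof. by move=> h x gx; rewrite iterSr h //; apply: goodT. Qed.

Lemma vanish_le i j f : (i <= j)%N -> vanish i f -> vanish j f.
Proof. by move=> /subnK <-; elim: (j - i)%N => // k IH /IH; apply: vanishS. Qed.

Lemma vanish_prime j f g : polyfun f -> polyfun g ->
  vanish j (fun x => f x * g x) -> vanish j f \/ vanish j g.
Proof. by move=> pf pg h; apply: domain h; apply: poly_iter. Qed.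

Lemma nested_poly D fs (c : seq 'I_D -> algC) :
  (forall f, List.In f fs -> polyfun f) -> polyfun (nested fs c).
Proof.
elim: fs c => [|f fs IH] c pf /=; first exact: pf_const.
apply: pf_sum => e; apply: pf_mul; last by apply: IH => g gi; apply: pf; right.
by apply: pf_exp; apply: pf; left.
Qed.

(** Each function witnesses that one inclusion in the chain is strict. *)
Fixpoint ascending j (fs : seq (X -> algC)) : Prop :=
  if fs is f :: fs' then [/\ polyfun f, vanish j.+1 f, ~ vanish j f & ascending j.+1 fs']
  else True.

Lemma ascending_poly j fs : ascending j fs -> forall f, List.In f fs -> polyfun f.
Proof.
by elim: fs j => //= f fs IH j [pf _ _ /IH h] g [<-//|]; apply: h.
Qed.

(* The lowest power of the first function can be cancelled by primality; the
   rest of the sum then vanishes one level up, where that function is zero. *)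
Lemma ascending_independent D fs j (c : seq 'I_D -> algC) :
  ascending j fs -> vanish j (nested fs c) ->
  forall t : (size fs).-tuple 'I_D, c t = 0.
Proof.
elim: fs j c => [|f fs IH] j c /=.
  by move=> _ h t; rewrite (tuple0 t) /=; apply: (h x0).
case=> pf f1 fn asc van.
have pfs := ascending_poly asc.
suff H e (eD : (e < D)%N) (t : (size fs).-tuple 'I_D) : c (Ordinal eD :: t) = 0.
  move=> t; case: (tupleP t) => -[e eD] t' /=; exact: H.
elim/ltn_ind: e eD t => e IHe eD.
have IHe' (k : 'I_D) : (k < e)%N -> forall x, nested fs (fun s => c (k :: s)) x = 0.
  move=> ke x; rewrite nestedE big1 // => t _.
  by case: k ke => k kD ke; rewrite IHe // mul0r.
apply: (IH j.+1 (fun s => c (Ordinal eD :: s))) => // x gx.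
pose g y := nested fs (fun s => c (Ordinal eD :: s)) y +
  f y * \sum_(k < D | (e < k)%N) f y ^+ (k - e.+1) * nested fs (fun s => c (k :: s)) y.
have pg : polyfun g.
  apply: pf_add; first exact: nested_poly.
  apply: pf_mul => //.
  have := @pf_sum _ _ coord 'I_D [seq k : 'I_D <- enum 'I_D | (e < k)%N]
    (fun (k : 'I_D) y => f y ^+ (k - e.+1) * nested fs (fun s => c (k :: s)) y).
  move=> H; apply: pf_ext (H _) => [y|k]; first by rewrite big_filter big_enum_cond.
  by apply: pf_mul; [apply: pf_exp|apply: nested_poly].
have : vanish j (fun y => f y ^+ e * g y).
  move=> y gy; rewrite -[RHS](van y gy) /g mulrDr mulrA -exprSr.
  rewrite [RHS](bigID (fun k : 'I_D => (k < e)%N)) /= [X in _ = X + _]big1 ?add0r; last first.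
    by move=> k ke; rewrite IHe' // mulr0.
  rewrite [RHS](bigD1 (Ordinal eD)) ?ltnn //=; congr (_ + _).
  rewrite big_distrr /=; apply: eq_big => [k|k ek].
    by rewrite -leqNgt andbC -(inj_eq val_inj) eq_sym ltn_neqAle.
  by rewrite mulrA -exprD subnKC.
case/(vanish_prime (pf_exp e pf) pg) => [fe|].
  by case: fn => y gy; have /eqP := fe y gy; rewrite expf_eq0 => /andP[_ /eqP].
by move/vanishS/(_ x gx); rewrite /g f1 // mul0r addr0.
Qed.

(** More than [#|I|] strict inclusions would give too many algebraically independent functions, so
    the chain pauses at some level up to [#|I|]. A pause is permanent, because each ideal is the
    preimage of the preceding one under composition with [T]. *)
Lemma vanish_stable f s j : polyfun f -> (#|I| <= j)%N -> vanish s f -> vanish j f.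
Proof.
move=> pf Ij vs.
have [i iI st] : exists2 i, (i <= #|I|)%N &
    forall g, polyfun g -> vanish i.+1 g -> vanish i g.
  apply: contrapT => H.
  have H' i : (i <= #|I|)%N -> exists g, [/\ polyfun g, vanish i.+1 g & ~ vanish i g].
    move=> iI; apply: contrapT => Hi; apply: H; exists i => // g pg v1.
    by apply: contrapT => v2; apply: Hi; exists g.
  have [fs sz asc] : exists2 fs, size fs = #|I|.+1 & ascending 0 fs.
    have : forall m i, (i + m <= #|I|.+1)%N -> exists2 fs, size fs = m & ascending i fs.
      elim=> [|m IHm] i im; first by exists [::].
      have [|fs sz asc] := IHm i.+1; first by rewrite addSnnS.
      have [|g [pg v1 v2]] := H' i; first by rewrite -ltnS (leq_trans _ im) // addnS ltnS leq_addr.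
      by exists (g :: fs); rewrite /= ?sz.
    exact.
  have [D [c [c0 [t /eqP[]]]]] := algebraic_relation sz (ascending_poly asc).
  by apply: (ascending_independent asc) => x _; apply: c0.
have st' k g : polyfun g -> vanish (i + k) g -> vanish i g.
  elim: k g => [|k IH] g pg; first by rewrite addn0.
  rewrite addnS => v; apply: (IH g pg) => x gx.
  have /(IH _ (polyT pg)) v' : vanish (i + k) (fun x => g (T x)) by move=> y gy; apply: (v y gy).
  by apply: (vanish_le (leq_addr k i)) gx; apply: st => // y gy; apply: (v' y gy).
apply: (vanish_le (leq_trans iI Ij)); case: (leqP i s) => [h|h].
  by apply: (st' (s - i)%N) => //; rewrite subnKC.
exact: vanish_le (ltnW h) vs.
Qed.

End Stabilisation.

(** * Stabilisation of trace identities *)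

Section Substitution.

Variables (p q : nat) (ws : 'I_p -> word 'I_q).

Definition letter_image (l : letter 'I_p) : word 'I_q :=
  if l.2 then word_inv (ws l.1) else ws l.1.

Definition subw (w : word 'I_p) : word 'I_q := flatten [seq letter_image l | l <- w].

Lemma subw_cat u v : subw (u ++ v) = subw u ++ subw v.
Proof. by rewrite /subw map_cat flatten_cat. Qed.

Lemma letter_image_inv l : letter_image (letter_inv l) = word_inv (letter_image l).
Proof. by case: l => i []; rewrite /letter_image /= ?word_invK. Qed.

Lemma mxev_subw (R : nzRingType) N (f : letter 'I_q -> 'M[R]_N) w :
  mxev f (subw w) = mxev (fun l => mxev f (letter_image l)) w.
Proof. by elim: w => //= l w <-; rewrite -[l :: w]cat1s subw_cat mxev_cat /subw /= cats0. Qed.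

End Substitution.

Section RepFacts.

Variables (R : comUnitRingType) (q N : nat).
Implicit Type f : letter 'I_q -> 'M[R]_N.

Definition inverse_pairs f := forall l, f l *m f (letter_inv l) = 1%:M.

Lemma mxev_inv f w : inverse_pairs f -> mxev f w *m mxev f (word_inv w) = 1%:M.
Proof.
move=> fV; elim: w => [|l w IH]; first by rewrite mulmx1.
rewrite -cat1s word_inv_cat !mxev_cat -mulmxA (mulmxA (mxev f w)) IH mul1mx.
by rewrite /word_inv /= !mulmx1 fV.
Qed.

Lemma letter_mx_inv rho : inv_rep rho -> inverse_pairs (@letter_mx R q N rho).
Proof. by move=> h [i []]; rewrite /letter_mx /= ?mulVmx ?mulmxV. Qed.

Lemma inverse_pairsE f : inverse_pairs f ->
  inv_rep (fun i => f (i, false)) /\ letter_mx (fun i => f (i, false)) =1 f.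
Proof.
move=> fV; have u i : f (i, false) \in unitmx by case: (mulmx1_unit (fV (i, false))).
split=> // -[i []]; rewrite /letter_mx //=.
by rewrite -[RHS]mul1mx -(mulVmx (u i)) -mulmxA (fV (i, false)) mulmx1.
Qed.

Lemma inverse_pairs_subst p (ws : 'I_p -> word 'I_q) f : inverse_pairs f ->
  forall l, mxev f (letter_image ws l) *m mxev f (letter_image ws (letter_inv l)) = 1%:M.
Proof. by move=> fV l; rewrite letter_image_inv mxev_inv. Qed.

End RepFacts.

Lemma rep_subw (R : comUnitRingType) p q N (ws : 'I_p -> word 'I_q) (rho : 'I_q -> 'M[R]_N) w :
  inv_rep rho -> inv_rep (fun i => rep rho (ws i)) /\
  rep rho (subw ws w) = rep (fun i => rep rho (ws i)) w.
Proof.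
move=> h; have [h1 h2] := inverse_pairsE (inverse_pairs_subst ws (letter_mx_inv h)).
split; first exact: h1.
by rewrite /rep mxev_subw; apply: eq_mxev => l; rewrite -h2.
Qed.

Section TraceStabilisation.

Variables (q N : nat).
Notation X := (letter 'I_q -> 'M[algC]_N).
Notation I := ('I_q * bool * 'I_N * 'I_N)%type.

(** A representation is given by the matrices of all letters, inverses included: inverses are then
    coordinates and substitution is a polynomial map. *)
Definition entry (i : I) (x : X) := x i.1.1 i.1.2 i.2.

Lemma polyfun_word w a b : polyfun entry (fun x => mxev x w a b).
Proof.
elim: w a b => [|l w IH] a b /=; first exact: pf_const.
apply: (@pf_ext _ _ entry (fun x : X => \sum_k x l a k * mxev x w k b)).
  by move=> x; rewrite mxE.
apply: pf_sum => k; apply: pf_mul => //.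
exact: (pf_coord entry (l, a, k)).
Qed.

Section Line.

Variables x0 x1 : X.

Let A i : 'M[{poly algC}]_N :=
  map_mx polyC (x0 (i, false)) + 'X *: map_mx polyC (x1 (i, false) - x0 (i, false)).
Let delta := \prod_i \det (A i).
Let rho t i := map_mx (horner_eval t) (A i).

(** [delta] is the common denominator that the inverse letters bring in. *)
Lemma line_poly f : polyfun entry f -> exists M (p : {poly algC}),
  forall t, delta.[t] != 0 -> f (letter_mx (rho t)) * delta.[t] ^+ M = p.[t].
Proof.
elim=> {f} [f g fg _ [M [p hp]]|c|[[[i b] a] k]|f g _ [M [p hp]] _ [M' [p' hp']]|f g _ [M [p hp]] _ [M' [p' hp']]].
- by exists M, p => t ht; rewrite -fg hp.
- by exists 0%N, c%:P => t _; rewrite mulr1 hornerC.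
- case: b; last first.
    by exists 0%N, (A i a k) => t _; rewrite mulr1 /entry /letter_mx /= mxE.
  exists 1%N, ((\adj (A i)) a k * \prod_(j | j != i) \det (A j)) => t ht.
  have dE : delta.[t] = (\det (A i)).[t] * (\prod_(j | j != i) \det (A j)).[t].
    by rewrite /delta (bigD1 i) //= hornerM.
  have d0 : (\det (A i)).[t] != 0 by move: ht; rewrite dE mulf_eq0 negb_or => /andP[].
  have u : rho t i \in unitmx.
    by rewrite unitmxE unitfE /rho det_map_mx.
  rewrite expr1 /entry /letter_mx /= /invmx u mxE dE hornerM mulrA; congr (_ * _).
  rewrite /rho det_map_mx /= -map_mx_adj !mxE /= !horner_evalE.
  by rewrite mulrAC mulVf ?mul1r.
- exists (M + M')%N, (p * delta ^+ M' + p' * delta ^+ M) => t ht.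
  by rewrite hornerD !hornerM !horner_exp -hp // -hp' // exprD; ring.
- exists (M + M')%N, (p * p') => t ht.
  by rewrite hornerM -hp // -hp' // exprD; ring.
Qed.

(** Irreducibility of a product of general linear groups. On the line through the two points,
    invertibility and the two functions become nonzero polynomials in one variable, which have a
    common nonroot. *)
Lemma line_domain f g : inverse_pairs x0 -> inverse_pairs x1 ->
  polyfun entry f -> polyfun entry g -> f x0 != 0 -> g x1 != 0 ->
  exists2 x, inverse_pairs x & f x * g x != 0.
Proof.
move=> h0 h1 /line_poly[M [p hp]] /line_poly[M' [p' hp']] f0 g1.
have rE t : rho t =1 fun i => x0 (i, false) + t *: (x1 (i, false) - x0 (i, false)).
  move=> i; apply/matrixP=> a b; rewrite !mxE /= horner_evalE hornerD hornerM.
  by rewrite hornerX !hornerC.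
have [u0 e0] := inverse_pairsE h0; have [u1 e1] := inverse_pairsE h1.
have r0 : letter_mx (rho 0) = x0.
  apply/boolp.funext => l; rewrite -e0 /letter_mx.
  by case: l.2; rewrite rE scale0r addr0.
have r1 : letter_mx (rho 1) = x1.
  apply/boolp.funext => l; rewrite -e1 /letter_mx.
  by case: l.2; rewrite rE scale1r addrC subrK.
have dt t : delta.[t] = \prod_i \det (rho t i).
  by rewrite /delta horner_prod; apply: eq_bigr => i _; rewrite /rho det_map_mx.
have d0 : delta.[0] != 0.
  rewrite dt; apply/prodf_neq0 => i _; rewrite rE scale0r addr0 -unitfE -unitmxE.
  exact: u0.
have d1 : delta.[1] != 0.
  rewrite dt; apply/prodf_neq0 => i _; rewrite rE scale1r addrC subrK -unitfE -unitmxE.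
  exact: u1.
have p0 : p != 0.
  apply: contraNneq f0 => pz; have := hp 0 d0; rewrite pz horner0 r0 => /eqP.
  by rewrite mulf_eq0 expf_eq0 (negbTE d0) andbF orbF.
have p'0 : p' != 0.
  apply: contraNneq g1 => pz; have := hp' 1 d1; rewrite pz horner0 r1 => /eqP.
  by rewrite mulf_eq0 expf_eq0 (negbTE d1) andbF orbF.
have de0 : delta != 0 by apply: contraNneq d0 => ->; rewrite horner0.
have [t ht] : exists t, (p * p' * delta).[t] != 0.
  apply: contrapT => H; suff /eqP : p * p' * delta = 0.
    by rewrite !mulf_eq0 (negbTE p0) (negbTE p'0) (negbTE de0).
  apply: poly_eq_horner => t _; rewrite horner0; apply/eqP/negPn/negP => tn.
  by apply: H; exists t.
move: ht; rewrite !hornerM !mulf_eq0 !negb_or => /andP[/andP[pt p't] dt0].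
exists (letter_mx (rho t)).
  apply: letter_mx_inv => i; rewrite unitmxE unitfE.
  by move: dt0; rewrite dt => /prodf_neq0; apply.
by apply/negP => /eqP/(congr1 (fun c => c * delta.[t] ^+ (M + M')));
  rewrite mul0r exprD mulrACA hp // hp' // => /eqP; rewrite mulf_eq0 (negbTE pt) (negbTE p't).
Qed.

End Line.

(** [2 * q * N ^ 2] is the number of coordinates, the level at which [vanish_stable] applies. *)
Lemma same_trace_stable (ws : 'I_q -> word 'I_q) u v s j :
  (2 * q * N ^ 2 <= j)%N ->
  same_trace N (iter s (subw ws) u) (iter s (subw ws) v) ->
  same_trace N (iter j (subw ws) u) (iter j (subw ws) v).
Proof.
move=> jN H; pose T (x : X) : X := fun l => mxev x (letter_image ws l).
pose f (x : X) := \tr (mxev x u) - \tr (mxev x v).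
have iterE k x w : mxev (iter k T x) w = mxev x (iter k (subw ws) w).
  by elim: k x => // k IH x; rewrite iterSr IH -mxev_subw.
have ptr w : polyfun entry (fun x => \tr (mxev x w)).
  by apply: pf_sum => k; apply: polyfun_word.
have pf : polyfun entry f by apply: pf_add (ptr u) (pf_opp (ptr v)).
have goodT x : inverse_pairs x -> inverse_pairs (T x) by move=> h; apply: inverse_pairs_subst.
have one_good : inverse_pairs ((fun=> 1%:M) : X) by move=> l; exact: mulmx1.
have van k : vanish (@inverse_pairs _ q N) T k f <->
    same_trace N (iter k (subw ws) u) (iter k (subw ws) v).
  split=> h.
    move=> rho hr; have := h _ (letter_mx_inv hr); rewrite /f !iterE => /eqP.
    by rewrite subr_eq0 => /eqP.
  move=> x hx; have [ux ex] := inverse_pairsE hx; rewrite /f !iterE.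
  by have := h _ ux; rewrite /rep !(eq_mxev _ ex) => ->; rewrite subrr.
apply/van; apply: (vanish_stable one_good goodT _ _ pf (s := s)).
- move=> f0; elim=> {f0 f pf van} [f g fg _ h|c|i|f g _ hf _ hg|f g _ hf _ hg].
  + by apply: pf_ext h => x; apply: fg.
  + exact: pf_const.
  + exact: polyfun_word.
  + exact: pf_add hf hg.
  + exact: pf_mul hf hg.
- move=> g h pg ph gh; have [|gn] := pselect (forall x, inverse_pairs x -> g x = 0); first by left.
  have [x0 hx0 gx0] : exists2 x, inverse_pairs x & g x != 0.
    apply: contrapT => H0; apply: gn => x hx; apply/eqP/negPn/negP => gx.
    by apply: H0; exists x.
  right => x1 hx1.
  apply/eqP/negPn/negP => hx1n.
  by have [x hx] := line_domain hx0 hx1 pg ph gx0 hx1n; rewrite gh ?eqxx.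
- by rewrite !card_prod card_bool !card_ord; apply: leq_trans jN; rewrite -mulnA mulnn (mulnC 2).
- exact/van.
Qed.

Lemma same_trace_subst p (ws : 'I_p -> word 'I_q) u v :
  same_trace N u v -> same_trace N (subw ws u) (subw ws v).
Proof. by move=> H rho hr; rewrite !(rep_subw _ _ hr).2 H //; apply: (rep_subw ws u hr).1. Qed.

End TraceStabilisation.

(** * Roots of unity of bounded degree *)

(** A prime power exactly dividing [d] is at most twice its totient, hence at most [2 * m]. *)
Lemma dvdn_fact_totient d m : (0 < d)%N -> (totient d <= m)%N -> (d %| (2 * m)`!)%N.
Proof.
move=> d0 tm; apply/dvdn_partP => // p; rewrite mem_primes => /and3P[pp _ pd].
have pe : (0 < logn p d)%N by rewrite logn_gt0 mem_primes pp d0.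
rewrite p_part; apply: dvdn_fact; rewrite expn_gt0 prime_gt0 //=.
have : (totient (p ^ logn p d) <= m)%N.
  apply: leq_trans tm; rewrite -{2}(partnC p d0) p_part totient_coprime.
    by rewrite leq_pmulr // totient_gt0 part_gt0.
  by rewrite -p_part coprime_partC.
rewrite totient_pfactor // => h; apply: leq_trans (_ : 2 * (p.-1 * p ^ (logn p d).-1) <= _)%N.
  rewrite -{1}(prednK pe) expnS mulnA leq_mul2r.
  by have := prime_gt1 pp; lia.
by rewrite leq_mul2l h orbT.
Qed.

(** Adjoining at most [q] roots, each of degree at most [q], gives a field of degree at most
    [q ^ q]; this bounds the totient of the order of any root of unity in it. *)
Definition unity_exponent q := (2 * q ^ q)`!.

Lemma dim_adjoin_roots (L : fieldExtType rat) (P : {poly rat}) q (K : {subfield L}) (rs : seq L) :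
  P != 0 -> (size P <= q.+1)%N -> all (root (map_poly (in_alg L) P)) rs ->
  (\dim <<K & rs>> <= q ^ size rs * \dim K)%N.
Proof.
move=> P0 sP; elim: rs K => [|x rs IH] K /=; first by rewrite adjoin_nil subfield_closed mul1n.
case/andP=> rx /IH h; rewrite adjoin_cons; apply: leq_trans (h _) _.
rewrite dim_Fadjoin expnSr -mulnA leq_mul2l leq_mul2r; apply/orP; right; apply/orP; right.
rewrite -ltnS -size_minPoly; apply: leq_trans sP.
rewrite -(size_map_poly (in_alg L) P); apply: dvdp_leq; first by rewrite map_poly_eq0.
apply: minPoly_dvdp => //; apply: (polyOverSv (sub1v K)).
by apply/polyOver1P; exists P.
Qed.

Lemma root_of_unity_product (P : {poly rat}) q (s ks : seq algC) n :
  P != 0 -> (size P <= q.+1)%N -> (size s <= q)%N ->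
  all (root (map_poly ratr P)) s -> {subset ks <= s} ->
  (0 < n)%N -> (\prod_(x <- ks) x) ^+ n = 1 ->
  (\prod_(x <- ks) x) ^+ unity_exponent q = 1.
Proof.
move=> P0 sP ss rs sub n0 zn; set z := \prod_(x <- ks) x in zn *.
have [Qs [QsC [s1 s1s s1full]]] := num_field_exists s.
have QE : QsC \o in_alg Qs =1 ratr.
  by move=> r; rewrite /= alg_num_field fmorph_rat.
have rs1 : all (root (map_poly (in_alg Qs) P)) s1.
  apply/allP=> x xs; have := allP rs (QsC x); rewrite -s1s map_f // => /(_ isT).
  rewrite -(eq_map_poly QE) map_poly_comp /root horner_map /= fmorph_eq0.
  exact.
have dimQ : (\dim {:Qs} <= q ^ q)%N.
  rewrite -s1full (leq_trans (dim_adjoin_roots 1 P0 sP rs1)) // dimv1 muln1.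
  case: (q) ss sP => [|q'] ss sP; last by rewrite leq_pexp2l // -(size_map QsC) s1s.
  by move: ss; rewrite -s1s size_map leqn0 => /eqP ->.
have [z1 z1z] : exists z1, QsC z1 = z.
  rewrite /z; elim: (ks) sub => [|x ks' IH] sub.
    by exists 1; rewrite big_nil rmorph1.
  have [|y hy] := IH; first by move=> w wk; apply: sub; rewrite inE wk orbT.
  have : x \in s by apply: sub; rewrite mem_head.
  rewrite -s1s => /mapP[x1 _ ->]; exists (x1 * y); rewrite rmorphM /= hy big_cons //.
have [d pd _] := prim_order_exists n0 zn.
have d0 := prim_order_gt0 pd.
(* The minimal polynomial of [z] is cyclotomic of degree [totient d], and it divides the minimal
   polynomial of [z1] in the number field [Qs]. *)
have td : (totient d <= q ^ q)%N.
  have [p [hp _ div]] := minCpolyP z.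
  have sp : size p = (totient d).+1.
    by rewrite -(size_map_poly (ratr : rat -> algC)) -hp (minCpoly_cyclotomic pd) size_cyclotomic.
  have [r hr] := polyOver1P (minPolyOver 1%AS z1).
  have r0 : r != 0.
    rewrite -(map_poly_eq0 (in_alg Qs)) -hr; exact: monic_neq0 (monic_minPoly _ _).
  have rz : (p %| r)%R.
    rewrite -div -(eq_map_poly QE) map_poly_comp -hr -z1z /root horner_map /= fmorph_eq0.
    exact: root_minPoly.
  rewrite -ltnS -sp; apply: leq_trans (dvdp_leq r0 rz) _.
  rewrite -(size_map_poly (in_alg Qs)) -hr size_minPoly ltnS.
  have -> : adjoin_degree 1%AS z1 = \dim <<1; z1>> by rewrite dim_Fadjoin dimv1 muln1.
  exact: leq_trans (dimvS (subvf _)) dimQ.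
have /dvdnP[m E] := dvdn_fact_totient d0 td.
by rewrite /unity_exponent E mulnC exprM (prim_expr_order pd) expr1n.
Qed.

(** * Shifted linear recurrences *)

Lemma char_poly_conj (F : fieldType) n (P B : 'M[F]_n) : P \in unitmx ->
  char_poly (invmx P *m B *m P) = char_poly B.
Proof.
move=> Pu; have e : map_mx polyC (invmx P) *m map_mx polyC P = 1%:M.
  by rewrite -map_mxM mulVmx // map_mx1.
rewrite /char_poly /char_poly_mx.
have -> : 'X%:M - map_mx polyC (invmx P *m B *m P) =
    map_mx polyC (invmx P) *m ('X%:M - map_mx polyC B) *m map_mx polyC P.
  rewrite mulmxBr mulmxBl !map_mxM; congr (_ - _).
  by rewrite mul_mx_scalar -scalemxAl e scalemx1.
by rewrite !det_mulmx mulrAC -det_mulmx e det1 mul1r.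
Qed.

Lemma trig_exp (R : comNzRingType) n (A : 'M[R]_n.+1) j : is_trig_mx A ->
  is_trig_mx (A ^+ j) /\ forall i, (A ^+ j) i i = A i i ^+ j.
Proof.
move=> /is_trig_mxP tA; elim: j => [|j [/is_trig_mxP tB dB]].
  split=> [|i]; first exact: scalar_mx_is_trig.
  by rewrite !expr0 mxE eqxx.
split=> [|i].
  apply/is_trig_mxP => i k ik; rewrite exprS mxE big1 // => l _.
  case: (ltnP i l) => il; first by rewrite tA ?mul0r.
  by rewrite tB ?mulr0 // (leq_ltn_trans il).
rewrite exprS mxE (bigD1 i) //= dB -exprS big1 ?addr0 // => l li.
case: (ltngtP i l) => [il|il|/val_inj il]; first by rewrite tA ?mul0r.
  by rewrite tB ?mulr0.
by rewrite il eqxx in li.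
Qed.

(** By Schur triangularisation, one family [t] of diagonal entries serves all the exponents. *)
Lemma char_poly_exp n (A : 'M[algC]_n.+1) : exists t : 'I_n.+1 -> algC,
  forall j, char_poly (A ^+ j) = \prod_i ('X - (t i ^+ j)%:P).
Proof.
have [P Pu] := Schur A (ltn0Sn n).
have {}Pu := unitarymx_unit Pu.
rewrite /similar_to /= conjumx // => tr; set T := P *m A *m invmx P in tr.
exists (fun i => T i i) => j.
have PA : P *m A = T *m P by rewrite /T mulmxKV.
have -> : A ^+ j = invmx P *m T ^+ j *m P.
  rewrite -mulmxA -[LHS]mul1mx -(mulVmx Pu) -mulmxA; congr (_ *m _).
  elim: j => [|j IH]; first by rewrite !expr0 mulmx1 mul1mx.
  by rewrite !exprS -!mulmxE mulmxA PA -!mulmxA IH.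
rewrite char_poly_conj //; have [tj dj] := trig_exp j tr.
by rewrite char_poly_trig //; apply: eq_bigr => i _; rewrite dj.
Qed.

Lemma det_bound (R : numDomainType) n (A : 'M[R]_n) (b : R) : 0 <= b ->
  (forall i j, `|A i j| <= b) -> `|\det A| <= n`!%:R * b ^+ n.
Proof.
move=> b0 Ab; rewrite /determinant (le_trans (ler_norm_sum _ _ _)) //.
rewrite -card_Sn -sum1_card natr_sum big_distrl /=; apply: ler_sum => s _.
rewrite normrM normr_sign mul1r mul1r normr_prod.
rewrite -[X in _ <= _ ^+ X]card_ord -prodr_const.
by apply: ler_prod => i _; rewrite normr_ge0 Ab.
Qed.

(* Kronecker: the multisets of i-th and j-th powers coincide. *)
Lemma equal_powers_unity n (t : 'I_n -> algC) i j : (0 < i < j)%N ->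
  \prod_k ('X - (t k ^+ i)%:P) = \prod_k ('X - (t k ^+ j)%:P) ->
  forall k, t k = 0 \/ exists2 m, (0 < m)%N & t k ^+ m = 1.
Proof.
move=> /andP[i0 ij] E.
(* [s] matches every [t k ^+ i] with some [t l ^+ j]. On a cycle of [s] of length [m], the value [y]
   then satisfies [y ^+ (i ^ m) = y ^+ (j ^ m)]. *)
have [s hs] : exists s : 'I_n -> 'I_n, forall k, t (s k) ^+ j = t k ^+ i.
  suff H k : exists l, t l ^+ j == t k ^+ i.
    by exists (fun k => xchoose (H k)) => k; apply/eqP/(xchooseP (H k)).
  have : root (\prod_k ('X - (t k ^+ j)%:P)) (t k ^+ i).
    rewrite -E (bigD1 k) //= rootM root_XsubC eqxx //.
  rewrite /root horner_prod => /prodf_eq0[l _]; rewrite hornerXsubC subr_eq0 => /eqP e.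
  by exists l; rewrite e.
have it a k : t k ^+ (i ^ a) = t (iter a s k) ^+ (j ^ a).
  elim: a k => [|a IH] k //; rewrite expnS exprM -hs -exprM mulnC exprM IH -exprM.
  by rewrite -expnSr iterSr.
move=> k; have [a [m [m0 e]]] : exists a m, (0 < m)%N /\ iter a s k = iter (m + a) s k.
  have : ~~ injectiveb (fun a : 'I_n.+1 => iter a s k).
    by apply/injectiveP => /leq_card; rewrite !card_ord ltnn.
  case/injectivePn => a [b ab e].
  wlog lt : a b ab e / (a < b)%N.
    move=> W; case: (ltngtP a b) => [|ba|/val_inj h]; first exact: (W a b).
      by apply: (W b a) => //; rewrite eq_sym.
    by rewrite h eqxx in ab.
  by exists a, (b - a)%N; rewrite subn_gt0 lt subnK // ltnW.
set y := t (iter a s k).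
have ym : y ^+ (i ^ m) = y ^+ (j ^ m).
  by rewrite /y it -iterD -e.
have lt : (i ^ m < j ^ m)%N by rewrite ltn_exp2r.
case: (eqVneq y 0) => [y0|y0].
  left; have := it a k; rewrite -/y y0 => /eqP; rewrite expr0n expn_eq0 (gtn_eqF (leq_trans _ ij)) //.
  by rewrite expf_eq0 => /andP[_ /eqP].
right; exists (i ^ a * (j ^ m - i ^ m))%N.
  by rewrite muln_gt0 expn_gt0 i0 subn_gt0.
rewrite exprM it -/y -exprM mulnC exprM.
have -> : y ^+ (j ^ m - i ^ m) = 1.
  apply: (mulfI (expf_neq0 (i ^ m) y0)).
  by rewrite -exprD subnKC ?mulr1 ?ym // ltnW.
by rewrite expr1n.
Qed.

Lemma coef_prod_bound n (y : 'I_n -> algC) (b : algC) k : 0 <= b ->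
  (forall i, `|y i| <= b) -> `|(\prod_i ('X - (y i)%:P))`_k| <= (1 + b) ^+ n.
Proof.
move=> b0; elim: n y k => [|n IH] y k yb.
  by rewrite big_ord0 coef1 expr0; case: eqP; rewrite ?normr1 ?normr0 ?ler01.
rewrite big_ord_recl mulrBl coefB coefXM coefCM exprS.
apply: le_trans (ler_normB _ _) _; rewrite normrM mulrDl mul1r.
set Q := \prod_(i < n) _; have HQ l : `|Q`_l| <= (1 + b) ^+ n.
  exact: (IH (fun i => y (lift ord0 i))).
have e0 : 0 <= (1 + b) ^+ n by rewrite exprn_ge0 // addr_ge0.
apply: lerD; first by case: eqP => _ //; rewrite normr0.
by apply: ler_pM.
Qed.

(** The sum of the absolute values of the entries of a left eigenvector serves as a norm. *)
Lemma eigenvalue_exp_bound n (N : 'M[algC]_n.+1) k (b : algC) t :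
  root (char_poly N) t -> (forall i j, `|(N ^+ k) i j| <= b) ->
  `|t| ^+ k <= n.+1%:R * b.
Proof.
rewrite -eigenvalue_root_char => /eigenvalueP[v vN v0] Nb.
have vk : v *m N ^+ k = t ^+ k *: v.
  elim: k {Nb} => [|k IH]; first by rewrite !expr0 mulmx1 scale1r.
  by rewrite exprSr -mulmxE mulmxA IH -scalemxAl vN scalerA exprSr.
have [j vj] : exists j, v 0 j != 0.
  by have /matrix0Pn[i [j vj]] := v0; exists j; rewrite -(ord1 i).
pose S := \sum_l `|v 0 l|.
have S0 : 0 < S.
  by rewrite /S (bigD1 j) //= ltr_pwDl ?normr_gt0 // sumr_ge0.
rewrite -normrX -(ler_pM2r S0) {1}/S big_distrr /=.
have -> : n.+1%:R * b * S = \sum_(l < n.+1) \sum_(m < n.+1) `|v 0 m| * b.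
  rewrite sumr_const card_ord -big_distrl /= -/S; ring.
apply: ler_sum => l _; have := congr1 (fun u : 'rV_n.+1 => u 0 l) vk; rewrite !mxE => e.
rewrite -normrM -e; apply: le_trans (ler_norm_sum _ _ _) _.
by apply: ler_sum => m _; rewrite normrM ler_wpM2l.
Qed.

(** A bound on [N ^+ k] controls the eigenvalues of all earlier powers, since [|t| ^ j] is at most
    the maximum of 1 and [|t| ^ k]. The characteristic polynomials of the first [k] powers are
    integral, and fewer than [k] of them fit the bounds, so two coincide and [equal_powers_unity]
    applies. *)
Lemma bounded_power_unity n (N0 : 'M[rat]_n.+1) (k b M : nat) :
  let N := map_mx (ratr : rat -> algC) N0 in
  (forall t, root (char_poly N) t -> t \in Aint) ->
  (forall i j, `|(N ^+ k) i j| <= b%:R) ->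
  ((2 + n.+1 * b) ^ n.+1 <= M)%N -> ((2 * M).+1 ^ n.+2 < k)%N ->
  forall t, root (char_poly N) t -> t = 0 \/ exists2 m, (0 < m)%N & t ^+ m = 1.
Proof.
move=> N NA Nb bM Mk; have [t ht] := char_poly_exp N.
have rt i : root (char_poly N) (t i).
  have := ht 1%N; rewrite expr1 => ->; rewrite /root horner_prod.
  by apply/prodf_eq0; exists i => //; rewrite hornerXsubC expr1 subrr.
have tb i j : (j <= k)%N -> `|t i ^+ j| <= (1 + n.+1 * b)%:R.
  move=> jk; rewrite normrX; have [t1|t1] := real_leP (normr_real (t i)) (@real1 algC).
    by apply: le_trans (exprn_ile1 j (normr_ge0 _) t1) _ => //; rewrite natrD lerDl ler0n.
  apply: le_trans (_ : `|t i| ^+ k <= _); first by apply: ler_weXn2l => //; apply: ltW.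
  apply: le_trans (eigenvalue_exp_bound (rt i) Nb) _.
  by rewrite natrD natrM lerDr ler01.
have NE j : N ^+ j = map_mx ratr (N0 ^+ j).
  elim: j => [|j IH]; first by rewrite !expr0 map_mx1.
  by rewrite !exprS IH -!mulmxE map_mxM.
have co j l : (j <= k)%N -> exists2 c : int, (char_poly (N ^+ j))`_l = c%:~R & (`|c| <= M)%N.
  move=> jk; have /intrP[c hc] : (char_poly (N ^+ j))`_l \in Num.int.
    apply: Cint_rat_Aint.
      by rewrite NE -map_char_poly coef_map /= Crat_rat.
    have : char_poly (N ^+ j) \is a polyOver Aint.
      by rewrite ht rpred_prod // => i _; rewrite polyOverXsubC rpredX // NA.
    by move/polyOverP.
  exists c => //; have h : `|(char_poly (N ^+ j))`_l| <= M%:R.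
    rewrite ht; apply: le_trans (coef_prod_bound l (ler0n _ _) (fun i => tb i j jk)) _.
    by rewrite -[1]/(1%:R) -natrD -natrX ler_nat add1n -[(1 + _).+1]add1n addnA.
  by move: h; rewrite hc -intr_norm -abszE -[M%:R]/((M : int)%:~R) ler_int lez_nat.
(* Adding [M] makes coefficients in the range from [-M] to [M] natural numbers below [2 * M + 1].
   Exponents start at 1, because [equal_powers_unity] needs positive ones. *)
pose enc (j : 'I_k) : {ffun 'I_n.+2 -> 'I_(2 * M).+1} :=
  [ffun l : 'I_n.+2 => inord (absz (Num.floor ((char_poly (N ^+ j.+1))`_l) + M%:Z))].
have : ~~ injectiveb enc.
  apply/injectiveP => /leq_card; rewrite card_ffun !card_ord => h.
  by have := leq_ltn_trans h Mk; rewrite ltnn.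
case/injectivePn => i [j ij e].
have {}e : char_poly (N ^+ i.+1) = char_poly (N ^+ j.+1).
  apply/polyP => l; have [ln|ln] := ltnP l n.+2; last first.
    by rewrite !nth_default // size_char_poly.
  have := congr1 (fun f : {ffun 'I_n.+2 -> 'I_(2 * M).+1} => val (f (Ordinal ln))) e.
  rewrite !ffunE /=.
  have [c -> cM] := co i.+1 l (ltn_ord i); have [c' -> cM'] := co j.+1 l (ltn_ord j).
  rewrite !intrKfloor !inordK; try lia.
  by move=> h; congr (_%:~R); lia.
wlog lt : i j ij e / (i < j)%N.
  move=> W; case: (ltngtP i j) => [|ba|/val_inj h]; first exact: W.
    by apply: (W j i) => //; rewrite eq_sym.
  by rewrite h eqxx in ij.
move=> x; have := ht 1%N; rewrite expr1 => -> ; rewrite /root horner_prod => /prodf_eq0[l _].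
rewrite hornerXsubC expr1 subr_eq0 => /eqP ->.
by apply: (@equal_powers_unity _ t i.+1 j.+1); rewrite -?ht.
Qed.

(** * Finite differences *)

Fixpoint diff d m (f : nat -> int) x : int :=
  if m is m'.+1 then diff d m' f (x + d)%N - diff d m' f x else f x.

Lemma diffS d m f x : diff d m.+1 f x = diff d m f (x + d)%N - diff d m f x.
Proof. by []. Qed.

Lemma diff_bound d m f x (R : nat) :
  (forall t, (t <= m)%N -> (`|f (x + d * t)%N| <= R)%N) -> (`|diff d m f x| <= 2 ^ m * R)%N.
Proof.
elim: m x => [|m IH] x h /=; first by rewrite mul1n; have := h 0%N; rewrite muln0 addn0; apply.
have h1 : (`|diff d m f (x + d)%N| <= 2 ^ m * R)%N.
  by apply: IH => t tm; rewrite -addnA -mulnS; apply: h.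
have h2 : (`|diff d m f x| <= 2 ^ m * R)%N by apply: IH => t tm; apply: h; apply: leqW.
by rewrite expnS; lia.
Qed.

(** An integer-valued polynomial that is not constant cannot be small both near 0 and near a large
    [y]: its last nonzero difference is an integer [c], and the difference one order below moves by
    [c * y]. *)
Lemma diff_growth d w f r y (R : nat) :
  (forall x, diff d w f (r + d * x) = 0) -> diff d 1 f (r + d * y) != 0 ->
  (forall t, (t <= w)%N -> (`|f (r + d * t)%N| <= R)%N) ->
  (forall t, (t <= w)%N -> (`|f (r + d * y + d * t)%N| <= R)%N) ->
  (y <= 2 ^ w * R)%N.
Proof.
move=> + d1 + +; elim: w => [|[|w] IH] d0 b1 b2.
- by move: d1; rewrite /= -addnA -mulnSr [f _]d0 [f (_ + d * y)%N]d0 subrr eqxx.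
- by rewrite d0 eqxx in d1.
have const x : diff d w.+1 f (r + d * x) = diff d w.+1 f r.
  elim: x => [|x IHx]; first by rewrite muln0 addn0.
  have /eqP := d0 x; rewrite diffS subr_eq0 -addnA -mulnSr => /eqP ->.
  exact: IHx.
case: (eqVneq (diff d w.+1 f r) 0) => [z|nz].
  apply: leq_trans (_ : _ <= 2 ^ w.+1 * R)%N _; last by rewrite leq_mul2r leq_exp2l // leqnSn orbT.
  by apply: IH => [x|t tw|t tw]; [rewrite const|apply: b1; apply: leqW|apply: b2; apply: leqW].
have lin x : diff d w f (r + d * x) = diff d w f r + diff d w.+1 f r * x%:Z.
  elim: x => [|x IHx]; first by rewrite muln0 addn0 mulr0 addr0.
  have := const x; rewrite diffS -addnA -mulnSr IHx => e.
  by rewrite -[LHS](subrK (diff d w f r + diff d w.+1 f r * x%:Z)) e intS; ring.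
have h1 : (`|diff d w f r| <= 2 ^ w * R)%N.
  by apply: diff_bound => t tw; apply: b1; do 2 apply: leqW.
have h2 : (`|diff d w f (r + d * y)| <= 2 ^ w * R)%N.
  by apply: diff_bound => t tw; apply: b2; do 2 apply: leqW.
move: h2; rewrite lin => h2; rewrite !expnS.
set a := diff d w f r in h1 h2; set c := diff d w.+1 f r in nz h2; set K := (2 ^ w * R)%N in h1 h2.
have : (absz (c * y%:Z)%R <= 2 * K)%N by move: h1 h2; lia.
rewrite abszM /= => h3; apply: leq_trans (_ : absz c * y <= _)%N.
  by rewrite leq_pmull // absz_gt0.
by rewrite -!mulnA; apply: leq_trans h3 _; rewrite leq_mul2l leq_pmull.
Qed.

(** * Effective bound for a shift between recurrent sequences *)

Definition power_bound D R := (D * (D * R ^ 2) * (D`! * (D * R ^ 2).+1 ^ D))%N.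
(** The first term is the threshold of [bounded_power_unity]. The second bounds a position
    [r + d * y] with offset at most [D + d] and [y] bounded by [diff_growth]. *)
Definition shift_bound D d R :=
  ((2 * (2 + D * power_bound D R) ^ D).+1 ^ D.+1 + (D + d + d * (2 ^ D * R)))%N.

Lemma map_mx_exp (R S : nzRingType) (f : {rmorphism R -> S}) n (A : 'M[R]_n.+1) j :
  map_mx f (A ^+ j) = map_mx f A ^+ j.
Proof.
elim: j => [|j IH]; first by rewrite !expr0 map_mx1.
by rewrite !exprS -IH -!mulmxE map_mxM.
Qed.

(** A kernel vector has an image whose squared length is zero, hence a zero image by positivity over
    [rat]. *)
Lemma row_free_gram (m n : nat) (A : 'M[rat]_(m, n)) : row_free A -> A *m A^T \in unitmx.
Proof.
move=> fA; rewrite -row_free_unit -kermx_eq0; apply/rowV0P => v /sub_kermxP vG.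
apply/eqP; rewrite -(mulmx_free_eq0 _ fA); apply/eqP/matrixP => i j.
have := congr1 (fun u : 'rV_m => (u *m v^T) 0 0) vG.
rewrite mul0mx mulmxA -mulmxA -trmx_mul [RHS]mxE.
move: (v *m A) => u; rewrite mxE => /eqP.
rewrite psumr_eq0 => [/allP/(_ j (mem_index_enum _))|k _]; last by rewrite mxE -expr2 sqr_ge0.
by rewrite mxE -expr2 expf_eq0 /= ord1 => /eqP ->; rewrite mxE.
Qed.

(** The rectangular system has the solution [X = B A^T G^-1], and dividing by the determinant of
    [G], a nonzero integer, enlarges nothing. In [power_bound], [D * R ^ 2] bounds the entries of
    [B A^T], the factorial term those of the adjugate of [G], and the outer [D] the number of
    summands. *)
Lemma gram_power_bound n D (A B : 'M[int]_(n.+1, D)) (X : 'M[rat]_n.+1) (R : nat) :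
  let Aq := map_mx (intr : int -> rat) A in
  (n < D)%N -> row_free Aq -> X *m Aq = map_mx intr B ->
  (forall i j, (`|A i j| <= R)%N) -> (forall i j, (`|B i j| <= R)%N) ->
  forall i j, `|X i j| <= (power_bound D R)%:R.
Proof.
move=> Aq nD fA XA Ab Bb i j; have Gu := row_free_gram fA.
set G := Aq *m Aq^T in Gu.
have XE : X = map_mx intr (B *m A^T) *m invmx G.
  by rewrite map_mxM -XA -map_trmx -[X *m Aq *m _]mulmxA -/G mulmxK.
have prodb (Y Z : 'M[int]_(n.+1, D)) a b : (forall i j, (`|Y i j| <= R)%N) ->
    (forall i j, (`|Z i j| <= R)%N) ->
    `|map_mx intr (Y *m Z^T) a b| <= (D * R ^ 2)%:R :> rat.
  move=> Yb Zb; rewrite mxE -intr_norm -[(D * _)%:R]/((D * R ^ 2)%N%:Z%:~R) ler_int mxE.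
  apply: le_trans (ler_norm_sum _ _ _) _.
  rewrite -[X in _ <= (X * _)%N%:Z]card_ord PoszM -[Posz #|_|]natz mulr_natl -sumr_const.
  apply: ler_sum => l _; rewrite normrM mxE -mulnn PoszM ler_pM //.
    by rewrite -abszE lez_nat.
  by rewrite -abszE lez_nat.
have GE : G = map_mx intr (A *m A^T) by rewrite map_mxM -map_trmx.
have det1 : 1 <= `|\det G|.
  have : \det G != 0 by rewrite -unitfE -unitmxE.
  rewrite GE det_map_mx intr_eq0 => dn; rewrite -intr_norm -[1]/(1%:~R) ler_int.
  by rewrite -gtz0_ge1 normr_gt0.
have adjb (H : 'M[rat]_n.+1) : (forall a b, `|H a b| <= (D * R ^ 2)%:R) ->
    forall a b, `|(\adj H) a b| <= (D`! * (D * R ^ 2).+1 ^ D)%:R.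
  move=> Hb a b; rewrite mxE /cofactor normrM normr_sign mul1r.
  apply: le_trans (@det_bound _ _ _ (D * R ^ 2).+1%:R _ _) _ => //.
    by move=> c c'; rewrite !mxE; apply: le_trans (Hb _ _) _; rewrite ler_nat.
  rewrite -natrX -natrM ler_nat leq_mul ?leq_pexp2l ?(ltnW nD) //.
  exact: leq_fact (ltnW nD).
have invb a b : `|invmx G a b| <= (D`! * (D * R ^ 2).+1 ^ D)%:R.
  rewrite /invmx Gu mxE normrM normfV.
  apply: le_trans (_ : `|(\adj G) a b| <= _).
    by rewrite ler_piMl // invf_le1 // (lt_le_trans ltr01).
  by apply: adjb => c c'; rewrite GE; apply: prodb.
rewrite XE mxE; apply: le_trans (ler_norm_sum _ _ _) _.
rewrite /power_bound -mulnA [X in _ <= X]natrM.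
apply: le_trans (_ : \sum_(l < n.+1) ((D * R ^ 2) * (D`! * (D * R ^ 2).+1 ^ D))%:R <= _).
  by apply: ler_sum => l _; rewrite normrM natrM ler_pM // prodb.
by rewrite sumr_const card_ord -[_ *+ n.+1]mulr_natl ler_wpM2r // ler_nat.
Qed.

Section Recurrence.

Variables (P : {poly algC}) (D : nat).
Hypotheses (Pm : P \is monic) (sP : size P = D.+1).

Definition recurrent (u : nat -> algC) := forall x, \sum_(i < D.+1) P`_i * u (i + x)%N = 0.

Lemma recurrent_eq0 u : recurrent u -> (forall x, (x < D)%N -> u x = 0) -> forall x, u x = 0.
Proof.
move=> ru u0; elim/ltn_ind => x IH; case: (ltnP x D) => [|Dx]; first exact: u0.
have := ru (x - D)%N; rewrite big_ord_recr /= big1 => [|i _]; last first.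
  by rewrite IH ?mulr0 //=; have := ltn_ord i; move: Dx; clear; lia.
have -> : P`_D = 1 by move/monicP: Pm; rewrite lead_coefE sP.
by rewrite add0r mul1r subnKC.
Qed.

Lemma recurrent_geometric u t : recurrent u -> (forall x, u x = t ^+ x * u 0%N) ->
  u 0%N != 0 -> root P t.
Proof.
move=> ru ut u0; have := ru 0%N; rewrite /root horner_coef sP => e.
rewrite -(mulIr_eq0 _ (mulIf u0)) big_distrl -[X in _ == X]e /=; apply/eqP.
by apply: eq_bigr => i _; rewrite -mulrA addn0 -ut.
Qed.

Lemma recurrent_comb (I : finType) (c : I -> algC) (u : I -> nat -> algC) :
  (forall i, recurrent (u i)) -> recurrent (fun x => \sum_i c i * u i x).
Proof.
move=> ru x; under eq_bigr do rewrite big_distrr /=.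
rewrite exchange_big big1 //= => i _; under eq_bigr do rewrite mulrCA.
by rewrite -big_distrr /= ru mulr0.
Qed.

Lemma recurrent_shift u i : recurrent u -> recurrent (fun x => u (i + x)%N).
Proof. by move=> ru x; rewrite -[RHS](ru (i + x)%N); apply: eq_bigr => j _; rewrite addnCA. Qed.

Lemma recurrentB u v : recurrent u -> recurrent v -> recurrent (fun x => u x - v x).
Proof.
by move=> ru rv x; under eq_bigr do rewrite mulrBr; rewrite sumrB ru rv subrr.
Qed.

(** The shift of [e] is realised by a rational matrix [N0] on the first independent rows of a Hankel
    matrix, like a companion matrix of its minimal recurrence. [N0 ^+ k] carries the Hankel matrix
    of [e] to that of [g]; as both have entries up to [R], it is bounded independently of [k]. *)
Lemma shift_of_recurrence (d R k : nat) (e g : nat -> int) : (0 < d)%N ->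
  recurrent (fun x => (e x)%:~R) ->
  (forall t, root P t -> t \in Aint) ->
  (forall t m, root P t -> (0 < m)%N -> t ^+ m = 1 -> t ^+ d = 1) ->
  (forall x, e (k + x)%N = g x) -> g d != g 0%N ->
  (forall x, (x <= (2 * D + 2) * d.+1)%N -> (`|e x| <= R)%N /\ (`|g x| <= R)%N) ->
  (k <= shift_bound D d R)%N.
Proof.
move=> d0 re PA Pu eg gd bd; set L := ((2 * D + 2) * d.+1)%N in bd.
(* [D] columns suffice, because a recurrent sequence is determined by its first [D] values. *)
pose A w := \matrix_(i < w, j < D) e (i + j)%N.
pose Aq w : 'M[rat]_(w, D) := map_mx intr (A w).
have ex : exists w, ~~ row_free (Aq w.+1).
  by exists D; rewrite /row_free neq_ltn ltnS rank_leq_col.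
case: (ex_minnP ex) => w nf minw.
have wD : (w <= D)%N by apply: minw; rewrite /row_free neq_ltn ltnS rank_leq_col.
have fw : row_free (Aq w).
  case: w {nf wD} minw => [|w] minw; first by rewrite /row_free -leqn0 rank_leq_row.
  by apply/negPn/negP => /minw; rewrite ltnn.
have sub : (Aq w.+1 <= Aq w)%MS.
  have le : (Aq w <= Aq w.+1)%MS.
    apply/row_subP => i; have -> : row i (Aq w) = row (widen_ord (leqnSn w) i) (Aq w.+1).
      by apply/rowP => j; rewrite !mxE.
    exact: row_sub.
  have [le1 eq1] := mxrank_leqif_eq le.
  suff /andP[] : (Aq w == Aq w.+1)%MS by [].
  rewrite -eq1 eqn_leq le1 /=; move: nf fw; rewrite /row_free => nf /eqP ->.
  by rewrite -ltnS ltn_neqAle nf rank_leq_row.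
have e0 : ~ forall x, e x = 0.
  by move=> h; move/eqP: gd; apply; rewrite -!eg !h.
(* With [w = 0] the first [D] values of [e] vanish, hence all of them, against [g d != g 0]. *)
case: w nf minw wD fw sub => [|n] nf minw wD fw sub.
  case: e0 => x; apply/eqP; rewrite -(intr_eq0 algC); apply/eqP; move: x.
  apply: recurrent_eq0 => // x xD; have z : Aq 1%N = 0.
    apply/eqP; rewrite -submx0; apply: submx_trans sub _.
    by apply/row_subP => -[].
  have := congr1 (fun B : 'M[rat]_(1, D) => B 0 (Ordinal xD)) z; rewrite !mxE add0n.
  by move=> /eqP; rewrite intr_eq0 => /eqP ->.
pose A' : 'M[int]_(n.+1, D) := \matrix_(i, j) e (i.+1 + j)%N.
have [N0 hN0] : exists N0, map_mx intr A' = N0 *m Aq n.+1.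
  apply/submxP/row_subP => i; apply: submx_trans sub.
  have -> : row i (map_mx intr A') = row (lift ord0 i) (Aq n.+2).
    by apply/rowP => j; rewrite !mxE.
  exact: row_sub.
pose ec x : algC := (e x)%:~R; pose N := map_mx (ratr : rat -> algC) N0.
pose V x : 'cV[algC]_n.+1 := \col_i ec (i + x)%N.
have NV x : N *m V x = V x.+1.
  apply/colP => i; rewrite !mxE; apply/eqP; rewrite -subr_eq0; apply/eqP.
  move: x; apply: recurrent_eq0 => [|x xD].
    apply: recurrentB.
      have := @recurrent_comb 'I_n.+1 (fun j => N i j) (fun j x => ec (j + x)%N).
      move=> h x; rewrite -[RHS](h _ x) => [|j]; last exact: recurrent_shift.
      by apply: eq_bigr => l _; congr (_ * _); apply: eq_bigr => j _; rewrite ?mxE.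
    move=> x; rewrite -[RHS](recurrent_shift i.+1 re x).
    by apply: eq_bigr => l _; rewrite addSnnS.
  have := congr1 (fun B : 'M[rat]_(n.+1, D) => ratr (B i (Ordinal xD)) : algC) hN0.
  rewrite !mxE /= rmorph_sum ratr_int /ec addSnnS => ->; apply/eqP; rewrite subr_eq0; apply/eqP.
  by apply: eq_bigr => j _; rewrite !mxE rmorphM /= ratr_int.
have NkV j x : N ^+ j *m V x = V (x + j)%N.
  elim: j x => [|j IH] x; first by rewrite expr0 mul1mx addn0.
  by rewrite exprSr -mulmxE -mulmxA NV IH addSnnS.
have fAc : row_free (map_mx ratr (Aq n.+1) : 'M[algC]_(n.+1, D)) by rewrite row_free_map.
have Ac i j : map_mx ratr (Aq n.+1) i j = V j i 0 by rewrite !mxE ratr_int.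
have rootN t : root (char_poly N) t -> root P t.
  rewrite -eigenvalue_root_char => /eigenvalueP[v vN v0].
  have geo x : (v *m V x) 0 0 = t ^+ x * (v *m V 0%N) 0 0.
    elim: x => [|x IH]; first by rewrite expr0 mul1r.
    by rewrite -NV mulmxA vN -scalemxAl mxE IH exprS mulrA.
  apply: (@recurrent_geometric (fun x => (v *m V x) 0 0) t) => //.
    have := @recurrent_comb 'I_n.+1 (fun j => v 0 j) (fun j x => ec (j + x)%N).
    move=> h x; rewrite -[RHS](h _ x) => [|j]; last exact: recurrent_shift.
    by apply: eq_bigr => l _; congr (_ * _); rewrite mxE; apply: eq_bigr => j _; rewrite mxE.
  apply: contraNneq v0 => z; rewrite -(mulmx_free_eq0 _ fAc).
  apply/eqP/rowP => j; rewrite [RHS]mxE -[RHS](mulr0 (t ^+ j)) -z -geo !mxE.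
  by apply: eq_bigr => l _; rewrite Ac.
have LE : L = (2 * D + 2 + (2 * (D * d) + 2 * d))%N by rewrite /L mulnS mulnDl -mulnA.
have dw t : (t <= n.+1)%N -> (d * t <= D * d)%N.
  by move=> tw; rewrite mulnC leq_mul2r (leq_trans tw wD) orbT.
rewrite leqNgt; apply/negP => big.
have Xb i j : `|(N0 ^+ k) i j| <= (power_bound D R)%:R.
  pose B : 'M[int]_(n.+1, D) := \matrix_(i, j) g (i + j)%N.
  apply: (@gram_power_bound n D (A n.+1) B) => //.
  - apply: (map_mx_inj (f := (ratr : rat -> algC))); rewrite map_mxM map_mx_exp.
    apply/matrixP => a b; rewrite !mxE /= ratr_int -eg.
    have -> : (k + (a + b) = a + (b + k))%N by rewrite addnC addnA.
    transitivity ((N ^+ k *m V b) a 0); last by rewrite NkV mxE.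
    by rewrite mxE; apply: eq_bigr => l _; rewrite -Ac !mxE.
  - move=> a b; rewrite mxE; apply: (bd _ _).1.
    by rewrite LE; have := ltn_ord a; have := ltn_ord b; move: wD; clear; lia.
  - move=> a b; rewrite mxE; apply: (bd _ _).2.
    by rewrite LE; have := ltn_ord a; have := ltn_ord b; move: wD; clear; lia.
have troot t : root (char_poly N) t -> t = 0 \/ t ^+ d = 1.
  move=> rt; have [] := @bounded_power_unity n N0 k (power_bound D R)
    ((2 + D * power_bound D R) ^ D) _ _ _ _ t rt; [| | | |by left|].
  - by move=> s /rootN; apply: PA.
  - move=> i j; rewrite -map_mx_exp mxE -ratr_norm -(ratr_nat algC) ler_rat; exact: Xb.
  - apply: leq_trans (_ : (2 + D * power_bound D R) ^ n.+1 <= _)%N.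
      by rewrite leq_exp2r // leq_add2l leq_mul2r wD orbT.
    by rewrite leq_pexp2l.
  - apply: leq_ltn_trans big; rewrite /shift_bound.
    by apply: leq_trans (leq_addr _ _); rewrite leq_pexp2l.
  - by move=> [m m0 tm]; right; apply: (Pu t m) => //; apply: rootN.
(* The factor ['X] accounts for the eigenvalue 0. It shifts the index by one at each application,
   whence the restriction to arguments from [n.+1] on in [diff0]. *)
pose theta : {poly algC} := 'X * ('X^d - 1).
have dv : (char_poly N %| theta ^+ n.+1)%R.
  have [t ht] := char_poly_exp N; have := ht 1%N; rewrite expr1 => hN.
  rewrite hN -[X in theta ^+ X]card_ord -prodr_const.
  apply: (big_ind2 (fun a b => a %| b)%R) => [|a b a' b' h h'|i _]; first exact: dvdpp.
    exact: dvdp_mul.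
  rewrite dvdp_XsubCl /root /theta hornerM hornerX hornerD hornerN hornerXn hornerC expr1.
  have [|->|->] := troot (t i); rewrite ?mul0r ?subrr ?mulr0 //.
  rewrite hN /root horner_prod; apply/prodf_eq0; exists i => //.
  by rewrite hornerXsubC expr1 subrr.
have thetaN : (N * (N ^+ d - 1)) ^+ n.+1 = 0.
  have -> : N * (N ^+ d - 1) = horner_mx N theta.
    by rewrite rmorphM rmorphB /= rmorphXn /= horner_mx_X rmorph1.
  rewrite -rmorphXn /=; move/dvdpP: dv => [q ->].
  by rewrite rmorphM /= Cayley_Hamilton mulr0.
have diffV m x : (N * (N ^+ d - 1)) ^+ m *m V x = \col_i (diff d m e (i + x + m)%N)%:~R.
  elim: m x => [|m IH] x; first by rewrite expr0 mul1mx; apply/colP => i; rewrite !mxE addn0.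
  have PV : (N * (N ^+ d - 1)) *m V x = V (x + d).+1 - V x.+1.
    by rewrite -mulmxE -mulmxA mulmxBl NkV mul1mx mulmxBr !NV.
  move: (N * (N ^+ d - 1)) PV IH => Q PV IH; rewrite exprSr -mulmxE -mulmxA PV mulmxBr !IH; apply/colP => i; rewrite !mxE -intrB.
  by congr (_%:~R); rewrite diffS; congr (diff _ _ _ _ - diff _ _ _ _); lia.
have diff0 x : (n.+1 <= x)%N -> diff d n.+1 e x = 0.
  move=> nx; have := congr1 (fun u : 'cV_n.+1 => u 0 0) (diffV n.+1 (x - n.+1)%N).
  by rewrite thetaN mul0mx !mxE /= add0n subnK // => /esym /eqP; rewrite intr_eq0 => /eqP.
have kw : (n.+1 <= k)%N.
  apply: leq_trans (ltnW big); apply: leq_trans wD _; rewrite /shift_bound.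
  by rewrite -!addnA addnCA leq_addr.
(* [r] is congruent to [k] modulo [d] and not below [n.+1], so the whole progression lies where the
   difference vanishes. *)
pose r := (n.+1 + (k - n.+1) %% d)%N; pose y := ((k - n.+1) %/ d)%N.
have kE : k = (r + d * y)%N.
  by rewrite /r /y -addnA [(d * _)%N]mulnC [(_ %% _ + _)%N]addnC -divn_eq subnKC.
have rd : (r <= n.+1 + d)%N by rewrite leq_add2l ltnW // ltn_mod.
have yb : (y <= 2 ^ n.+1 * R)%N.
  apply: (@diff_growth d n.+1 e r y R).
  - by move=> x; apply: diff0; rewrite /r -addnA leq_addr.
  - by rewrite diffS /= -kE eg -[k in e k]addn0 eg subr_eq0.
  - move=> t tw; apply: (bd _ _).1; have := dw t tw; rewrite LE; move: rd wD; clear; lia.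
  - move=> t tw; rewrite -kE eg; apply: (bd _ _).2; have := dw t tw; rewrite LE; clear; lia.
move: big; rewrite ltnNge => /negP; apply; rewrite kE /shift_bound.
apply: leq_trans (leq_addl _ _); apply: leq_add; first exact: leq_trans rd (leq_add wD (leqnn _)).
by rewrite leq_mul2l; apply/orP; right; apply: leq_trans yb _; rewrite leq_mul2r leq_pexp2l ?orbT.
Qed.

End Recurrence.

(** * Magnus coefficients *)

Definition free_eq q : word 'I_q -> word 'I_q -> Prop := pres_eq (fun _ _ => False).

Section Magnus.

Variable q : nat.
Notation W := (seq 'I_q).
Implicit Types (w : W) (f g h : W -> int) (u v : word 'I_q) (i : 'I_q).

(* Noncommutative power series are functions on words; [mag_mul i] and
   [mag_div i] are left multiplication by 1 + X_i and by its inverse. *)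
Definition mag_mul i f w : int :=
  f w + (if w is j :: w' then if j == i then f w' else 0 else 0).

Fixpoint mag_div i f w : int :=
  f w - (if w is j :: w' then if j == i then mag_div i f w' else 0 else 0).

Definition mag_letter (l : letter 'I_q) f : W -> int :=
  if l.2 then mag_div l.1 f else mag_mul l.1 f.

Definition mag_act u f : W -> int := foldr mag_letter f u.

Definition delta0 w : int := (w == [::])%:R.
Definition coef u := mag_act u delta0.

Lemma mag_mulK i f : mag_div i (mag_mul i f) =1 f.
Proof.
elim=> [|j w IH] /=; first by rewrite /mag_mul addr0 subr0.
by rewrite {1}/mag_mul; case: (j == i); rewrite ?IH ?addrK // addr0 subr0.
Qed.

Lemma mag_divK i f : mag_mul i (mag_div i f) =1 f.
Proof.
case=> [|j w] /=; first by rewrite /mag_mul /= subr0 addr0.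
by rewrite /mag_mul /=; case: (j == i); rewrite ?subrK // subr0 addr0.
Qed.

Lemma eq_mag_letter l f g : f =1 g -> mag_letter l f =1 mag_letter l g.
Proof.
move=> fg; rewrite /mag_letter; case: l.2 => w; last first.
  by rewrite /mag_mul fg; case: w => // j w; rewrite fg.
by elim: w => [|j w IH] /=; rewrite fg ?IH.
Qed.

Lemma eq_mag_act u f g : f =1 g -> mag_act u f =1 mag_act u g.
Proof. by move=> fg; elim: u => //= l u IH; apply: eq_mag_letter. Qed.

Lemma mag_act_cat u v f : mag_act (u ++ v) f = mag_act u (mag_act v f).
Proof. exact: foldr_cat. Qed.

Lemma mag_letterK l f : mag_letter l (mag_letter (letter_inv l) f) =1 f.
Proof. by case: l => i [] w; rewrite /mag_letter /= ?mag_mulK ?mag_divK. Qed.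

Lemma mag_act_free u v f : free_eq u v -> mag_act u f =1 mag_act v f.
Proof.
move=> uv; elim: uv f => {u v} [u|u v _ IH|u v w _ IH1 _ IH2|u u' v v' _ IH1 _ IH2|l|//] f //.
- by move=> w; rewrite IH.
- by move=> x; rewrite IH1 IH2.
- by move=> w; rewrite !mag_act_cat IH1; apply: eq_mag_act => x; rewrite IH2.
- by move=> w; rewrite /= mag_letterK.
Qed.

Lemma coef_nil u : coef u [::] = 1.
Proof.
rewrite /coef; elim: u => //= l u IH; rewrite /mag_letter; case: l.2.
  by rewrite /= subr0.
by rewrite /mag_mul addr0.
Qed.

Definition conv f g w : int := \sum_(j < (size w).+1) f (take j w) * g (drop j w).

Lemma conv_nil f g : conv f g [::] = f [::] * g [::].
Proof. by rewrite /conv big_ord_recl big_ord0 addr0. Qed.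

Lemma conv_cons f g x w : conv f g (x :: w) =
  f [::] * g (x :: w) + conv (fun w' => f (x :: w')) g w.
Proof. by rewrite /conv big_ord_recl. Qed.

Lemma conv_mul i f g : mag_mul i (conv f g) =1 conv (mag_mul i f) g.
Proof.
case=> [|x w]; first by rewrite /mag_mul !conv_nil !addr0.
rewrite /mag_mul !conv_cons /= addr0 -addrA; congr (_ + _).
rewrite {3}/conv; under eq_bigr do rewrite mulrDl.
rewrite big_split; congr (_ + _).
by case: (x == i) => //; rewrite big1 // => j _; rewrite mul0r.
Qed.

Lemma eq_conv f f' g g' : f =1 f' -> g =1 g' -> conv f g =1 conv f' g'.
Proof. by move=> ff gg w; apply: eq_bigr => j _; rewrite ff gg. Qed.

Lemma conv_letter l f g : mag_letter l (conv f g) =1 conv (mag_letter l f) g.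
Proof.
case: l => i [] w; rewrite /mag_letter /=; last exact: conv_mul.
rewrite -[RHS](mag_mulK i); apply: (eq_mag_letter (i, true)) => x /=.
by rewrite conv_mul; apply: eq_conv => // y; rewrite mag_divK.
Qed.

Lemma conv_delta0 g : conv delta0 g =1 g.
Proof.
move=> w; rewrite /conv big_ord_recl take0 drop0 mul1r big1 ?addr0 // => j _.
by case: w j => [|x w] j //=; [case: j|rewrite mul0r].
Qed.

Lemma mag_actE u f : mag_act u f =1 conv (coef u) f.
Proof.
elim: u => [|l u IH] w /=; first by rewrite conv_delta0.
by rewrite (eq_mag_letter l IH) conv_letter.
Qed.

Lemma coef_cat u v : coef (u ++ v) =1 conv (coef u) (coef v).
Proof. by move=> w; rewrite {1}/coef mag_act_cat mag_actE. Qed.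

Lemma coef_bound u w : (`|coef u w| <= (size w).+1 ^ size u)%N.
Proof.
elim: u w => [|l u IH] w /=; first by rewrite /coef /= /delta0; case: eqP.
set b := ((size w).+1 ^ size u)%N.
have bw w' : (size w' <= size w)%N -> (`|coef u w'| <= b)%N.
  by move=> ww; apply: leq_trans (IH w') _; rewrite /b; case: (size u) => // k; rewrite leq_exp2r.
rewrite /coef /= -/(coef u) /mag_letter expnS -/b; case: l.2.
  suff H w' : (size w' <= size w)%N -> (`|mag_div l.1 (coef u) w'| <= (size w').+1 * b)%N.
    exact: H.
  elim: w' => [|x w' IHw] ww /=; first by rewrite subr0 mul1n bw.
  have := IHw (ltnW ww); have := bw (x :: w') ww; rewrite mulSn.
  by case: (x == _) => /=; move: (mag_div _ _ _) (coef _ _) ((size w').+1 * b)%N => a c d; lia.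
rewrite /mag_mul; case: w b bw => [|x w] b bw; first by rewrite addr0 mul1n bw.
have := bw (x :: w) (leqnn _); have := bw w (leqnSn _).
by case: (x == _) => /=; rewrite !mulSn; move: (coef u w) (coef u _) => a c; lia.
Qed.

(** * Substitution *)

Fixpoint words c : seq W :=
  if c is c'.+1 then [::] :: [seq i :: w | i <- enum 'I_q, w <- words c'] else [:: [::]].

Lemma mem_words c w : (w \in words c) = (size w <= c)%N.
Proof.
elim: c w => [|c IH] [|i w] //=; rewrite in_cons /=.
apply/allpairsP/idP => [[[j w'] /= [_ w'c [_ ->]]]|wc]; first by rewrite ltnS -IH.
by exists (i, w); rewrite /= mem_enum IH.
Qed.

Lemma uniq_words c : uniq (words c).
Proof.
elim: c => //= c IH; apply/andP; split; first by apply/allpairsP => -[[]] /= j w [].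
by apply: allpairs_uniq; rewrite ?enum_uniq // => -[a b] [a' b'] _ _ /= [-> ->].
Qed.

Lemma size_words c : (size (words c) <= q.+1 ^ c)%N.
Proof.
elim: c => //= c IH; rewrite size_allpairs size_enum_ord expnS mulSn -add1n leq_add ?expn_gt0 //.
by rewrite leq_mul2l IH orbT.
Qed.

Lemma sum_words (R : nmodType) c (F : W -> R) :
  \sum_(w <- words c.+1) F w = F [::] + \sum_i \sum_(w <- words c) F (i :: w).
Proof. by rewrite big_cons big_allpairs_dep /= big_enum. Qed.

Variable ws : 'I_q -> word 'I_q.

Definition aug i w : int := coef (ws i) w - delta0 w.

Lemma aug_nil i : aug i [::] = 0.
Proof. by rewrite /aug coef_nil subrr. Qed.

(** The coefficient of [w] after each [X_i] in the monomial [w'] is replaced by the expansion of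
    [ws i] minus 1. *)
Fixpoint subst_coef w' : W -> int :=
  if w' is i :: w'' then conv (aug i) (subst_coef w'') else delta0.

Definition subst_sum c f w : int := \sum_(w' <- words c) f w' * subst_coef w' w.

Lemma conv_sum (J : Type) (s : seq J) (c : J -> int) f (g : J -> W -> int) w :
  \sum_(j <- s) c j * conv f (g j) w = conv f (fun x => \sum_(j <- s) c j * g j x) w.
Proof.
rewrite /conv; under eq_bigr do rewrite big_distrr /=; rewrite exchange_big /=.
apply: eq_bigr => k _; rewrite big_distrr /=; apply: eq_bigr => j _.
by rewrite mulrCA.
Qed.

Lemma subst_sumS c f w : subst_sum c.+1 f w =
  f [::] * delta0 w + \sum_i conv (aug i) (subst_sum c (fun x => f (i :: x))) w.
Proof.
by rewrite /subst_sum sum_words; congr (_ + _); apply: eq_bigr => i _; rewrite conv_sum.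
Qed.

Lemma conv_aug i g g' w : (forall x, (size x < size w)%N -> g x = g' x) ->
  conv (aug i) g w = conv (aug i) g' w.
Proof.
move=> gg; rewrite /conv !big_ord_recl take0 aug_nil !mul0r !add0r.
apply: eq_bigr => j _; rewrite gg // size_drop /bump /=.
by case: (w) j => [|x s] [j jw] //=; rewrite subSS ltnS leq_subr.
Qed.

(** Since [aug] has no constant term, monomials longer than [w] contribute nothing. *)
Lemma subst_sum_le c c' f w : (size w <= c)%N -> (c <= c')%N ->
  subst_sum c f w = subst_sum c' f w.
Proof.
elim: c c' f w => [|c IH] c' f w.
  case: w => // _ _; case: c' => // c'; rewrite subst_sumS big1 ?addr0 => [|i _].
    by rewrite /subst_sum big_seq1.
  by rewrite conv_nil aug_nil mul0r.
case: c' => // c' wc cc; rewrite !subst_sumS; congr (_ + _); apply: eq_bigr => i _.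
apply: conv_aug => x xw; apply: IH => //; rewrite -ltnS; exact: leq_trans xw wc.
Qed.

Lemma subst_sum_mul c i f w : (size w <= c)%N ->
  subst_sum c (mag_mul i f) w = mag_act (ws i) (subst_sum c f) w.
Proof.
move=> wc; rewrite mag_actE.
have -> : conv (coef (ws i)) (subst_sum c f) w =
    subst_sum c f w + conv (aug i) (subst_sum c f) w.
  rewrite -[X in _ = X + _](conv_delta0 (subst_sum c f) w) /conv -big_split /=.
  by apply: eq_bigr => j _; rewrite -mulrDl addrC /aug subrK.
case: c wc => [|c] wc.
  case: w wc => // _; rewrite conv_nil aug_nil mul0r addr0.
  by rewrite /subst_sum !big_seq1 /mag_mul addr0.
have -> : conv (aug i) (subst_sum c.+1 f) w = conv (aug i) (subst_sum c f) w.
  by apply: conv_aug => x xw; rewrite (subst_sum_le _ _ (leqnSn c)) // -ltnS (leq_trans xw).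
rewrite !subst_sumS -addrA; congr (_ + _); first by rewrite /mag_mul addr0.
rewrite [in RHS](bigD1 i) //= [LHS](bigD1 i) //= addrAC; congr (_ + _).
  rewrite -!conv_sum /= -big_split /=; apply: eq_bigr => w' _.
  by rewrite /mag_mul eqxx mulrDl.
apply: eq_bigr => j ji; apply: eq_conv => // x; apply: eq_bigr => w' _.
by rewrite /mag_mul (negbTE ji) addr0.
Qed.

Lemma eq_subst_sum c f g w : f =1 g -> subst_sum c f w = subst_sum c g w.
Proof. by move=> fg; apply: eq_bigr => x _; rewrite fg. Qed.

(** Substitution is linear on truncated Magnus series; the recurrences rest on this. *)
Lemma coef_subw c u w : (size w <= c)%N ->
  coef (subw ws u) w = subst_sum c (coef u) w.
Proof.
elim: u w => [|l u IH] w wc.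
  rewrite /coef /= /subst_sum (big_rem [::]) /= ?mem_words // mul1r big1_seq ?addr0 //.
  move=> x /andP[_]; rewrite mem_rem_uniq ?uniq_words // inE /delta0 => /andP[/negbTE -> _].
  by rewrite mul0r.
rewrite -cat1s subw_cat {1}/subw /= cats0 {1}/coef mag_act_cat -/(coef (subw ws u)).
(* [mag_act] only looks at suffixes of [w]. *)
have suff_eq v f g : (forall x, (size x <= c)%N -> f x = g x) ->
    forall x, (size x <= c)%N -> mag_act v f x = mag_act v g x.
  move=> fg x xc; rewrite !mag_actE; apply: eq_bigr => j _; rewrite fg //.
  by rewrite size_drop (leq_trans (leq_subr _ _)).
rewrite (suff_eq _ _ _ IH) //.
case: l => i [] /=; rewrite /letter_image /=; last by rewrite -subst_sum_mul.
(* The series of [u] is [1 + X_i] times [h], which reduces an inverse letter to the positive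
   case. *)
set h := mag_letter (i, true) (coef u).
have E x : (size x <= c)%N -> subst_sum c (coef u) x = mag_act (ws i) (subst_sum c h) x.
  move=> xc; rewrite -subst_sum_mul //; apply: eq_subst_sum => y.
  by rewrite -[LHS](mag_divK i).
rewrite (suff_eq _ _ _ E) // -mag_act_cat.
by rewrite (mag_act_free _ (pres_mulVl _ (ws i))).
Qed.

End Magnus.

(** * Eigenvalues of substitutions on Magnus coefficients *)

Section TensorEigen.

Variables (q : nat) (A : 'I_q -> 'I_q -> algC).
Implicit Types (g h : seq 'I_q -> algC) (w : seq 'I_q).

(* The [d]-th tensor power of the matrix [A], acting on functions on words of length [d]. *)
Fixpoint tens_act g w : algC :=
  if w is x :: w' then \sum_i A i x * tens_act (fun y => g (i :: y)) w' else g [::].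

(** The tensor factor acting on the first letter. It commutes with the whole tensor power, which
    makes common eigenvectors available. *)
Definition head_act g w : algC :=
  if w is x :: w' then \sum_i A i x * g (i :: w') else g [::].

Lemma eq_tens_act g h w : (forall x, size x = size w -> g x = h x) ->
  tens_act g w = tens_act h w.
Proof.
elim: w g h => [|x w IH] g h gh /=; first by apply: gh.
by apply: eq_bigr => i _; congr (_ * _); apply: IH => y yw; apply: gh; rewrite /= yw.
Qed.

Lemma tens_act_sum (I : finType) (c : I -> algC) (g : I -> seq 'I_q -> algC) w :
  tens_act (fun x => \sum_i c i * g i x) w = \sum_i c i * tens_act (g i) w.
Proof.
elim: w g => [//|x w IH] g /=.
under eq_bigr do rewrite (IH (fun i y => g i (_ :: y))) big_distrr.
rewrite exchange_big /=; apply: eq_bigr => i _; rewrite big_distrr /=.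
by apply: eq_bigr => j _; rewrite mulrCA.
Qed.

Lemma tens_act_scale h a w : tens_act (fun x => a * h x) w = a * tens_act h w.
Proof.
elim: w h => [//|x w IH] h /=; rewrite big_distrr /=; apply: eq_bigr => i _.
by rewrite (IH (fun y => h (i :: y))) mulrCA.
Qed.

Lemma tens_act_sub g h a w :
  tens_act (fun x => g x - a * h x) w = tens_act g w - a * tens_act h w.
Proof.
have := tens_act_sum (fun b : bool => if b then 1 else - a) (fun b : bool => if b then g else h) w.
rewrite big_bool /= mul1r mulNr => <-; apply: eq_tens_act => x _.
by rewrite big_bool /= mul1r mulNr.
Qed.

Lemma tens_head_act g x w : tens_act (head_act g) (x :: w) = head_act (tens_act g) (x :: w).
Proof.
rewrite /=; apply: eq_bigr => i _; congr (_ * _).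
by rewrite (tens_act_sum (fun j => A j i) (fun j y => g (j :: y))).
Qed.

Lemma tens_cons g x w : tens_act g (x :: w) =
  tens_act (fun y => head_act g (x :: y)) w.
Proof. by rewrite /= -tens_act_sum. Qed.

(** Applying [head_act - a] for the successive [a] in [s] ends at 0; the last nonzero stage is a
    common eigenvector. *)
Lemma tens_head_eigenvector (s : seq algC) d g t w :
  (forall w, size w = d.+1 -> tens_act g w = t * g w) ->
  size w = d.+1 -> g w != 0 ->
  (forall w, size w = d -> foldl (fun r a => r *m (\matrix_(i, j) A i j) - a *: r)
      (\row_i g (i :: w)) s = 0) ->
  exists a h, [/\ a \in s,
    forall w, size w = d.+1 -> tens_act h w = t * h w,
    exists2 w, size w = d.+1 & h w != 0 &
    forall w, size w = d.+1 -> head_act h w = a * h w].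
Proof.
elim: s g w => [|a s IHs] g w tg wd gw Hs.
  case: w wd gw => // x w [wd]; move/rowP: (Hs w wd) => /(_ x).
  by rewrite /= !mxE => ->; rewrite eqxx.
pose g1 x := head_act g x - a * g x.
case: (boolP [exists z : d.+1.-tuple 'I_q, g1 z != 0]) => [/existsP[z g1z]|].
  have [||b [h [bs h1 h2 h3]]] := IHs g1 z _ (size_tuple z) g1z.
  - case=> [//|x v] vd; rewrite /g1 tens_act_sub tens_head_act /head_act.
    rewrite tg // mulrBr big_distrr /=; congr (_ - _); last by rewrite mulrCA.
    case: vd => vd; apply: eq_bigr => i _; rewrite -[\sum_j _]/(tens_act g (i :: v)) tg /= ?vd //.
    by rewrite mulrCA.
  - move=> w1 w1d; rewrite -[RHS](Hs w1 w1d) /=; congr (foldl _ _ _).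
    apply/rowP => i; rewrite !mxE /g1 /=; congr (_ - _).
    by apply: eq_bigr => j _; rewrite !mxE mulrC.
  by exists b, h; split=> //; rewrite inE bs orbT.
rewrite negb_exists => /forallP G; exists a, g; split=> //; first by rewrite inE eqxx.
  by exists w.
move=> v /eqP vd; apply/eqP; rewrite -subr_eq0.
by have := G (Tuple vd); rewrite negbK.
Qed.

Variable s : seq algC.
Hypothesis As : forall r : 'rV[algC]_q,
  foldl (fun r a => r *m (\matrix_(i, j) A i j) - a *: r) r s = 0.

Lemma tens_eigenvalue d g t : t != 0 ->
  (forall w, size w = d -> tens_act g w = t * g w) ->
  (exists2 w, size w = d & g w != 0) ->
  exists2 ks, {subset ks <= s} & t = \prod_(x <- ks) x.
Proof.
elim: d g t => [|d IH] g t t0 tg [w wd gw].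
  exists [::] => //; rewrite big_nil; apply: (mulIf gw).
  by rewrite mul1r; move/size0nil: (wd) gw (tg w wd) => -> _ /= <-.
have [a [h [sa th [w' w'd hw'] ha]]] :=
  tens_head_eigenvector tg wd gw (fun w _ => As (\row_i g (i :: w))).
case: w' w'd hw' => [//|x w'] [w'd] hw'.
have E v : size v = d -> t * h (x :: v) = a * tens_act (fun y => h (x :: y)) v.
  move=> vd; rewrite -th /= ?vd // -/(tens_act h (x :: v)) tens_cons.
  rewrite -tens_act_scale; apply: eq_tens_act => y yv.
  by rewrite ha //= yv vd.
have a0 : a != 0.
  apply: contraNneq hw' => a0; have /eqP := E w' w'd.
  by rewrite a0 mul0r mulf_eq0 (negbTE t0).
have [||ks kss tE] := IH (fun y => h (x :: y)) (t / a) _ _ (ex_intro2 _ _ w' w'd hw').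
- by rewrite mulf_neq0 // invr_eq0.
- by move=> v vd; rewrite mulrAC E // mulrC mulKf.
exists (a :: ks); last by rewrite big_cons -tE mulrCA divff ?mulr1.
by move=> b; rewrite inE => /orP[/eqP -> //|]; apply: kss.
Qed.

End TensorEigen.

(** The last clause is Cayley-Hamilton, unfolded root by root into the form that [tens_eigenvalue]
    consumes. *)
Lemma char_poly_roots q (A : 'M[algC]_q) : exists s : seq algC,
  [/\ size s = q, all (root (char_poly A)) s &
      forall r : 'rV[algC]_q, foldl (fun r a => r *m A - a *: r) r s = 0].
Proof.
case: q A => [|q] A; first by exists [::]; split=> // r; apply/rowP; case.
have [s sE] := closed_field_poly_normal (char_poly A).
rewrite (monicP (char_poly_monic A)) scale1r in sE.
have sz : size s = q.+1.
  by apply/succn_inj; rewrite -(size_char_poly A) sE size_prod_XsubC.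
exists s; split=> // [|r]; first by apply/allP=> x; rewrite sE root_prod_XsubC.
have -> : foldl (fun r a => r *m A - a *: r) r s =
    r *m horner_mx A (\prod_(a <- s) ('X - a%:P)).
  elim: (s) r => [|a s' IH] r /=; first by rewrite big_nil rmorph1 mulmx1.
  rewrite IH big_cons rmorphM /= rmorphB /= horner_mx_X horner_mx_C -mulmxE mulmxA.
  by rewrite mulmxBr mul_mx_scalar.
by rewrite -sE Cayley_Hamilton mulmx0.
Qed.

Lemma horner_mx_sum (R : comNzRingType) p (A : 'M[R]_p.+1) (P : {poly R}) :
  horner_mx A P = \sum_(i < size P) P`_i *: A ^+ i.
Proof.
rewrite -[in LHS](coefK P) poly_def linear_sum; apply: eq_bigr => i _.
by rewrite linearZ rmorphXn /= horner_mx_X.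
Qed.

Lemma sum_words_tuple (R : nmodType) q c (F : seq 'I_q -> R) :
  \sum_(w <- words q c) F w = \sum_(j < c.+1) \sum_(w : j.-tuple 'I_q) F w.
Proof.
elim: c F => [|c IH] F; first by rewrite big_seq1 big_ord1 (big_tuple0 F).
rewrite sum_words; under eq_bigr do rewrite IH.
rewrite exchange_big [RHS]big_ord_recl (big_tuple0 F); congr (_ + _); apply: eq_bigr => j _.
by rewrite (big_tuple_cons _ F).
Qed.

Section SubstMatrix.

Variables (q : nat) (ws : 'I_q -> word 'I_q) (c : nat).

(** The predecessor is taken so that matrices of size [subst_dim.+1] form a ring. *)
Definition subst_dim := (size (words q c)).-1.

Lemma subst_dimE : size (words q c) = subst_dim.+1.
Proof. by rewrite /subst_dim; case: c. Qed.

Definition word_at (i : 'I_subst_dim.+1) := nth [::] (words q c) i.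

Definition subst_mx : 'M[int]_subst_dim.+1 :=
  \matrix_(i, j) subst_coef ws (word_at i) (word_at j).

Definition coef_row u : 'rV[int]_subst_dim.+1 := \row_i coef u (word_at i).

Lemma size_word_at i : (size (word_at i) <= c)%N.
Proof. by rewrite -mem_words mem_nth // subst_dimE. Qed.

Lemma sum_word_at (R : nmodType) (F : seq 'I_q -> R) :
  \sum_(w <- words q c) F w = \sum_i F (word_at i).
Proof. by rewrite (big_nth [::]) subst_dimE big_mkord. Qed.

Lemma coef_row_subw u : coef_row (subw ws u) = coef_row u *m subst_mx.
Proof.
apply/rowP=> j; rewrite !mxE (@coef_subw _ _ c) ?size_word_at // /subst_sum sum_word_at.
by apply: eq_bigr => i _; rewrite !mxE.
Qed.

Lemma coef_row_iter u k : coef_row (iter k (subw ws) u) = coef_row u *m subst_mx ^+ k.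
Proof.
elim: k => [|k IH]; first by rewrite expr0 mulmx1.
by rewrite iterS coef_row_subw IH exprSr -mulmxE mulmxA.
Qed.

Definition subst_poly : {poly algC} := map_poly intr (char_poly subst_mx).

Lemma subst_poly_monic : subst_poly \is monic.
Proof. by rewrite monic_map // char_poly_monic. Qed.

Lemma size_subst_poly : size subst_poly = subst_dim.+2.
Proof. by rewrite size_map_poly_id0 ?size_char_poly // (monicP (char_poly_monic _)) oner_neq0. Qed.

Lemma subst_poly_Aint t : root subst_poly t -> t \in Aint.
Proof.
move=> rt; apply: (root_monic_Aint rt subst_poly_monic).
by apply/polyOverP => i; rewrite coef_map /= intr_int.
Qed.

Lemma coef_recurrent (alpha : seq 'I_q -> int) u :
  recurrent subst_poly subst_dim.+1 (fun k =>
    (\sum_(w <- words q c) alpha w * coef (iter k (subw ws) u) w)%:~R).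
Proof.
move=> x; pose a : 'cV[int]_subst_dim.+1 := \col_i alpha (word_at i).
have F k : \sum_(w <- words q c) alpha w * coef (iter k (subw ws) u) w =
    (coef_row u *m subst_mx ^+ k *m a) 0 0.
  rewrite sum_word_at -coef_row_iter mxE; apply: eq_bigr => i _.
  by rewrite !mxE mulrC.
under eq_bigr do rewrite F coef_map /= -intrM.
rewrite -rmorph_sum /=; apply/eqP; rewrite intr_eq0; apply/eqP.
have CH := Cayley_Hamilton subst_mx.
transitivity ((coef_row u *m (horner_mx subst_mx (char_poly subst_mx) *m subst_mx ^+ x) *m a) 0 0);
  last by rewrite CH mul0mx mulmx0 mul0mx mxE.
rewrite horner_mx_sum size_char_poly mulmx_suml mulmx_sumr mulmx_suml summxE.
apply: eq_bigr => i _; rewrite -!scalemxAl -scalemxAr -scalemxAl [RHS]mxE; congr (_ * _).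
by rewrite !mulmxE -exprD.
Qed.

Lemma subst_coef_short w' w : (size w < size w')%N -> subst_coef ws w' w = 0.
Proof.
elim: w' w => [//|i w' IH] w /= ww; rewrite /conv big_ord_recl take0 aug_nil mul0r add0r.
rewrite big1 // => j _; rewrite IH ?mulr0 // size_drop.
case: (w) ww j => [|x s] ww [j jw] //=; rewrite /bump /= ?add1n subSS.
exact: (leq_ltn_trans (leq_subr _ _)).
Qed.

Lemma subst_coef_cons i w' x w : size w = size w' ->
  subst_coef ws (i :: w') (x :: w) = aug ws i [:: x] * subst_coef ws w' w.
Proof.
move=> ww; rewrite /= conv_cons aug_nil mul0r add0r /conv big_ord_recl take0 drop0.
rewrite big1 ?addr0 // => j _; rewrite subst_coef_short ?mulr0 // size_drop -ww.
by case: (w) j => [|y s] [j jw] //=; rewrite /bump /= ?add1n subSS ltnS leq_subr.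
Qed.

Definition abel_coef (i x : 'I_q) : algC := (aug ws i [:: x])%:~R.

Lemma tens_act_abel g w : tens_act abel_coef g w =
  \sum_(w' : (size w).-tuple 'I_q) g w' * (subst_coef ws w' w)%:~R.
Proof.
elim: w g => [|x w IH] g /=.
  by rewrite (big_tuple0 (fun w' : seq 'I_q => g w' * (subst_coef ws w' [::])%:~R)) /= mulr1.
rewrite (big_tuple_cons _ (fun w' : seq 'I_q => g w' * (subst_coef ws w' (x :: w))%:~R)).
apply: eq_bigr => i _; rewrite IH big_distrr /=; apply: eq_bigr => w' _.
by rewrite -/(subst_coef ws (i :: w') (x :: w)) subst_coef_cons ?size_tuple // intrM mulrCA.
Qed.

(** The matrix is block triangular for word length. On the shortest words where an eigenvector is
    nonzero it acts as a tensor power of the abelianisation, which makes [t] a product of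
    eigenvalues of the latter. *)
Lemma subst_poly_unity t k : root subst_poly t -> (0 < k)%N -> t ^+ k = 1 ->
  t ^+ unity_exponent q = 1.
Proof.
move=> rt k0 tk; have t0 : t != 0.
  by apply: contra_eq_neq tk => ->; rewrite expr0n gtn_eqF // eq_sym oner_neq0.
have : eigenvalue (map_mx intr subst_mx) t by rewrite eigenvalue_root_char -map_char_poly.
case/eigenvalueP => v vM v0.
pose f w := if (size w <= c)%N then v 0 (inord (index w (words q c))) else 0.
have f_at i : f (word_at i) = v 0 i.
  rewrite /f size_word_at /word_at index_uniq ?uniq_words ?subst_dimE //.
  by rewrite inord_val.
have fM w : (size w <= c)%N ->
    \sum_(w' <- words q c) f w' * (subst_coef ws w' w)%:~R = t * f w.
  move=> wc; have [i <-] : exists i, word_at i = w.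
    exists (inord (index w (words q c))); rewrite /word_at inordK ?nth_index ?mem_words //.
    by rewrite -subst_dimE index_mem mem_words.
  move/rowP: vM => /(_ i); rewrite !mxE f_at => <-; rewrite sum_word_at.
  by apply: eq_bigr => j _; rewrite f_at !mxE.
have ex : exists d, [exists i, (size (word_at i) == d) && (v 0 i != 0)].
  have /rV0Pn[i vi] := v0; exists (size (word_at i)); apply/existsP; exists i.
  by rewrite eqxx.
case: (ex_minnP ex) => d /existsP[i0 /andP[/eqP sd vi0]] dmin.
have fsmall w : (size w < d)%N -> f w = 0.
  rewrite /f; case: (leqP (size w) c) => // wc wd; apply/eqP; apply: contraTT wd => vw.
  rewrite -leqNgt; apply: dmin; apply/existsP; exists (inord (index w (words q c))).
  rewrite vw andbT /word_at inordK ?nth_index ?mem_words //.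
  by rewrite -subst_dimE index_mem mem_words.
have dc : (d < c.+1)%N by rewrite -sd ltnS size_word_at.
have fd w : size w = d -> tens_act abel_coef f w = t * f w.
  move=> wd; rewrite -fM ?wd // tens_act_abel wd.
  rewrite (sum_words_tuple _ (fun w' => f w' * (subst_coef ws w' w)%:~R)).
  rewrite [RHS](bigD1 (Ordinal dc)) //= [X in _ + X]big1 ?addr0 // => j jd.
  rewrite big1 // => w' _; case: (ltngtP j d) => [jd'|jd'|jd'].
  - by rewrite fsmall ?mul0r // size_tuple.
  - by rewrite subst_coef_short ?mulr0 // size_tuple wd.
  - by rewrite -val_eqE /= jd' eqxx in jd.
pose B : 'M[int]_q := \matrix_(i, j) aug ws i [:: j].
have [s [sz rs ks]] := char_poly_roots (map_mx intr B : 'M[algC]_q).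
have BE : \matrix_(i, j) abel_coef i j = map_mx intr B by apply/matrixP => i j; rewrite !mxE.
rewrite -BE in ks.
have [|l sub tE] := tens_eigenvalue ks t0 fd.
  by exists (word_at i0); rewrite ?f_at.
rewrite tE; apply: (@root_of_unity_product (map_poly intr (char_poly B)) q s l k) => //.
- by rewrite monic_neq0 // monic_map // char_poly_monic.
- by rewrite size_map_poly_id0 ?size_char_poly // (monicP (char_poly_monic _)) oner_neq0.
- by rewrite sz.
- rewrite -map_poly_comp; rewrite -map_char_poly in rs; apply: sub_all rs => x.
  by congr root; apply: eq_map_poly => y /=; rewrite ratr_int.
- by rewrite -tE.
Qed.

End SubstMatrix.

(** * Cyclic coefficients and traces *)

Section CyclicCoefficients.

Variable q : nat.
Implicit Types (w : seq 'I_q) (u v : word 'I_q).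

Definition cyc w u : int := \sum_(t < size w) coef u (rot t w).

Lemma sum_rot (R : nmodType) (T : Type) (G : seq T -> R) j (w : seq T) : (j <= size w)%N ->
  \sum_(t < size w) G (rot t w) = \sum_(t < size w) G (rot j (rot t w)).
Proof.
have rot1_sum (H : seq T -> R) (s : seq T) :
    \sum_(t < size s) H (rot t s) = \sum_(t < size s) H (rot 1 (rot t s)).
  case E : (size s) => [|l]; first by rewrite !big_ord0.
  rewrite big_ord_recl [RHS]big_ord_recr /= addrC rot0; congr (_ + _).
    by apply: eq_bigr => t _; rewrite -rotS // E ltnS ltnW.
  by rewrite -rotS ?E // -E rot_size.
elim: j => [|j IH] jw; first by apply: eq_bigr => t _; rewrite rot0.
rewrite IH 1?ltnW // (rot1_sum (fun x => G (rot j x))); apply: eq_bigr => t _.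
by rewrite rot_rot -rotS // size_rot.
Qed.

(** Both sides sum over a rotation and a cut of [w]; exchanging the two pieces is a further
    rotation. *)
Lemma cyc_catC w u v : cyc w (u ++ v) = cyc w (v ++ u).
Proof.
rewrite /cyc; under eq_bigr do rewrite coef_cat /conv size_rot.
under [RHS]eq_bigr do rewrite coef_cat /conv size_rot.
rewrite exchange_big [RHS]exchange_big /= [RHS](reindex_inj rev_ord_inj) /=.
apply: eq_bigr => j _; have jw : (j <= size w)%N by rewrite -ltnS.
rewrite [RHS](sum_rot (fun x => coef v (take (size w - j) x) * coef u (drop (size w - j) x)) jw).
apply: eq_bigr => t _; set x := rot t w; have sx : size x = size w by rewrite size_rot.
have -> : (size w - j)%N = size (drop j x) by rewrite size_drop sx.
by rewrite mulrC /(rot j) take_size_cat // drop_size_cat.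
Qed.

Lemma cyc_free_eq w u v : free_eq u v -> cyc w u = cyc w v.
Proof.
by move=> uv; apply: eq_bigr => t _; rewrite /coef (mag_act_free _ uv).
Qed.

Lemma cyc_conj w u v z : free_eq (word_inv z ++ u ++ z) v -> cyc w u = cyc w v.
Proof.
move/(cyc_free_eq w) => <-; rewrite cyc_catC -catA; apply: cyc_free_eq.
rewrite /free_eq -[X in pres_eq _ X _]cats0; apply: pres_cat; first exact: pres_refl.
by apply: pres_sym; apply: pres_mulV.
Qed.

Lemma cyc_bound w u : (`|cyc w u| <= size w * (size w).+1 ^ size u)%N.
Proof.
rewrite -[X in (_ <= X * _)%N]card_ord -sum_nat_const.
apply: (big_ind2 (fun (a : int) (b : nat) => `|a| <= b)%N) => // [a b a' b'|t _]; first by lia.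
by have := coef_bound u (rot t w); rewrite size_rot.
Qed.

Lemma cyc_recurrent (ws : 'I_q -> word 'I_q) c w u : (size w <= c)%N ->
  recurrent (subst_poly ws c) (subst_dim q c).+1 (fun k =>
    (cyc w (iter k (subw ws) u))%:~R).
Proof.
move=> wc x; rewrite -[RHS](@coef_recurrent _ ws c
  (fun y => (\sum_(t < size w) (y == rot t w)%:R)%R) u x).
apply: eq_bigr => i _; congr (_ * _%:~R); rewrite /cyc.
under [RHS]eq_bigr do rewrite big_distrl /=.
rewrite exchange_big /=; apply: eq_bigr => t _.
rewrite (big_rem (rot t w)) /= ?mem_words ?size_rot // eqxx mul1r big1_seq ?addr0 //.
move=> y /andP[_]; rewrite mem_rem_uniq ?uniq_words // inE => /andP[/negbTE -> _].
by rewrite mul0r.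
Qed.

End CyclicCoefficients.

(** * From cyclic Magnus coefficients to traces *)

Section TraceCoefficients.

Variables (q N : nat) (rho : 'I_q -> 'M[algC]_N).
Hypothesis rho_unit : inv_rep rho.
Implicit Types (f g : seq 'I_q -> int) (u v : word 'I_q).

(** The homogeneous part of degree [j] of the series [f], evaluated at [rho i - 1] for [X_i]. *)
Definition hom_part j f : 'M[algC]_N :=
  \sum_(t : j.-tuple 'I_q) (f t)%:~R *: mxev (fun i => rho i - 1%:M) t.

Lemma hom_partS j f :
  hom_part j.+1 f = \sum_i (rho i - 1%:M) *m hom_part j (fun w => f (i :: w)).
Proof.
rewrite /hom_part (big_tuple_cons _ (fun t => (f t)%:~R *: mxev (fun i => rho i - 1%:M) t)).
apply: eq_bigr => i _; rewrite mulmx_sumr; apply: eq_bigr => t _ /=.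
by rewrite scalemxAr.
Qed.

Lemma hom_part0 f : hom_part 0 f = (f [::])%:~R%:M.
Proof.
rewrite /hom_part (big_tuple0 (fun t => (f t)%:~R *: mxev (fun i => rho i - 1%:M) t)) /=.
by rewrite scalemx1.
Qed.

Lemma hom_part_mul0 i f : hom_part 0 (mag_mul i f) = hom_part 0 f.
Proof. by rewrite !hom_part0 /mag_mul addr0. Qed.

Lemma hom_part_mulS i j f : hom_part j.+1 (mag_mul i f) =
  hom_part j.+1 f + (rho i - 1%:M) *m hom_part j f.
Proof.
rewrite !hom_partS (bigD1 i) //= [in RHS](bigD1 i) //= addrAC -mulmxDr; congr (_ *m _ + _).
  rewrite /hom_part -big_split /=; apply: eq_bigr => t _.
  by rewrite /mag_mul eqxx rmorphD scalerDl.
apply: eq_bigr => k ki; congr (_ *m _); apply: eq_bigr => t _.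
by rewrite /mag_mul (negbTE ki) addr0.
Qed.

(** Traces of products are invariant under rotation, so [j] times the trace is a sum against cyclic
    coefficients, and [j] can be cancelled in characteristic 0. *)
Lemma tr_hom_part_cyc j u v :
  (forall w : seq 'I_q, size w = j -> cyc w u = cyc w v) ->
  \tr (hom_part j (coef u)) = \tr (hom_part j (coef v)).
Proof.
case: j => [_|j cE]; first by rewrite !hom_part0 !coef_nil.
pose T (w : seq 'I_q) := \tr (mxev (fun i => rho i - 1%:M) w).
have trE g : \tr (hom_part j.+1 g) = \sum_(t : j.+1.-tuple 'I_q) (g t)%:~R * T t.
  by rewrite /hom_part raddf_sum; apply: eq_bigr => t _; rewrite /= mxtraceZ.
have Trot k (w : seq 'I_q) : T (rot k w) = T w.
  by rewrite /T /rot mxev_cat mxtrace_mulC -mxev_cat cat_take_drop.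
have cycE g : \tr (hom_part j.+1 g) *+ j.+1 =
    \sum_(t : j.+1.-tuple 'I_q) (\sum_(k < j.+1) g (rot k t))%:~R * T t.
  rewrite -[X in _ *+ X]card_ord -sumr_const.
  under [RHS]eq_bigr do rewrite rmorph_sum big_distrl.
  rewrite [RHS]exchange_big; apply: eq_big => [k|k _]; first by rewrite inE.
  rewrite trE.
  rewrite (reindex (fun t : j.+1.-tuple 'I_q => [tuple of rot k t])) /=.
    by apply: eq_bigr => t _; rewrite Trot.
  exists (fun t : j.+1.-tuple 'I_q => [tuple of rotr k t]) => t _; apply/val_inj; rewrite /=.
    by rewrite rotK.
  by rewrite rotrK.
apply: (@pmulrnI _ j.+1) => //; rewrite !cycE; apply: eq_bigr => t _; congr (_%:~R * _).
by have := cE t (size_tuple t); rewrite /cyc size_tuple.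
Qed.

(* [rho] is deformed to the family [1 + 'X (rho - 1)], which is a truncated
   Magnus expansion at ['X = 0] and [rho] itself at ['X = 1]; adjugates replace
   inverses to stay among polynomials. *)
Definition line_mx i : 'M[{poly algC}]_N := 1%:M + 'X *: map_mx polyC (rho i - 1%:M).

Definition line_letter (l : letter 'I_q) : 'M[{poly algC}]_N :=
  if l.2 then \adj (line_mx l.1) else line_mx l.1.

Definition line_det u : {poly algC} := \prod_(l <- u | l.2) \det (line_mx l.1).

Definition line_word u := mxev line_letter u.

Definition magnus_mx c f : 'M[{poly algC}]_N :=
  \sum_(j < c.+1) 'X^j *: map_mx polyC (hom_part j f).

Definition congr_mx c (A B : 'M[{poly algC}]_N) := exists E, A - B = 'X^(c.+1) *: E.

Lemma congr_mx_trans c A B C : congr_mx c A B -> congr_mx c B C -> congr_mx c A C.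
Proof.
move=> [E AB] [F BC]; exists (E + F); rewrite scalerDr -AB -BC.
by rewrite addrA subrK.
Qed.

Lemma congr_mx_mul c A B C : congr_mx c A B -> congr_mx c (C *m A) (C *m B).
Proof. by move=> [E AB]; exists (C *m E); rewrite -mulmxBr AB scalemxAr. Qed.

Lemma congr_mx_scale c A B a : congr_mx c A B -> congr_mx c (a *: A) (a *: B).
Proof. by move=> [E AB]; exists (a *: E); rewrite -scalerBr AB scalerA mulrC -scalerA. Qed.

Lemma congr_mx_sym c A B : congr_mx c A B -> congr_mx c B A.
Proof. by move=> [E AB]; exists (- E); rewrite scalerN -AB opprB. Qed.

Lemma line_magnus_mul c i f :
  congr_mx c (line_mx i *m magnus_mx c f) (magnus_mx c (mag_mul i f)).
Proof.
exists (map_mx polyC ((rho i - 1%:M) *m hom_part c f)).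
have -> : magnus_mx c (mag_mul i f) = magnus_mx c f +
    \sum_(j < c) 'X^(j.+1) *: map_mx polyC ((rho i - 1%:M) *m hom_part j f).
  rewrite /magnus_mx !big_ord_recl hom_part_mul0 -addrA; congr (_ + _).
  rewrite -big_split; apply: eq_bigr => j _ /=.
  by rewrite /bump /= add1n hom_part_mulS map_mxD scalerDr.
rewrite /line_mx mulmxDl mul1mx -scalemxAl {2}/magnus_mx mulmx_sumr scaler_sumr.
rewrite big_ord_recr /= opprD addrACA subrr add0r.
under eq_bigr do rewrite -scalemxAr -map_mxM scalerA -exprS.
by rewrite addrAC subrr add0r -scalemxAr -map_mxM scalerA -exprS.
Qed.

Lemma eq_magnus_mx c f g : f =1 g -> magnus_mx c f = magnus_mx c g.
Proof.
move=> fg; apply: eq_bigr => j _; congr (_ *: map_mx _ _).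
by apply: eq_bigr => t _; rewrite fg.
Qed.

Lemma line_magnus c u : congr_mx c (line_word u) (line_det u *: magnus_mx c (coef u)).
Proof.
elim: u => [|[i b] u IH].
  rewrite /line_word /= /line_det big_nil scale1r; exists 0; rewrite scaler0.
  rewrite /magnus_mx big_ord_recl expr0 scale1r hom_part0 /coef /= /delta0 eqxx /=.
  rewrite map_scalar_mx /= big1 ?addr0 ?subrr // => j _.
  rewrite /hom_part big1 ?map_mx0 ?scaler0 // => t _.
  by rewrite (_ : _ == _ = false) ?scale0r //; case: t => -[].
rewrite /line_word /line_det big_cons /=; case: b => /=.
  rewrite /line_letter /= -[mxev _ _]/(line_word u) -/(line_det u).
  apply: congr_mx_trans (congr_mx_mul _ IH) _.
  rewrite (eq_magnus_mx _ (fun w => esym (mag_divK i (coef u) w))) -scalemxAr mulrC -scalerA.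
  apply: congr_mx_scale; apply: congr_mx_trans.
    by apply/congr_mx_mul/congr_mx_sym/line_magnus_mul.
  rewrite mulmxA mul_adj_mx mul_scalar_mx; exists 0; rewrite scaler0.
  by apply/eqP; rewrite subr_eq0.
rewrite /line_letter /= -[mxev _ _]/(line_word u) -/(line_det u).
apply: congr_mx_trans (congr_mx_mul _ IH) _; rewrite -scalemxAr.
exact/congr_mx_scale/line_magnus_mul.
Qed.

End TraceCoefficients.

Section PolyDegrees.

Variable R : comNzRingType.

Lemma size_sum_leq (I : Type) (r : seq I) (P : pred I) (F : I -> {poly R}) d :
  (forall i, size (F i) <= d)%N -> (size (\sum_(i <- r | P i) F i)%R <= d)%N.
Proof.
move=> Fd; apply: (big_ind (fun p : {poly R} => size p <= d)%N) => [|p p' pd pd'|i _].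
- by rewrite size_poly0.
- by rewrite (leq_trans (size_polyD _ _)) // geq_max pd.
- exact: Fd.
Qed.

Lemma size_mul_leqD (p r : {poly R}) a b :
  (size p <= a.+1)%N -> (size r <= b.+1)%N -> (size (p * r)%R <= (a + b).+1)%N.
Proof. by move=> pa rb; have := size_polyMleq p r; move: pa rb; clear; lia. Qed.

Lemma size_prod_leqM (I : Type) (s : seq I) (P : pred I) (F : I -> {poly R}) d :
  (forall i, size (F i) <= d.+1)%N ->
  (size (\prod_(i <- s | P i) F i)%R <= (d * size s).+1)%N.
Proof.
move=> Fd; elim: s => [|i s IH]; first by rewrite big_nil size_poly1.
rewrite big_cons; case: (P i); first by rewrite mulnS size_mul_leqD.
by rewrite (leq_trans IH) // ltnS leq_mul2l leqnSn orbT.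
Qed.

Lemma size_det_leq k (A : 'M[{poly R}]_k) :
  (forall i j, size (A i j) <= 2)%N -> (size (\det A) <= k.+1)%N.
Proof.
move=> Ad; apply: size_sum_leq => s; rewrite -(rmorph_sign polyC) mul_polyC.
apply: leq_trans (size_scale_leq _ _) _.
rewrite -[k in (_ <= k.+1)%N]mul1n -[k in (_ * k)%N]card_ord cardE.
by rewrite -big_enum; apply: size_prod_leqM => i; apply: Ad.
Qed.

Lemma size_mxev_leq (T : Type) k (f : T -> 'M[{poly R}]_k) d u :
  (forall l i j, size (f l i j) <= d.+1)%N ->
  forall i j, (size (mxev f u i j) <= (d * size u).+1)%N.
Proof.
move=> fd; elim: u => [|l u IH] i j /=.
  by rewrite !mxE; case: (i == j); rewrite ?size_poly1 ?size_poly0.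
by rewrite mxE; apply: size_sum_leq => a; rewrite mulnS size_mul_leqD.
Qed.

End PolyDegrees.

Lemma map_mxev (R S : nzRingType) (f : {rmorphism R -> S}) (T : Type) k (g : T -> 'M[R]_k) u :
  map_mx f (mxev g u) = mxev (fun l => map_mx f (g l)) u.
Proof. by elim: u => [|l u IH] /=; rewrite ?map_mx1 // map_mxM IH. Qed.

Section TraceFromCyclic.

Variables (q N : nat) (rho : 'I_q -> 'M[algC]_N).
Hypothesis rho_unit : inv_rep rho.
Implicit Types (u v : word 'I_q).

Lemma size_line_mx i a b : (size (line_mx rho i a b) <= 2)%N.
Proof.
rewrite !mxE; apply: leq_trans (size_polyD _ _) _; rewrite geq_max.
rewrite mulrC mul_polyC (leq_trans (size_scale_leq _ _)) ?size_polyX // andbT.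
by case: (a == b); rewrite ?size_poly1 ?size_poly0.
Qed.

Lemma size_line_det u : (size (line_det rho u) <= (N * size u).+1)%N.
Proof. by apply: size_prod_leqM => l; apply: size_det_leq; apply: size_line_mx. Qed.

Lemma size_line_word u : (0 < N)%N -> (size (\tr (line_word rho u)) <= (N * size u).+1)%N.
Proof.
move=> N0; apply: size_sum_leq => a; apply: size_mxev_leq => l i j.
rewrite /line_letter; case: l.2; last by rewrite (leq_trans (size_line_mx _ _ _)).
rewrite mxE /cofactor -(rmorph_sign polyC) mul_polyC.
rewrite (leq_trans (size_scale_leq _ _)) //.
apply: leq_trans (size_det_leq _) _; last by rewrite prednK // leqnSn.
by move=> x y; rewrite !mxE; have := size_line_mx l.1 (lift j x) (lift i y); rewrite !mxE.
Qed.

Lemma line_mx1 i : map_mx (horner_eval 1) (line_mx rho i) = rho i.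
Proof.
apply/matrixP=> a b; rewrite !mxE /horner_eval hornerD hornerM hornerX mul1r hornerC.
have -> : ((a == b)%:R : {poly algC}).[1] = (a == b)%:R by case: (a == b); rewrite ?hornerC ?horner0.
by rewrite addrCA subrr addr0.
Qed.

Lemma line_det1 u : (line_det rho u).[1] != 0.
Proof.
rewrite /line_det horner_prod prodf_seq_neq0; apply/allP => l _; apply/implyP => _.
by rewrite -[_.[1]]/(horner_eval 1 _) -det_map_mx line_mx1 -unitfE; apply: rho_unit.
Qed.

Lemma line_word1 u : map_mx (horner_eval 1) (line_word rho u) =
  (line_det rho u).[1] *: rep rho u.
Proof.
rewrite map_mxev; elim: u => [|[i b] u IH] /=.
  by rewrite /line_det big_nil hornerC scale1r.
rewrite IH /line_det big_cons /line_letter /letter_mx -/(line_det rho u) /=.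
case: b => /=; last by rewrite line_mx1 scalemxAr.
have adjE : \adj (rho i) = (\det (line_mx rho i)).[1] *: invmx (rho i).
  rewrite -[_.[1]]/(horner_eval 1 _) -det_map_mx line_mx1; have := rho_unit i.
  move=> ru; rewrite /invmx ru scalerA divff ?scale1r //.
  by move: ru; rewrite unitmxE unitfE.
by rewrite map_mx_adj line_mx1 adjE hornerM -scalemxAl -scalemxAr scalerA.
Qed.

(** Cross-multiplication by the determinants gives a polynomial of degree at most
    [c = N * (size u + size v)] that is divisible by ['X^(c.+1)], hence zero; its value at 1
    compares the traces of [rho] itself. *)
Lemma trace_eq_of_cyc u v :
  (forall w : seq 'I_q, (size w <= N * (size u + size v))%N -> cyc w u = cyc w v) ->
  \tr (rep rho u) = \tr (rep rho v).
Proof.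
move=> cE; case: (posnP N) => [N0|N0].
  by rewrite /mxtrace !big1 // => i _; have := ltn_ord i; rewrite [X in (_ < X)%N]N0.
set c := (N * (size u + size v))%N in cE.
have tE : \tr (magnus_mx rho c (coef u)) = \tr (magnus_mx rho c (coef v)).
  rewrite !raddf_sum; apply: eq_bigr => j _ /=; rewrite !mxtraceZ !trace_map_mx.
  congr (_ * polyC _); apply: tr_hom_part_cyc => w wj; apply: cE.
  by rewrite wj -ltnS.
have [[E uE] [F vF]] := (line_magnus rho c u, line_magnus rho c v).
pose D := line_det rho v * \tr (line_word rho u) - line_det rho u * \tr (line_word rho v).
have DE : D = (line_det rho v * \tr E - line_det rho u * \tr F) * 'X^(c.+1).
  have := congr1 mxtrace uE; have := congr1 mxtrace vF; rewrite !raddfB /= !mxtraceZ tE /D.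
  move=> /(canRL (subrK _)) -> /(canRL (subrK _)) ->; ring.
have D0 : D = 0.
  have sD : (size D <= c.+1)%N.
    rewrite (leq_trans (size_polyD _ _)) // geq_max size_polyN /c mulnDr.
    by rewrite {1}addnC !size_mul_leqD ?size_line_det ?size_line_word.
  move: DE; set G := _ - _ => DE; have [G0|G0] := eqVneq G 0; first by rewrite DE G0 mul0r.
  have G1 : (0 < size G)%N by rewrite size_poly_gt0.
  by move: sD; rewrite DE size_Mmonic ?monicXn // size_polyXn addnS /= -[X in (_ <= X)%N]add0n leq_add2r leqNgt G1.
have := congr1 (horner_eval 1) D0.
rewrite /D rmorphB !rmorphM /= -!trace_map_mx !line_word1 !mxtraceZ /horner_eval horner0.
move/eqP; rewrite subr_eq0 mulrCA => /eqP /(mulfI (line_det1 u)) /(mulfI (line_det1 v)).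
by [].
Qed.

End TraceFromCyclic.

Local Close Scope ring_scope.

Section Shift.

Variables (q : nat) (ws : 'I_q -> word 'I_q).
Implicit Types (u x y : word 'I_q).

Lemma size_subw L u : (forall i, size (ws i) <= L) -> size (subw ws u) <= L * size u.
Proof.
move=> wL; rewrite size_flatten /shape -map_comp sumnE big_map mulnC -sum1_size big_distrl /=.
apply: leq_sum => -[i []] _; rewrite mul1n /= /letter_image //=.
by rewrite /word_inv size_rev size_map.
Qed.

Lemma size_iter_subw L u k : (forall i, size (ws i) <= L) ->
  size (iter k (subw ws) u) <= L ^ k * size u.
Proof.
move=> wL; elim: k => [|k IH]; first by rewrite mul1n.
by rewrite iterS (leq_trans (size_subw _ wL)) // expnS -mulnA leq_mul2l IH orbT.
Qed.

(* The bound of [shift_of_recurrence] for the coefficient [cyc w] with [size w <= c],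
   when [s] bounds the lengths of all the words that define the problem. *)
Definition coef_shift_bound d c s j := let D := size (words q c) in
  shift_bound D d (c * c.+1 ^ (s ^ (j + (2 * D + 2) * d.+1) * s)).

Lemma cyc_shift_bound d c s j k w x y :
  0 < d -> unity_exponent q %| d -> size w <= c -> 0 < s ->
  (forall i, size (ws i) <= s) -> size x <= s -> size y <= s ->
  let X i := iter i (subw ws) x in let Y i := iter i (subw ws) y in
  (forall i, cyc w (X (j + k + i)) = cyc w (Y (j + i))) ->
  cyc w (Y (j + d)) <> cyc w (Y j) ->
  k <= coef_shift_bound d c s j.
Proof.
move=> d0 qd wc s0 wsS xs ys X Y XY Yd; rewrite /coef_shift_bound subst_dimE.
set D := (subst_dim q c).+1; set R := (c * _)%N.
have bd i u : i <= j + (2 * D + 2) * d.+1 -> size u <= s -> `|cyc w (iter i (subw ws) u)| <= R.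
  move=> ij us; apply: leq_trans (cyc_bound _ _) _; apply: leq_mul => //.
  apply: leq_trans (_ : c.+1 ^ size (iter i (subw ws) u) <= _).
    by case: (size (iter _ _ _)) => // e; rewrite leq_exp2r.
  rewrite leq_pexp2l //; apply: leq_trans (size_iter_subw u i wsS) _.
  by apply: leq_mul => //; rewrite leq_pexp2l.
apply: (@shift_of_recurrence (subst_poly ws c) D _ _ _ R k
  (fun i => cyc w (X (j + i))) (fun i => cyc w (Y (j + i))) d0) => //.
- exact: subst_poly_monic.
- exact: size_subst_poly.
- move=> i; rewrite -[RHS](@cyc_recurrent _ ws c w (X j) wc i).
  by apply: eq_bigr => a _; rewrite /X -iterD addnC.
- exact: subst_poly_Aint.
- move=> t e rt e0 te; have := subst_poly_unity rt e0 te; case/dvdnP: qd => a ->.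
  by rewrite mulnC exprM => ->; rewrite expr1n.
- by move=> i; rewrite addnA XY.
- by apply/eqP; rewrite addn0.
- by move=> i iL; split; apply: bd; rewrite // leq_add2l.
Qed.

End Shift.

(** * Conjugacy and commutation in free groups *)

Section StackReduction.

Variable n : nat.
Notation L := (letter 'I_n).
Implicit Types (u v w : word 'I_n) (st : seq L).

(** The head is the last letter read, so stacks hold reversed words. *)
Definition push st (l : L) : seq L :=
  if st is l' :: st' then if l' == letter_inv l then st' else l :: st else [:: l].

Definition stack st u := foldl push st u.

Lemma reduced_step_sym (a b : L) : reduced_step a b = reduced_step b a.
Proof. by rewrite /reduced_step eq_sym (can2_eq (@letter_invK _) (@letter_invK _)). Qed.

Lemma sorted_push st l : sorted (@reduced_step n) st -> sorted (@reduced_step n) (push st l).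
Proof.
case: st => //= l' st ls; case: eqP => [_|/eqP l'l]; first exact: path_sorted ls.
by rewrite /= ls andbT /reduced_step l'l.
Qed.

Lemma sorted_stack st u : sorted (@reduced_step n) st -> sorted (@reduced_step n) (stack st u).
Proof. by elim: u st => [|l u IH] st ss //; apply: (IH (push st l)); apply: sorted_push. Qed.

Lemma pushK st l : sorted (@reduced_step n) st -> push (push st l) (letter_inv l) = st.
Proof.
case: st => [|l' st] /= ls; first by rewrite letter_invK eqxx.
case: eqP ls => [->|_] ls /=; last by rewrite letter_invK eqxx.
case: st ls => [|l2 st] //= /andP[]; rewrite /reduced_step letter_invK.
by move=> /negbTE ->.
Qed.

(** By [pushK], inverse letters undo each other on reduced stacks, so the final stack depends only
    on the group element. *)
Lemma stack_free_eq u v st : free_eq u v -> sorted (@reduced_step n) st ->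
  stack st u = stack st v.
Proof.
move=> uv; elim: uv st => {u v} [u|u v _ IH|u v w _ IH1 _ IH2|u u' v v' _ IH1 _ IH2|l|//] st ss.
- by [].
- by rewrite IH.
- by rewrite IH1 // IH2.
- by rewrite /stack !foldl_cat -!/(stack _ _) IH1 // IH2 // sorted_stack.
- by rewrite /= pushK.
Qed.

Lemma rev_push st l : free_eq (rev (push st l)) (rev st ++ [:: l]).
Proof.
case: st => [|l' st] /=; first exact: pres_refl.
case: eqP => [->|_]; last by rewrite rev_cons -cats1; apply: pres_refl.
rewrite /free_eq [rev (letter_inv l :: _)]rev_cons -cats1 -catA -[X in pres_eq _ X _]cats0.
apply: pres_cat; first exact: pres_refl.
by apply: pres_sym; have := pres_cancel (fun _ _ => False) (letter_inv l); rewrite letter_invK.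
Qed.

Lemma rev_stack st u : free_eq (rev (stack st u)) (rev st ++ u).
Proof.
elim: u st => [|l u IH] st /=; first by rewrite cats0; apply: pres_refl.
apply: pres_trans (IH _) _; rewrite -cat1s catA; apply: pres_cat; last exact: pres_refl.
exact: rev_push.
Qed.

Definition reduce u := rev (stack [::] u).

Lemma reduce_eq u : free_eq (reduce u) u.
Proof. exact: rev_stack. Qed.

Lemma reduceP u v : free_eq u v <-> stack [::] u = stack [::] v.
Proof.
split=> [uv|uv]; first exact: stack_free_eq.
apply: pres_trans (pres_sym (reduce_eq u)) _; rewrite /reduce uv; exact: reduce_eq.
Qed.

Lemma reduce_sorted u : sorted (@reduced_step n) (reduce u).
Proof.
rewrite rev_sorted; under eq_sorted do rewrite reduced_step_sym.
exact: sorted_stack.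
Qed.

Lemma cancelling_pair l w : ~~ path (@reduced_step n) l w ->
  exists b a c, l :: w = b ++ a :: letter_inv a :: c.
Proof.
elim: w l => [//|l' w IH] l /=; rewrite negb_and negbK => /orP[/eqP ->|/IH[b [a [c E]]]].
  by exists [::], l, w.
by exists (l :: b), a, c; rewrite E.
Qed.

(** The length bounds are kept because conjugators built from these words enter the certificates of
    the final search. *)
Lemma cyclic_reduction u : exists a u',
  [/\ cyc_reduced u', size a <= size u, size u' <= size u &
      free_eq u (a ++ u' ++ word_inv a)].
Proof.
have [k uk] := ubnP (size u); elim: k u uk => // k IH [|l u] uk.
  by exists [::], [::]; split=> //; apply: pres_refl.
case: (boolP (path (@reduced_step n) l u)) => [pu|/cancelling_pair[b [a [c E]]]].
  case: (boolP (reduced_step (last l u) l)) => [lu|].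
    exists [::], (l :: u); split=> //; last by rewrite cats0; apply: pres_refl.
    by rewrite /cyc_reduced /= rcons_path pu.
  rewrite negbK => /eqP lE; case/lastP: u lE uk pu => [|u l'] /= lE uk _.
    by have := letter_inv_neq l; rewrite -lE eqxx.
  rewrite last_rcons in lE; rewrite /= size_rcons ltnS in uk.
  have [|a [u' [cu' sa su' ua]]] := IH u; first exact: ltnW.
  rewrite size_rcons; exists (l :: a), u'; split=> //.
  - by rewrite /= ltnS leqW.
  - by rewrite (leq_trans su') // !leqW.
  rewrite -cats1 -[l :: a]cat1s word_inv_cat -[l :: _]cat1s -!catA.
  apply: pres_cat; first exact: pres_refl.
  rewrite [a ++ _]catA [(a ++ u') ++ _]catA; apply: pres_cat; first by rewrite -catA.
  by rewrite /word_inv /= lE letter_invK; apply: pres_refl.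
rewrite E size_cat /= in uk *; have uE : free_eq (b ++ a :: letter_inv a :: c) (b ++ c).
  apply: pres_cat; first exact: pres_refl.
  rewrite -[a :: _]/([:: a; letter_inv a] ++ c) -[X in pres_eq _ _ X]cat0s.
  by apply: pres_cat; [apply: pres_cancel | apply: pres_refl].
have sz : size (b ++ c) <= size b + (size c).+2 by rewrite size_cat leq_add2l !leqW.
have [|d [u' [cu' sd su' ud]]] := IH (b ++ c).
  by rewrite -ltnS (leq_trans _ uk) // ltnS size_cat !addnS !ltnS leqnSn.
exists d, u'; split=> //; first exact: leq_trans sz; first exact: leq_trans sz.
exact: pres_trans ud.
Qed.

Lemma iter_rot1 (T : Type) (w : seq T) i : exists2 k, k <= size w & iter i (rot 1) w = rot k w.
Proof.
elim: i => [|i [k kw E]]; first by exists 0 => //; rewrite rot0.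
rewrite iterS {}E; move: kw; rewrite leq_eqVlt => /predU1P[->|kw].
  case: (posnP (size w)) => [w0|w0]; first by exists 0 => //; rewrite (size0nil w0).
  by exists 1 => //; rewrite rot_size.
by exists k.+1 => //; rewrite -rotS.
Qed.

Lemma mxev_free_eq (R : comUnitRingType) N (f : L -> 'M[R]_N) u v : inverse_pairs f ->
  free_eq u v -> mxev f u = mxev f v.
Proof.
move=> fV; elim=> {u v} [//|u v _ ->//|u v w _ -> _ ->//|u u' v v' _ IH1 _ IH2|l|//].
  by rewrite !mxev_cat IH1 IH2.
by rewrite /= mulmx1 fV.
Qed.

Lemma mxev_conj_trace (R : comUnitRingType) N (f : L -> 'M[R]_N) u v z : inverse_pairs f ->
  free_eq u (z ++ v ++ word_inv z) -> (\tr (mxev f u) = \tr (mxev f v))%R.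
Proof.
move=> fV /(mxev_free_eq fV) ->; rewrite !mxev_cat mxtrace_mulC -mulmxA.
have := mxev_inv (word_inv z) fV; rewrite word_invK => ->.
by rewrite mulmx1.
Qed.

Lemma conjugate_of_traces u v :
  (forall r, r <= 7 -> same_trace (#|{: 'I_n * bool}| * tdim r) u v) ->
  exists2 z, size z <= size u + 2 * size v & free_eq (word_inv z ++ u ++ z) v.
Proof.
move=> H; have [a [u' [cu sa su ua]]] := cyclic_reduction u.
have [b [v' [cv sb sv vb]]] := cyclic_reduction v.
have [|i] := trace_separation cu cv.
  move=> r r7 rho rV; have := H r r7 rho rV; have fV := letter_mx_inv rV.
  by rewrite /rep (mxev_conj_trace fV ua) (mxev_conj_trace fV vb).
have [k kv ->] := iter_rot1 v' i => uE.
(* [p] realises the rotation as a conjugation. The three factors have lengths at most [size u],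
   [size v] and [size v]. *)
pose p := take k v'; exists (a ++ word_inv p ++ word_inv b).
  rewrite !size_cat /word_inv !size_rev !size_map mul2n -addnn.
  apply: leq_add => //; apply: leq_add => //; apply: leq_trans sv.
  by rewrite size_take; case: ltnP => // /ltnW.
have weq s t : free_eq s t -> welt (fun _ _ => False) s = welt (fun _ _ => False) t by move/weltP.
apply/weltP; rewrite !word_inv_cat !welt_cat (weq _ _ _ ua) (weq _ _ _ vb) uE /rot.
rewrite -{3}(cat_take_drop k v') !welt_cat -/p !welt_inv !monoid.invgK.
by rewrite !monoid.mulgA !(monoid.mulgVK, monoid.mulgK).
Qed.

End StackReduction.

Local Open Scope ring_scope.

Lemma exists_nonroot (p : {poly algC}) : p != 0 -> exists2 x, x != 0 & p.[x] != 0.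
Proof.
move=> p0; case: (boolP (has (fun x => p.[x] != 0) [seq i.+1%:R | i <- iota 0 (size p)])).
  case/hasP => x /mapP[i _ ->] px; exists i.+1%:R => //.
  by rewrite pnatr_eq0.
rewrite -all_predC => /allP rp; case/negP: p0; apply/eqP.
apply: (@roots_geq_poly_eq0 _ _ [seq i.+1%:R | i <- iota 0 (size p)]).
- by apply/allP => x /rp /=; rewrite negbK.
- rewrite map_inj_uniq ?iota_uniq // => i j /eqP.
  by rewrite eqr_nat => /eqP[].
- by rewrite size_map size_iota.
Qed.

(** * Plane representations and transitivity of commutation *)

Section PencilTop.

Variables (T : Type) (N : nat) (A B : T -> 'M[algC]_N).

Definition linear_pencil l : 'M[{poly algC}]_N :=
  'X *: map_mx polyC (A l) + map_mx polyC (B l).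

Lemma linear_pencil_horner x w :
  map_mx (horner_eval x) (mxev linear_pencil w) = mxev (fun l => x *: A l + B l) w.
Proof.
rewrite map_mxev; apply: eq_mxev => l; apply/matrixP => i j; rewrite !mxE /= /horner_eval.
by rewrite hornerD hornerM hornerX !hornerC.
Qed.

Lemma size_linear_pencil w i j : (size (mxev linear_pencil w i j) <= (size w).+1)%N.
Proof.
rewrite -[size w]mul1n; apply: size_mxev_leq => l a b; rewrite !mxE.
rewrite (leq_trans (size_polyD _ _)) // geq_max mulrC mul_polyC.
by rewrite (leq_trans (size_scale_leq _ _)) ?size_polyX // (leq_trans (size_polyC_leq1 _)).
Qed.

Lemma linear_pencil_top w i j : (mxev linear_pencil w i j)`_(size w) = mxev A w i j.
Proof.
elim: w i j => [|l w IH] i j /=; first by rewrite !mxE; case: (i == j); rewrite coefC.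
rewrite !mxE coef_sum; apply: eq_bigr => k _; rewrite !mxE mulrDl coefD.
rewrite -mulrA coefXM /= !coefCM IH [X in _ + _ * X]nth_default ?mulr0 ?addr0 //.
exact: size_linear_pencil.
Qed.

End PencilTop.

Lemma idempotent_entry (F : fieldType) (a b c d : F) : a - b != 0 ->
  c / (a - b) * - b * (1 / (a - b) * d) + (c / (a - b) * 1 * (a / (a - b) * d) + 0) =
  c / (a - b) * d.
Proof. by move=> h; field. Qed.

Lemma proj_entry (F : fieldType) (v e a b c k r : F) :
  v * e * - c * (1 * k * r) + (v * e * 1 * (b * k * r) + 0) = v * (e * (b - c) * k) * r.
Proof. by ring. Qed.

Lemma proj_sum (F : fieldType) (a b e : F) : (a - b) * e = 1 ->
  1 * e * - b + 1 * - e * - a = 1 /\ 1 * e * 1 + 1 * - e * 1 = 0 /\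
  a * e * - b + b * - e * - a = 0 /\ a * e * 1 + b * - e * 1 = 1.
Proof. by move=> h; do ![split]; try ring; rewrite -[RHS]h; ring. Qed.

Lemma commuting_entries (F : fieldType) (a b c d x y z t : F) : b != 0 ->
  a * x + b * z = x * a + y * c -> a * y + b * t = x * b + y * d ->
  z = y * c / b /\ t = x - y * (a - d) / b.
Proof.
move=> b0 E1 E2; split; apply: (mulfI b0).
  rewrite [RHS]mulrC mulfVK //.
  by move: E1; rewrite [x * a]mulrC => /addrI.
rewrite mulrBr [b * (_ / b)]mulrC mulfVK //.
have -> : b * t = a * y + b * t - a * y by ring.
by rewrite E2; ring.
Qed.

(** A nonzero corner makes [A] nonscalar, and in size 2 the centraliser of a nonscalar matrix is
    commutative: a member is determined linearly by its first row. *)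
Lemma centralizer_comm (F : fieldType) (A B C : 'M[F]_2) : A 0 1 != 0 ->
  A *m B = B *m A -> A *m C = C *m A -> B *m C = C *m B.
Proof.
move=> a0 AB AC; have one : lift ord0 ord0 = 1 :> 'I_2 by apply/val_inj.
have H (D : 'M[F]_2) : A *m D = D *m A ->
    D 1 0 = D 0 1 * A 1 0 / A 0 1 /\ D 1 1 = D 0 0 - D 0 1 * (A 0 0 - A 1 1) / A 0 1.
  move=> /matrixP AD; have := AD 0 0; have := AD 0 1.
  rewrite !mxE !big_ord_recl !big_ord0 /= one !addr0 => E1 E2.
  exact: commuting_entries.
have [B1 B2] := H _ AB; have [C1 C2] := H _ AC.
apply/matrixP => i j; rewrite !mxE !big_ord_recl !big_ord0 /= one.
have two (k : 'I_2) : k = 0 \/ k = 1.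
  by case: k => [[|[|k]]] // kp; [left|right]; apply/val_inj.
case: (two i) => ->; case: (two j) => ->; rewrite ?B1 ?B2 ?C1 ?C2.
all: move: (A 0 0) (A 0 1) (A 1 0) (A 1 1) (B 0 0) (B 0 1) (C 0 0) (C 0 1) => a b c d x y z t.
all: by move: (b^-1) => e; ring.
Qed.

Section PlaneRepresentation.

Variable n : nat.
Notation L := (letter 'I_n).

(* A free group acts on the projective line with the pairwise distinct points
   [point l] as attractors; [proj_mx l] is the projection onto the line of
   [point l] along that of [point (letter_inv l)]. *)
Definition point (l : L) : algC := (enum_rank (l : 'I_n * bool)%type)%:R.

Definition point_vec (l : L) (i : 'I_2) : algC := if i == 0 then 1 else point l.
Definition point_form (l : L) (i : 'I_2) : algC := if i == 0 then - point (letter_inv l) else 1.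

Definition proj_mx (l : L) : 'M[algC]_2 :=
  \matrix_(i, j) (point_vec l i * (point l - point (letter_inv l))^-1 * point_form l j).

Lemma point_neq (a b : L) : a != b -> point a - point b != 0.
Proof.
by apply: contraNneq => /eqP; rewrite subr_eq0 eqr_nat => /eqP /val_inj /enum_rank_inj ->.
Qed.

Lemma point_gap (l : L) : point l - point (letter_inv l) != 0.
Proof. by apply: point_neq; rewrite eq_sym letter_inv_neq. Qed.

Lemma proj_mx_idem l : proj_mx l *m proj_mx l = proj_mx l.
Proof.
apply/matrixP => i j; rewrite !mxE !big_ord_recl big_ord0 !mxE /point_vec /point_form /=.
exact: idempotent_entry (point_gap l).
Qed.

Lemma proj_mxD l : proj_mx l + proj_mx (letter_inv l) = 1%:M.
Proof.
have h := point_gap l; apply/matrixP => i j; rewrite !mxE /point_vec /point_form letter_invK.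
have h' : point (letter_inv l) - point l != 0 by rewrite -opprB oppr_eq0.
have gE : (point (letter_inv l) - point l)^-1 = - (point l - point (letter_inv l))^-1.
  by rewrite -opprB invrN.
case: i => [[|[|i]]] // ip; case: j => [[|[|j]]] // jp; rewrite /= ?mulr1n ?mulr0n gE.
all: by have [? [? []]] := proj_sum (divff h).
Qed.

Lemma proj_mx0 l : proj_mx l *m proj_mx (letter_inv l) = 0.
Proof.
have -> : proj_mx (letter_inv l) = 1%:M - proj_mx l by rewrite -(proj_mxD l) addrAC subrr add0r.
by rewrite mulmxBr mulmx1 proj_mx_idem subrr.
Qed.

Lemma proj_mx_word a w : path (@reduced_step n) a w -> exists2 k, k != 0 &
  forall i j, mxev proj_mx (a :: w) i j = point_vec a i * k * point_form (last a w) j.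
Proof.
elim: w a => [|b w IH] a /=.
  move=> _; exists (point a - point (letter_inv a))^-1; first by rewrite invr_eq0 point_gap.
  by move=> i j; rewrite mulmx1 mxE.
case/andP => ab /IH[k k0 kE]; exists ((point a - point (letter_inv a))^-1 *
    (point b - point (letter_inv a)) * k).
  by rewrite !mulf_neq0 ?invr_eq0 ?point_gap // point_neq.
move=> i j; rewrite mxE !big_ord_recl big_ord0 -/(mxev proj_mx (b :: w)) !kE !mxE.
have [-> ->] : point_form a ord0 = - point (letter_inv a) /\ point_form a (lift ord0 ord0) = 1 by [].
have [-> ->] : point_vec b ord0 = 1 /\ point_vec b (lift ord0 ord0) = point b by [].
exact: (proj_entry (point_vec a i) _ (point a) (point b)).
Qed.

(** A generator has eigenvalue [x] on its attractor and 1 on that of its inverse; the scalar [x^-1]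
    makes inverse letters inverse matrices. *)
Definition plane_letter (x : algC) (l : L) : 'M[algC]_2 :=
  (if l.2 then x^-1 else 1) *: (x *: proj_mx l + proj_mx (letter_inv l)).

Lemma plane_letter_inv x : x != 0 -> inverse_pairs (plane_letter x).
Proof.
move=> x0 l; rewrite /plane_letter -scalemxAl -scalemxAr scalerA letter_invK.
rewrite mulmxDl !mulmxDr -!scalemxAl -!scalemxAr !proj_mx_idem proj_mx0.
have := proj_mx0 (letter_inv l); rewrite letter_invK => ->.
rewrite !scaler0 add0r addr0 -scalerDr proj_mxD scalerA.
by case: l => i [] /=; rewrite ?mulr1 ?mul1r mulVf // scale1r.
Qed.

Lemma plane_letterE x w : x != 0 -> exists2 k, k != 0 &
  mxev (plane_letter x) w =
  k *: map_mx (horner_eval x) (mxev (linear_pencil proj_mx (proj_mx \o @letter_inv _)) w).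
Proof.
move=> x0; rewrite linear_pencil_horner; elim: w => [|l w [k k0 IH]] /=.
  by exists 1; rewrite ?oner_neq0 // scale1r.
exists ((if l.2 then x^-1 else 1) * k).
  by rewrite mulf_neq0 //; case: l.2; rewrite ?invr_eq0 ?oner_neq0.
by rewrite IH /plane_letter -scalemxAl -scalemxAr scalerA.
Qed.

Definition plane_poly (w : word 'I_n) : {poly algC} :=
  mxev (linear_pencil proj_mx (proj_mx \o @letter_inv _)) w 0 1.

(** In a reduced word no attractor lies in the kernel of the preceding projection, so the leading
    coefficient survives. The corner is used because [point_vec] and [point_form] are 1 there. *)
Lemma plane_poly_neq0 (w : word 'I_n) : w != [::] -> sorted (@reduced_step n) w ->
  plane_poly w != 0.
Proof.
case: w => // a w _ /proj_mx_word[k k0 kE]; apply/eqP => /(congr1 (fun p : {poly _} => p`_(size (a :: w)))).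
rewrite linear_pencil_top kE coef0 /point_vec /point_form /= mul1r mulr1.
exact/eqP.
Qed.

(** At a generic [x] the corners of [c] and of the commutator [k] of [a] and [b] are nonzero if [k]
    is nontrivial. The images of [a] and [b] then commute, so [k] maps to 1, against its corner. *)
Lemma commutation_transitive (a b c : word 'I_n) : ~ free_eq c [::] ->
  free_eq (c ++ a) (a ++ c) -> free_eq (c ++ b) (b ++ c) -> free_eq (a ++ b) (b ++ a).
Proof.
move=> c1 ca cb; pose k := (a ++ b) ++ word_inv (b ++ a).
have nz u : ~ free_eq u [::] -> plane_poly (reduce u) != 0.
  move=> u1; apply: plane_poly_neq0; last exact: reduce_sorted.
  by apply/eqP => ru; apply: u1; apply: pres_trans (pres_sym (reduce_eq u)) _; rewrite ru; apply: pres_refl.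
have [k1|k1] := eqVneq (reduce k) [::].
  apply/weltP; have : free_eq k [::] by rewrite -k1; apply/pres_sym/reduce_eq.
  by move/weltP; rewrite /k welt_cat welt_inv => /(canRL (monoid.mulgVK _)); rewrite monoid.mul1g.
have k0 : plane_poly (reduce k) != 0 by apply: plane_poly_neq0 => //; apply: reduce_sorted.
have [x x0] := exists_nonroot (mulf_neq0 (nz c c1) k0).
rewrite hornerM mulf_eq0 negb_or => /andP[cx kx].
have fV := plane_letter_inv x0.
have entry u : (plane_poly (reduce u)).[x] != 0 -> mxev (plane_letter x) u 0 1 != 0.
  move=> ux; rewrite -(mxev_free_eq fV (reduce_eq u)).
  by have [e e0 ->] := plane_letterE (reduce u) x0; rewrite !mxE mulf_neq0.
have E u v : free_eq (u ++ v) (v ++ u) ->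
    mxev (plane_letter x) u *m mxev (plane_letter x) v = mxev (plane_letter x) v *m mxev (plane_letter x) u.
  by move/(mxev_free_eq fV); rewrite !mxev_cat.
have ab := centralizer_comm (entry c cx) (E _ _ ca) (E _ _ cb).
have := entry k kx; rewrite /k mxev_cat mxev_cat ab -mxev_cat mxev_inv //.
by rewrite mxE eqxx.
Qed.

End PlaneRepresentation.

(** * The group F_n x Z^m *)

Local Close Scope ring_scope.

Section Counts.

Variable q : nat.
Implicit Types (u v : word 'I_q).
Local Open Scope ring_scope.

Definition expo i u : int := (count_mem (i, false) u)%:Z - (count_mem (i, true) u)%:Z.

Lemma expo_cat i u v : expo i (u ++ v) = expo i u + expo i v.
Proof. by rewrite /expo !count_cat !PoszD opprD addrACA. Qed.

Lemma coef_cat1 i u v : coef (u ++ v) [:: i] = coef u [:: i] + coef v [:: i].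
Proof.
rewrite coef_cat /conv big_ord_recl big_ord_recl big_ord0 /= !coef_nil mul1r mulr1 addr0.
by rewrite addrC.
Qed.

(** As Magnus coefficients of degree 1, exponent sums fall under the same recurrence estimates. *)
Lemma expoE i u : expo i u = coef u [:: i].
Proof.
elim: u => [|l u IH]; first by rewrite /expo /coef /= subrr.
rewrite -cat1s expo_cat coef_cat1 IH; congr (_ + _).
case: l => j b; rewrite /expo /coef /= /mag_letter /= /delta0 /mag_mul /= !xpair_eqE.
by rewrite [j == i]eq_sym; case: b => /=; case: (i == j).
Qed.

Lemma cyc1 i u : cyc [:: i] u = expo i u.
Proof. by rewrite expoE /cyc big_ord1 rot0. Qed.

Lemma expo_inv i u : expo i (word_inv u) = - expo i u.
Proof.
apply/eqP; rewrite -addr_eq0 addrC -expo_cat expoE.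
by rewrite /coef (mag_act_free _ (pres_mulV _ u)).
Qed.

Lemma rep_scalar (rho : 'I_q -> 'M[algC]_1) u : inv_rep rho ->
  rep rho u 0 0 = \prod_i (rho i 0 0) ^ (expo i u).
Proof.
move=> rV; have r0 i : rho i 0 0 != 0.
  by have := rV i; rewrite unitmxE unitfE det_mx11.
elim: u => [|l u IH]; first by rewrite mxE big1 // => i _; rewrite /expo subrr.
rewrite -cat1s /rep mxev_cat mxE big_ord1 IH; under [RHS]eq_bigr do rewrite expo_cat expfzDr //.
rewrite big_split; congr (_ * _); case: l => j b; rewrite (bigD1 j) //= big1 => [|i ij].
  rewrite mulmx1 mulr1 /letter_mx /expo /= !xpair_eqE eqxx /=; case: b => //=.
  apply: (mulfI (r0 j)); rewrite divff //.
  by have := mulmxV (rV j) => /matrixP /(_ 0 0); rewrite !mxE big_ord1.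
by rewrite /expo /= !xpair_eqE [j == i]eq_sym (negbTE ij).
Qed.

Lemma same_trace1P u v : same_trace 1 u v <-> forall i, expo i u = expo i v.
Proof.
split=> [H i|H rho rV]; last first.
  by rewrite /mxtrace !big_ord1 !rep_scalar //; apply: eq_bigr => i _; rewrite H.
(* Since 2 has infinite order, sending one generator to 2 and the others to 1 recovers its exponent
   sum. *)
pose rho j : 'M[algC]_1 := (if j == i then 2 else 1)%:M.
have rV : inv_rep rho.
  by move=> j; rewrite unitmxE unitfE det_scalar1; case: ifP; rewrite ?oner_neq0 ?pnatr_eq0.
have := H rho rV; rewrite /mxtrace !big_ord1 !rep_scalar //.
have E w : \prod_j rho j 0 0 ^ expo j w = 2 ^ expo i w.
  rewrite (bigD1 i) //= big1 => [|j ji]; rewrite !mxE ?eqxx ?mulr1 // (negbTE ji) mulr1n.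
  by rewrite exp1rz.
rewrite !E; move: (expo i u) (expo i v) => a b ab; apply/eqP; rewrite -subr_eq0.
have : (2 : algC) ^ (a - b) = 1 by rewrite expfzDr ?pnatr_eq0 // ab -expfzDr ?pnatr_eq0 // subrr.
have two k : (2 : algC) ^+ k.+1 == 1 = false.
  by rewrite pexpr_eq1 ?ler0n //; apply/negbTE; rewrite -[1]/1%:R eqr_nat.
case: (a - b) => [[|k]|k] // /eqP; first by rewrite -exprnP two.
by rewrite NegzE -exprnN invr_eq1 two.
Qed.

End Counts.

Lemma subw_free_eq p q (ws : 'I_p -> word 'I_q) u v :
  free_eq u v -> free_eq (subw ws u) (subw ws v).
Proof.
elim=> {u v} [u|u v _ IH|u v w _ IH1 _ IH2|u u' v v' _ IH1 _ IH2|l|//].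
- exact: pres_refl.
- exact: pres_sym.
- exact: pres_trans IH2.
- by rewrite !subw_cat; apply: pres_cat.
- rewrite /subw /= cats0 letter_image_inv; exact: pres_mulV.
Qed.

Section FreeTimesAbelian.

Variables n m : nat.
Notation W := (FZword n m).
Implicit Types (u v : W) (z : word 'I_n).

Definition FZ_eq u v := pres_eq (@FZ_rel n m) u v.

Definition xletter (l : letter 'I_(n + m)) : option (letter 'I_n) :=
  if split l.1 is inl i then Some (i, l.2) else None.

Definition xproj u : word 'I_n := pmap xletter u.
Definition xlift z : W := [seq (lshift m l.1, l.2) | l <- z].

Lemma xletter_l i b : xletter (lshift m i, b) = Some (i, b).
Proof. by rewrite /xletter /= -[lshift m i]/(unsplit (inl i)) unsplitK. Qed.

Lemma xletter_r i b : xletter (rshift n i, b) = None.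
Proof. by rewrite /xletter /= -[rshift n i]/(unsplit (inr i)) unsplitK. Qed.

Lemma xliftK z : xproj (xlift z) = z.
Proof. by elim: z => //= -[i b] z IH; rewrite xletter_l /= IH. Qed.

Lemma xproj_cat u v : xproj (u ++ v) = xproj u ++ xproj v.
Proof. exact: pmap_cat. Qed.

Lemma size_xproj u : size (xproj u) <= size u.
Proof. by rewrite size_pmap count_size. Qed.

Lemma xproj_inv u : xproj (word_inv u) = word_inv (xproj u).
Proof.
elim: u => // l u IH; rewrite -cat1s word_inv_cat !xproj_cat word_inv_cat IH; congr (_ ++ _).
case: l => i b; case: (split_ordP i) => j ->; rewrite /xproj /word_inv /= /letter_inv /=.
  by rewrite !xletter_l.
by rewrite !xletter_r.
Qed.

Lemma xproj_eq u v : FZ_eq u v -> free_eq (xproj u) (xproj v).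
Proof.
elim=> {u v} [u|u v _ IH|u v w _ IH1 _ IH2|u u' v v' _ IH1 _ IH2|l|u v].
- exact: pres_refl.
- exact: pres_sym.
- exact: pres_trans IH2.
- by rewrite !xproj_cat; apply: pres_cat.
- case: l => i b; case: (split_ordP i) => j ->; rewrite /xproj /letter_inv /=.
    by rewrite !xletter_l; apply: (pres_cancel _ (j, b)).
  by rewrite !xletter_r; apply: pres_refl.
- by case=> [i j|i k]; rewrite /xproj /= ?xletter_l !xletter_r; apply: pres_refl.
Qed.

Lemma xlift_eq z z' : free_eq z z' -> FZ_eq (xlift z) (xlift z').
Proof.
elim=> {z z'} [u|u v _ IH|u v w _ IH1 _ IH2|u u' v v' _ IH1 _ IH2|l|//].
- exact: pres_refl.
- exact: pres_sym.
- exact: pres_trans IH2.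
- by rewrite /xlift !map_cat; apply: pres_cat.
- exact: (pres_cancel _ (lshift m l.1, l.2)).
Qed.

Lemma expo_FZ_eq i u v : FZ_eq u v -> expo i u = expo i v.
Proof.
elim=> {u v} [//|//|u v w _ -> _ ->//|u u' v v' _ IH1 _ IH2|l|u v].
- by rewrite !expo_cat IH1 IH2.
- by rewrite -cat1s expo_cat; have := expo_inv i [:: l]; rewrite {1}/word_inv /= => ->; rewrite GRing.subrr.
- by case=> [a b|a b]; rewrite !expo_cat GRing.addrC.
Qed.

Definition central i := forall u, FZ_eq ((i, false) :: u) (rcons u (i, false)).

Lemma centralP i : (forall j, FZ_eq [:: (i, false); (j, false)] [:: (j, false); (i, false)]) ->
  central i.
Proof.
move=> H; set a := FZelt [:: (i, false)] : FZ n m.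
suff C u : monoid.commute a (FZelt u).
  by move=> u; apply/weltP; rewrite -cat1s -cats1 !welt_cat; apply: C.
elim: u => [|l u IH]; first exact: monoid.commute1.
rewrite /FZelt -cat1s welt_cat; apply: monoid.commuteM IH.
case: l => j b; have C : monoid.commute a (FZelt [:: (j, false)]).
  by rewrite /monoid.commute /a /FZelt -!welt_cat; apply/weltP/H.
by case: b => //; rewrite -[[:: _]]/(word_inv [:: (j, false)]) welt_inv; apply: monoid.commuteV.
Qed.

Lemma central_t j : central (rshift n j).
Proof.
apply: centralP => i; apply: pres_rel; case: (split_ordP i) => k ->.
  exact: (@FZ_tx n m j k).
exact: (@FZ_tt n m j k).
Qed.

Lemma central_small i : n <= 1 -> central i.
Proof.
case: (split_ordP i) => k -> n1; last exact: central_t.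
apply: centralP => i'; case: (split_ordP i') => k' ->.
  suff -> : k = k' by apply: pres_refl.
  by apply: ord_inj; move: (ltn_ord k) (ltn_ord k') n1; clear; lia.
by apply: pres_sym; apply: pres_rel; apply: (@FZ_tx n m k' k).
Qed.

Lemma central_collect i u : central i ->
  FZ_eq u ([seq l <- u | l.1 != i] ++ nseq (count_mem (i, false) u) (i, false)
           ++ nseq (count_mem (i, true) u) (i, true)).
Proof.
move=> ci; have ca u' v : FZ_eq ((i, false) :: u' ++ v) (u' ++ (i, false) :: v).
  by rewrite -cat_cons -cat_rcons; apply: pres_cat; [apply: ci | apply: pres_refl].
have cb u' v : FZ_eq ((i, true) :: u' ++ v) (u' ++ (i, true) :: v).
  rewrite -cat_cons -cat_rcons; apply: pres_cat; last exact: pres_refl.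
  apply/weltP; have /weltP := ci u'; rewrite -!cats1 -!(cat1s _ u') !welt_cat => C.
  rewrite -[[:: (i, true)]]/(word_inv [:: (i, false)]) welt_inv.
  exact/esym/monoid.commuteV/esym.
elim: u => [|[j b] u IH]; first exact: pres_refl.
have {}IH := pres_cat (pres_refl _ [:: (j, b)]) IH.
rewrite -cat1s; apply: pres_trans IH _ => /=.
rewrite !xpair_eqE; case: (eqVneq j i) => [->|ji] /=; last exact: pres_refl.
case: b => /=; rewrite ?add0n ?add1n /=; last exact: ca.
by rewrite catA; apply: pres_trans (cb _ _) _; rewrite -catA; apply: pres_refl.
Qed.

(** Central generators are collected at the end one at a time. This serves the [t_j] in general and
    all generators when [n <= 1]. *)
Lemma eq_of_central (C : seq 'I_(n + m)) u v : {in C, forall i, central i} ->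
  {in C, forall i, expo i u = expo i v} ->
  FZ_eq [seq l <- u | l.1 \notin C] [seq l <- v | l.1 \notin C] -> FZ_eq u v.
Proof.
elim: C u v => [|i C IH] u v cC eC.
  by rewrite !(eq_filter (_ : _ =1 predT)) ?filter_predT.
move=> H; have fE w : [seq l <- w | l.1 \notin i :: C] =
    [seq l <- [seq l <- w | l.1 != i] | l.1 \notin C].
  by rewrite -filter_predI; apply: eq_filter => l; rewrite /= inE negb_or andbC.
have cf j b w : count_mem (j, b) [seq l <- w | l.1 != i] =
    if j == i then 0 else count_mem (j, b) w.
  rewrite count_filter; case: eqP => [->|/eqP ji].
    by rewrite -(count_pred0 w); apply: eq_count => -[k c] /=; rewrite xpair_eqE; case: (k == i); rewrite ?andbF.
  by apply: eq_count => -[k c] /=; rewrite xpair_eqE; case: (eqVneq k j) => //= ->; rewrite ji andbT.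
have uv : FZ_eq [seq l <- u | l.1 != i] [seq l <- v | l.1 != i].
  apply: IH; last by rewrite -!fE.
    by move=> j jC; apply: cC; rewrite inE jC orbT.
  move=> j jC; rewrite /expo !cf; case: eqP => // _.
  by apply: (eC j); rewrite inE jC orbT.
have ci : central i by apply: cC; rewrite inE eqxx.
apply: pres_trans (central_collect u ci) _.
apply: pres_trans _ (pres_sym (central_collect v ci)).
apply: pres_cat => //; have := eC i; rewrite inE eqxx /expo => /(_ isT).
move: (count_mem _ u) (count_mem _ u) (count_mem _ v) (count_mem _ v) => a b c d E.
have {}E : a + d = c + b by move: E; clear; lia.
have nw k : nseq k (i, true) = word_inv (nseq k (i, false)) :> W.
  by rewrite /word_inv map_nseq rev_nseq.
apply/weltP; rewrite !nw !welt_cat !welt_inv; apply: (monoid.mulIg (welt _ (nseq (a + c) (i, false)))).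
rewrite {1}nseqD [a + c]addnC nseqD !welt_cat !monoid.mulgA !monoid.mulgVK -!welt_cat -!nseqD.
by rewrite [(b + c)%N]addnC [(d + a)%N]addnC E.
Qed.

Lemma FZ_eq_of_xproj u v : (forall j, expo (rshift n j) u = expo (rshift n j) v) ->
  free_eq (xproj u) (xproj v) -> FZ_eq u v.
Proof.
move=> e uv; apply: (@eq_of_central [seq rshift n j | j <- enum 'I_m]) => [i|i|].
- by case/mapP => j _ ->; apply: central_t.
- by case/mapP => j _ ->; apply: e.
have E w : [seq l <- w | l.1 \notin [seq rshift n j | j <- enum 'I_m]] = xlift (xproj w).
  elim: w => //= -[i b] w ->; case: (split_ordP i) => k ->; rewrite /xproj /= ?xletter_l ?xletter_r.
    by rewrite ifT //; apply/mapP => -[j _ /eqP]; rewrite eq_lrshift.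
  by rewrite map_f ?mem_enum.
by rewrite !E; apply: xlift_eq.
Qed.

Lemma FZ_eq_small u v : n <= 1 -> (forall i, expo i u = expo i v) -> FZ_eq u v.
Proof.
move=> n1 e; apply: (@eq_of_central (enum 'I_(n + m))) => [i _|i _|]; first exact: central_small.
  exact: e.
have E w : [seq l <- w | l.1 \notin enum 'I_(n + m)] = [::].
  by elim: w => //= l w ->; rewrite mem_enum.
by rewrite !E; apply: pres_refl.
Qed.

(** Dimension 1 records all exponent sums. The guard is there because for [n <= 1] the images of the
    [t_j] may have nontrivial [F_n]-component. *)
Definition trace_equiv u v := same_trace 1 u v /\
  (2 <= n -> forall r, r <= 7 -> same_trace (#|{: 'I_n * bool}| * tdim r) (xproj u) (xproj v)).

Lemma conjugate_of_trace_equiv u v : trace_equiv u v ->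
  exists2 z, size z <= size u + 2 * size v &
    FZ_eq (word_inv (xlift z) ++ u ++ xlift z) v.
Proof.
case=> /same_trace1P e H; have ec z i : expo i (word_inv (xlift z) ++ u ++ xlift z) = expo i v.
  by rewrite !expo_cat expo_inv e GRing.addrCA GRing.addNr GRing.addr0.
have [n1|n2] := leqP n 1; first by exists [::] => //; apply: FZ_eq_small.
have [z zs zE] := conjugate_of_traces (H n2).
exists z; first by apply: leq_trans zs _; rewrite leq_add ?leq_mul2l ?size_xproj.
apply: FZ_eq_of_xproj => //; by rewrite !xproj_cat xproj_inv xliftK.
Qed.

Lemma xproj_conj u v (c : W) : FZ_eq (word_inv c ++ u ++ c) v ->
  free_eq (word_inv (xproj c) ++ xproj u ++ xproj c) (xproj v).
Proof. by move/xproj_eq; rewrite !xproj_cat xproj_inv. Qed.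

Lemma free_conj_trace N (u v c : word 'I_n) : free_eq (word_inv c ++ u ++ c) v -> same_trace N u v.
Proof.
move=> uv rho rV; have fV := letter_mx_inv rV; apply: (mxev_conj_trace (z := c) fV).
apply/weltP; move/weltP: uv; rewrite !welt_cat !welt_inv => <-.
by rewrite !monoid.mulgA monoid.mulgK monoid.mulgV monoid.mul1g.
Qed.

Lemma trace_equiv_of_conjugate u v c : FZ_eq (word_inv c ++ u ++ c) v -> trace_equiv u v.
Proof.
move=> uv; split; last by move=> _ r _; apply: free_conj_trace (xproj_conj uv).
apply/same_trace1P => i; rewrite -(expo_FZ_eq i uv) !expo_cat expo_inv.
by rewrite GRing.addrCA GRing.addNr GRing.addr0.
Qed.

Section Endomorphism.

Variables (ws : 'I_(n + m) -> W) (Phi : {multiplicative FZ n m -> FZ n m}).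
Hypothesis reprP : forall i, Phi (FZelt [:: (i, false)]) = FZelt (ws i).

Lemma Phi1 : Phi 1%g = 1%g.
Proof.
apply: (monoid.mulIg (Phi 1%g)).
by rewrite -(@monoid.gmulfM _ _ Phi) !monoid.mul1g.
Qed.

Lemma PhiV x : Phi (x^-1)%g = ((Phi x)^-1)%g.
Proof.
apply: (monoid.mulIg (Phi x)).
by rewrite -(@monoid.gmulfM _ _ Phi) !monoid.mulVg Phi1.
Qed.

Lemma Phi_subw u : Phi (FZelt u) = FZelt (subw ws u).
Proof.
elim: u => [|[i b] u IH]; first exact: Phi1.
rewrite -cat1s subw_cat /FZelt !welt_cat (@monoid.gmulfM _ _ Phi) -!/(FZelt _) IH; congr (_ * _)%g.
rewrite (_ : FZelt [::] = 1%g) ?monoid.mulg1 //; case: b => /=; last exact: reprP.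
rewrite -[[:: _]]/(word_inv [:: (i, false)]) /FZelt !welt_inv PhiV; congr (_^-1)%g.
exact: reprP.
Qed.

Lemma Phi_iter k u : iter k Phi (FZelt u) = FZelt (iter k (subw ws) u).
Proof. by elim: k => // k IH; rewrite !iterS IH Phi_subw. Qed.

Hypothesis Phi_inj : injective Phi.

(** A nontrivial component would make the components of the images of [x0] and [x1] commute, so
    [x0 x1] and [x1 x0] would have the same image. *)
Lemma xproj_t_trivial j : 2 <= n -> free_eq (xproj (ws (rshift n j))) [::].
Proof.
move=> n2; pose x0 := Ordinal (ltnW n2); pose x1 := Ordinal n2.
apply/reduceP; apply/eqP/negPn/negP => /eqP cn.
have c1 : ~ free_eq (xproj (ws (rshift n j))) [::] by move/reduceP.
have comm k : free_eq (xproj (ws (rshift n j)) ++ xproj (ws (lshift m k)))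
                      (xproj (ws (lshift m k)) ++ xproj (ws (rshift n j))).
  rewrite -!xproj_cat; apply: xproj_eq; apply/weltP; rewrite !welt_cat.
  rewrite -!/(FZelt _) -!reprP -!(@monoid.gmulfM _ _ Phi); congr (Phi _).
  by rewrite /FZelt -!welt_cat; apply/weltP/pres_rel/(@FZ_tx n m j k).
have xx := commutation_transitive c1 (comm x0) (comm x1).
have /Phi_inj : Phi (FZelt (xgen m x0 ++ xgen m x1)) = Phi (FZelt (xgen m x1 ++ xgen m x0)).
  rewrite !Phi_subw; apply/weltP; rewrite /subw /= !cats0 /letter_image /=.
  apply: FZ_eq_of_xproj; last by rewrite !xproj_cat.
  by move=> i; rewrite !expo_cat GRing.addrC.
move/weltP/xproj_eq/reduceP; rewrite /xproj /= !xletter_l /=.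
by [].
Qed.

End Endomorphism.

Section InducedEndomorphism.

Variable ws : 'I_(n + m) -> W.
Hypothesis t_trivial : forall j, free_eq (xproj (ws (rshift n j))) [::].

Definition xws (i : 'I_n) : word 'I_n := xproj (ws (lshift m i)).

Lemma xproj_subw u : free_eq (xproj (subw ws u)) (subw xws (xproj u)).
Proof.
elim: u => [|[i b] u IH]; first exact: pres_refl.
rewrite -cat1s subw_cat !xproj_cat subw_cat; apply: pres_cat IH.
rewrite /subw /= cats0 /letter_image /=.
case: (split_ordP i) => j ->; rewrite /xproj /= ?xletter_l ?xletter_r /= -?/(xproj _).
  by rewrite /letter_image cats0 /=; case: b; rewrite ?xproj_inv; apply: pres_refl.
case: b; last exact: t_trivial.
by rewrite xproj_inv; apply: (pres_inv (t_trivial j)).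
Qed.

Lemma xproj_iter k u :
  free_eq (xproj (iter k (subw ws) u)) (iter k (subw xws) (xproj u)).
Proof.
elim: k => [|k IH]; first exact: pres_refl.
by rewrite !iterS; apply: pres_trans (xproj_subw _) _; apply: subw_free_eq.
Qed.

End InducedEndomorphism.

End FreeTimesAbelian.

(** * Bounding the exponents *)

Lemma iter_addC (T : Type) (f : T -> T) a b z : iter (a + b) f z = iter b f (iter a f z).
Proof. by rewrite addnC iterD. Qed.

Section Assembly.

Variables n m : nat.
Notation W := (FZword n m).
Implicit Types (x y u v : W).

Lemma same_trace_free_eq q N (u u' v v' : word 'I_q) :
  free_eq u u' -> free_eq v v' -> same_trace N u v -> same_trace N u' v'.
Proof.
move=> uu vv H rho rV; have fV := letter_mx_inv rV.
by rewrite /rep -(mxev_free_eq fV uu) -(mxev_free_eq fV vv); apply: H.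
Qed.

Lemma trace_equiv_sym u v : trace_equiv u v -> trace_equiv v u.
Proof. by move=> [H1 H2]; split=> [rho rV|n2 r r7 rho rV]; rewrite ?(H1 rho rV) ?(H2 n2 r r7 rho rV). Qed.

Lemma trace_equiv_trans u v x : trace_equiv u v -> trace_equiv v x -> trace_equiv u x.
Proof.
move=> [H1 H2] [G1 G2]; split=> [rho rV|n2 r r7 rho rV].
  by rewrite (H1 rho rV) (G1 rho rV).
by rewrite (H2 n2 r r7 rho rV) (G2 n2 r r7 rho rV).
Qed.

Definition rep_dim r := #|{: 'I_n * bool}| * tdim r.
Definition max_rep_dim := \sum_(r < 8) rep_dim r.

Lemma rep_dim_leq r : r <= 7 -> rep_dim r <= max_rep_dim.
Proof. by rewrite -ltnS => r8; rewrite /max_rep_dim (bigD1 (Ordinal r8)) //= leq_addr. Qed.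

(** Dominates [2 * q * N ^ 2] both for dimension 1 on [n + m] generators and for each [rep_dim r] on
    [n] generators; the successor covers [n = 0], where every [rep_dim r] is 0. *)
Definition stable_from := 2 * (n + m) * max_rep_dim.+1 ^ 2.

Lemma trace_equiv_of_cyc u v : (forall i, expo i u = expo i v) ->
  (2 <= n -> forall w : seq 'I_n, size w <= max_rep_dim * (size u + size v) ->
     cyc w (xproj u) = cyc w (xproj v)) -> trace_equiv u v.
Proof.
move=> e H; split=> [|n2 r r7 rho rV]; first exact/same_trace1P.
apply: trace_eq_of_cyc => // w wN; apply: H => //; apply: leq_trans wN _.
by rewrite leq_mul ?rep_dim_leq // leq_add ?size_xproj.
Qed.

Lemma cyc_of_trace_equiv u v w : trace_equiv u v -> 2 <= n -> cyc w (xproj u) = cyc w (xproj v).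
Proof.
by move=> uv n2; have [z _ /xproj_conj zE] := conjugate_of_trace_equiv uv; apply: cyc_conj zE.
Qed.

Variable ws : 'I_(n + m) -> W.
Hypothesis t_trivial : 2 <= n -> forall j, free_eq (xproj (ws (rshift n j))) [::].
Notation it k := (iter k (subw ws)).

Lemma xproj_it k u : 2 <= n -> free_eq (xproj (it k u)) (iter k (subw (xws ws)) (xproj u)).
Proof. by move=> n2; apply: xproj_iter => j; apply: t_trivial. Qed.

Lemma trace_equiv_iter k u v : trace_equiv u v -> trace_equiv (it k u) (it k v).
Proof.
move=> [H1 H2]; split=> [|n2 r r7].
  by elim: k => // k IH; rewrite !iterS; apply: same_trace_subst.
apply: same_trace_free_eq (pres_sym (xproj_it k u n2)) (pres_sym (xproj_it k v n2)) _.
by elim: k => [|k IH]; [apply: H2 | rewrite !iterS; apply: same_trace_subst].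
Qed.

Lemma trace_equiv_stable s j u v : stable_from <= j ->
  trace_equiv (it s u) (it s v) -> trace_equiv (it j u) (it j v).
Proof.
move=> sj [H1 H2]; split=> [|n2 r r7].
  by apply: same_trace_stable H1; apply: leq_trans sj; rewrite /stable_from leq_mul //.
apply: same_trace_free_eq (pres_sym (xproj_it j u n2)) (pres_sym (xproj_it j v n2)) _.
apply: (@same_trace_stable _ _ _ _ _ s).
  apply: leq_trans sj; rewrite /stable_from leq_mul // ?leq_mul2l ?leq_addr ?orbT //.
  by rewrite leq_sqr leqW // rep_dim_leq.
by apply: same_trace_free_eq (xproj_it s u n2) (xproj_it s v n2) _; apply: H2.
Qed.

Definition period := unity_exponent (n + m).

Lemma dvdn_period : unity_exponent n %| period.
Proof.
have le : 2 * n ^ n <= 2 * (n + m) ^ (n + m); last first.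
  by rewrite /period /unity_exponent -(bin_fact le) dvdn_mull // dvdn_mulr.
rewrite leq_mul2l /=; case: n => [|k]; first by case: m => // l; rewrite expn_gt0.
apply: leq_trans (_ : (k.+1 + m) ^ k.+1 <= _); first by rewrite leq_exp2r // leq_addr.
by rewrite leq_pexp2l // leq_addr.
Qed.

(** The two summands bound the lengths of the iterates of [y] at [stable_from + period] and at
    [stable_from]; the final 1 admits words of length 1, that is, exponent sums. *)
Definition coef_degree s := max_rep_dim * (s ^ (stable_from + period) * s + s ^ stable_from * s) + 1.

Definition exponent_bound s := stable_from + period +
  (coef_shift_bound (n + m) period (coef_degree s) s stable_from +
   coef_shift_bound n period (coef_degree s) s stable_from).

Variables (s : nat) (x y : W).
Hypotheses (s_gt0 : 0 < s) (ws_s : forall i, size (ws i) <= s).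
Hypotheses (x_s : size x <= s) (y_s : size y <= s).

(** The failure of periodicity is seen by an exponent sum on [n + m] letters or by a cyclic
    coefficient for the induced substitution on [n] letters; the two resulting bounds are added. *)
Lemma shift_bounded k : trace_equiv (it (stable_from + k) x) (it stable_from y) ->
  ~ trace_equiv (it (stable_from + period) y) (it stable_from y) ->
  k <= coef_shift_bound (n + m) period (coef_degree s) s stable_from +
       coef_shift_bound n period (coef_degree s) s stable_from.
Proof.
move=> xy yd; have p0 : 0 < period by rewrite fact_gt0.
have xyi i : trace_equiv (it (stable_from + k + i) x) (it (stable_from + i) y).
  by rewrite !(iter_addC _ _ i); apply: trace_equiv_iter.
have [e|/existsNP[i ei]] := pselect (forall i,
    expo i (it (stable_from + period) y) = expo i (it stable_from y)); last first.
  apply: leq_trans _ (leq_addr _ _).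
  apply: (@cyc_shift_bound _ ws period (coef_degree s) s stable_from k [:: i] x y) => //.
  - by rewrite /coef_degree addn1.
  - by move=> j; rewrite !cyc1; have [/same_trace1P] := xyi j.
  - by rewrite !cyc1.
have [n2|n1] := leqP 2 n; last first.
  by case: yd; apply: trace_equiv_of_cyc => // n2; rewrite ltnNge n2 in n1.
have [w ws' wd] : exists2 w : seq 'I_n, size w <= coef_degree s &
    cyc w (xproj (it (stable_from + period) y)) <> cyc w (xproj (it stable_from y)).
  apply: contrapT => /forall2NP H; apply: yd; apply: trace_equiv_of_cyc => // _ w wd.
  have [//|] := H w; last by move/contrapT.
  case; apply: leq_trans wd _; rewrite /coef_degree addn1 leqW // leq_mul //.
  by apply: leq_add; apply: leq_trans (size_iter_subw _ _ ws_s) _; rewrite leq_mul2l ?y_s orbT.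
apply: leq_trans _ (leq_addl _ _).
have cE u j : cyc w (iter j (subw (xws ws)) (xproj u)) = cyc w (xproj (it j u)).
  by apply/esym/cyc_free_eq/xproj_it.
apply: (@cyc_shift_bound _ (xws ws) period (coef_degree s) s stable_from k w (xproj x) (xproj y)) => //.
- exact: dvdn_period.
- by move=> i; apply: leq_trans (size_xproj _) _.
- by apply: leq_trans (size_xproj _) _.
- by apply: leq_trans (size_xproj _) _.
- by move=> i; rewrite !cE; apply: cyc_of_trace_equiv.
- by rewrite !cE.
Qed.

End Assembly.

Section Solutions.

Variables n m : nat.
Notation W := (FZword n m).
Variable ws : 'I_(n + m) -> W.
Hypothesis t_trivial : 2 <= n -> forall j, free_eq (xproj (ws (rshift n j))) [::].
Notation it k := (iter k (subw ws)).
Notation s0 := (stable_from n m).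
Notation d := (period n m).

Lemma solution_bounded s (x y : W) r t : 0 < s -> (forall i, size (ws i) <= s) ->
  size x <= s -> size y <= s -> t <= r -> trace_equiv (it r x) (it t y) ->
  exists r' t', [/\ r' <= exponent_bound n m s, t' <= exponent_bound n m s &
    trace_equiv (it r' x) (it t' y)].
Proof.
move=> sp wss xs ys tr xy; pose k := r - t.
have xyk : trace_equiv (it (s0 + k) x) (it s0 y).
  rewrite iterD; apply: (@trace_equiv_stable _ _ _ t_trivial t) => //.
  by rewrite -iterD /k subnKC.
have s0b : s0 <= exponent_bound n m s by rewrite /exponent_bound -addnA leq_addr.
have [yd|yd] := pselect (trace_equiv (it (s0 + d) y) (it s0 y)); last first.
  exists (s0 + k), s0; split=> //; rewrite /exponent_bound -addnA leq_add2l.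
  by apply: leq_trans (shift_bounded t_trivial sp wss xs ys xyk yd) (leq_addl _ _).
have d0 : 0 < d by rewrite fact_gt0.
have yad a : trace_equiv (it (s0 + a * d) y) (it s0 y).
  elim: a => [|a IH]; first by rewrite addn0; split=> [rho|n2 r0 _ rho].
  rewrite mulSn addnA iter_addC; apply: trace_equiv_trans IH.
  rewrite [it (s0 + a * d) y]iter_addC; exact: (trace_equiv_iter t_trivial).
exists (s0 + k %% d), s0; split=> //.
  by rewrite /exponent_bound (leq_trans _ (leq_addr _ _)) // leq_add2l ltnW // ltn_mod.
(* The equivalence is known at level [k %/ d * d + s0] for the iterate of [x] by [k %% d]; stability
   brings the level back to [s0]. *)
rewrite iterD; apply: (@trace_equiv_stable _ _ _ t_trivial (k %/ d * d + s0)) => //.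
rewrite -iterD; have -> : k %/ d * d + s0 + k %% d = s0 + k by rewrite -addnA addnCA -divn_eq.
have -> : k %/ d * d + s0 = s0 + k %/ d * d by rewrite addnC.
exact: trace_equiv_trans xyk (trace_equiv_sym (yad _)).
Qed.

(** The factor 3 comes from the conjugator length [size u + 2 * size v], with both iterates of
    length at most [s ^ e * s]. *)
Lemma conjugate_bounded s (x y : W) r t c : 0 < s -> (forall i, size (ws i) <= s) ->
  size x <= s -> size y <= s -> FZ_eq (word_inv c ++ it r x ++ c) (it t y) ->
  exists r' t' z, let e := exponent_bound n m s in
    [/\ r' <= e, t' <= e, size z <= 3 * (s ^ e * s) &
    FZ_eq (word_inv (xlift m z) ++ it r' x ++ xlift m z) (it t' y)].
Proof.
move=> sp wss xs ys /trace_equiv_of_conjugate xy; set e := exponent_bound n m s.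
suff [r' [t' [r'e t'e]]] : exists r' t', [/\ r' <= e, t' <= e &
    trace_equiv (it r' x) (it t' y)].
  move=> /conjugate_of_trace_equiv[z zs zE]; exists r', t', z; split=> //.
  have sz u k : k <= e -> size u <= s -> size (it k u) <= s ^ e * s.
    move=> ke us; apply: leq_trans (size_iter_subw _ _ wss) _.
    by rewrite leq_mul // leq_pexp2l.
  apply: leq_trans zs _; rewrite mulSn.
  exact: (leq_add (sz _ _ r'e xs) (leq_mul (leqnn 2) (sz _ _ t'e ys))).
have [tr|/ltnW rt] := leqP t r; first exact: solution_bounded xy.
have [t' [r' [h1 h2 h3]]] := solution_bounded sp wss ys xs rt (trace_equiv_sym xy).
by exists r', t'; split=> //; apply: trace_equiv_sym.
Qed.

End Solutions.

(** * Computable functions *)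

Definition computable k (f : seq nat -> nat) :=
  exists p, forall a, size a = k -> reval p a (f a).

Lemma computable_ext k f g : (forall a, size a = k -> f a = g a) ->
  computable k f -> computable k g.
Proof. by move=> fg [p pP]; exists p => a sa; rewrite -fg //; apply: pP. Qed.

Lemma computable_nth k i : i < k -> computable k (nth 0 ^~ i).
Proof. by move=> ik; exists (RProj i) => a sa; apply: reval_proj; rewrite sa. Qed.

Lemma computable_comp k j g (fs : seq (seq nat -> nat)) : computable j g -> size fs = j ->
  (forall i, i < j -> computable k (nth (fun=> 0) fs i)) ->
  computable k (fun a => g [seq f a | f <- fs]).
Proof.
move=> [p pP] sfs fsP; have [ps [sps psP]] : exists ps, size ps = size fs /\
    forall a i, size a = k -> i < size fs ->
    reval (nth RZero ps i) a (nth (fun=> 0) fs i a).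
  rewrite -sfs in fsP; elim: fs {sfs} fsP => [|f fs IH] fsP; first by exists [::].
  have [|ps [sps psP]] := IH; first by move=> i il; apply: (fsP i.+1).
  have [p0 p0P] := fsP 0 isT; exists (p0 :: ps); split; first by rewrite /= sps.
  by move=> a [|i] sa il; [apply: p0P | apply: psP].
exists (RComp p ps) => a sa; apply: (@reval_comp _ _ _ [seq f a | f <- fs]).
- by rewrite size_map.
- by move=> i il; rewrite (nth_map (fun=> 0)) -?sps //; apply: psP; rewrite -?sps.
- by apply: pP; rewrite size_map.
Qed.

Lemma computable_rec k f g : computable k f -> computable k.+2 g ->
  computable k.+1 (fun a =>
    nat_rec (fun _ => nat) (f (behead a)) (fun i y => g [:: i, y & behead a]) (head 0 a)).
Proof.
move=> [p pP] [r rP]; exists (RRec p r) => -[|c a] //= [sa].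
elim: c => [|c IH] /=; first by apply: reval_rec0; apply: pP.
by apply: reval_recS IH _; apply: rP; rewrite /= sa.
Qed.

Definition K1 (g : nat -> nat) := computable 1 (fun a => g (nth 0 a 0)).
Definition K2 (g : nat -> nat -> nat) := computable 2 (fun a => g (nth 0 a 0) (nth 0 a 1)).
Definition K3 (g : nat -> nat -> nat -> nat) :=
  computable 3 (fun a => g (nth 0 a 0) (nth 0 a 1) (nth 0 a 2)).
Definition K4 (g : nat -> nat -> nat -> nat -> nat) :=
  computable 4 (fun a => g (nth 0 a 0) (nth 0 a 1) (nth 0 a 2) (nth 0 a 3)).

Section Application.

Variable k : nat.

Lemma app1 g : K1 g -> forall e1, computable k e1 -> computable k (fun a => g (e1 a)).
Proof. by move=> Kg e1 h1; apply: (computable_comp (fs := [:: e1]) Kg) => // -[|i]. Qed.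

Lemma app2 g : K2 g -> forall e1 e2, computable k e1 -> computable k e2 ->
  computable k (fun a => g (e1 a) (e2 a)).
Proof.
by move=> Kg e1 e2 h1 h2; apply: (computable_comp (fs := [:: e1; e2]) Kg) => // -[|[|i]].
Qed.

Lemma app3 g : K3 g -> forall e1 e2 e3,
  computable k e1 -> computable k e2 -> computable k e3 ->
  computable k (fun a => g (e1 a) (e2 a) (e3 a)).
Proof.
move=> Kg e1 e2 e3 h1 h2 h3.
by apply: (computable_comp (fs := [:: e1; e2; e3]) Kg) => // -[|[|[|i]]].
Qed.

Lemma app4 g : K4 g -> forall e1 e2 e3 e4,
  computable k e1 -> computable k e2 -> computable k e3 -> computable k e4 ->
  computable k (fun a => g (e1 a) (e2 a) (e3 a) (e4 a)).
Proof.
move=> Kg e1 e2 e3 e4 h1 h2 h3 h4.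
by apply: (computable_comp (fs := [:: e1; e2; e3; e4]) Kg) => // -[|[|[|[|i]]]].
Qed.

End Application.

Lemma K1_succ : K1 succn.
Proof. by exists RSucc => -[|x []] //= _; apply: reval_succ. Qed.

Lemma computable_const k c : computable k (fun=> c).
Proof.
elim: c => [|c IH]; first by exists RZero => a _; apply: reval_zero.
exact: (app1 K1_succ IH).
Qed.

Ltac arg := exact: computable_nth.

(** Iteration with a constant parameter; the folds over coded lists and the final search are built
    on it. *)
Lemma K3_iter h : K2 h -> K3 (fun N s p => iter N (h^~ p) s).
Proof.
move=> Kh; apply: computable_ext (computable_rec (k := 2) (f := nth 0 ^~ 0)
  (g := fun a => h (nth 0 a 1) (nth 0 a 3)) _ _); last 2 first.
- arg.
- by apply: (app2 Kh); arg.
by move=> [|N [|s [|p []]]] //= _; elim: N => //= N ->.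
Qed.

Lemma K2_iter h : K1 h -> K2 (fun N s => iter N h s).
Proof.
move=> Kh; have K : K3 (fun N s p => iter N (fun y => h y) s).
  by apply: (K3_iter (h := fun y _ => h y)); apply: (app1 Kh); arg.
exact: (app3 K (@computable_nth 2 0 isT) (@computable_nth 2 1 isT) (computable_const 2 0)).
Qed.

Lemma K2_add : K2 addn.
Proof.
apply: computable_ext (computable_rec (k := 1) (f := nth 0 ^~ 0)
  (g := fun a => (nth 0 a 1).+1) _ _); last 2 first.
- arg.
- by apply: (app1 K1_succ); arg.
by move=> [|N [|s []]] //= _; elim: N => //= N ->; rewrite addSn.
Qed.

Lemma K2_mul : K2 muln.
Proof.
apply: computable_ext (computable_rec (k := 1) (f := fun=> 0)
  (g := fun a => nth 0 a 1 + nth 0 a 2) _ _); last 2 first.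
- exact: computable_const.
- by apply: (app2 K2_add); arg.
by move=> [|N [|s []]] //= _; elim: N => //= N ->; rewrite mulSn addnC.
Qed.

Lemma K1_exp2 : K1 (expn 2).
Proof.
apply: computable_ext (computable_rec (k := 0) (f := fun=> 1)
  (g := fun a => nth 0 a 1 + nth 0 a 1) _ _); last 2 first.
- exact: computable_const.
- by apply: (app2 K2_add); arg.
by move=> [|N []] //= _; elim: N => //= N ->; rewrite expnS mul2n addnn.
Qed.

Lemma K1_pred : K1 predn.
Proof.
apply: computable_ext (computable_rec (k := 0) (f := fun=> 0) (g := nth 0 ^~ 0) _ _); last 2 first.
- exact: computable_const.
- arg.
by move=> [|[|N] []].
Qed.

Lemma K2_sub : K2 subn.
Proof.
have K := K2_iter K1_pred.
apply: computable_ext (app2 K (@computable_nth 2 1 isT) (@computable_nth 2 0 isT)) => // a _ /=.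
by elim: (nth 0 a 1) => [|y IH] /=; rewrite ?subn0 // IH subnS.
Qed.

Definition isz (x : nat) : nat := x == 0.

Lemma K1_isz : K1 isz.
Proof.
apply: computable_ext (computable_rec (k := 0) (f := fun=> 1) (g := fun=> 0) _ _); last 2 first.
- exact: computable_const.
- exact: computable_const.
by move=> [|[|N] []].
Qed.

Lemma K2_leq : K2 (fun x y => x <= y : nat).
Proof. by apply: (app1 K1_isz); apply: (app2 K2_sub); arg. Qed.

Lemma K2_eq : K2 (fun x y => x == y : nat).
Proof.
apply: (computable_ext (f := fun a => (nth 0 a 0 <= nth 0 a 1) * (nth 0 a 1 <= nth 0 a 0))).
  by move=> a _; rewrite mulnb eqn_leq.
by apply: (app2 K2_mul); apply: (app2 K2_leq); arg.
Qed.

Lemma K1_odd : K1 (fun x => odd x : nat).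
Proof.
apply: computable_ext (computable_rec (k := 0) (f := fun=> 0)
  (g := fun a => 1 - nth 0 a 1) _ _); last 2 first.
- exact: computable_const.
- by apply: (app2 K2_sub); [apply: computable_const | arg].
by move=> [|N []] //= _; elim: N => //= N ->; case: (odd N).
Qed.

Lemma K1_half : K1 half.
Proof.
apply: computable_ext (computable_rec (k := 0) (f := fun=> 0)
  (g := fun a => nth 0 a 0 - nth 0 a 1) _ _); last 2 first.
- exact: computable_const.
- by apply: (app2 K2_sub); arg.
move=> [|N []] //= _; elim: N => //= N ->.
by rewrite -[N in N - _]odd_double_half -addnn uphalf_half addnA addnK.
Qed.

Definition cond (c x y : nat) := if c is 0 then y else x.

Lemma K3_cond : K3 cond.
Proof.
apply: computable_ext (computable_rec (k := 2) (f := nth 0 ^~ 1) (g := nth 0 ^~ 2) _ _); last 2 first.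
- arg.
- arg.
by move=> [|[|N] [|x [|y []]]].
Qed.

Lemma condE (b : bool) x y : cond b x y = if b then x else y.
Proof. by case: b. Qed.

(** * Coded lists *)

Notation code := CodeSeq.code.
Notation decode := CodeSeq.decode.

Definition ccons a v := 2 ^ a * v.*2.+1.

Lemma K2_cons : K2 ccons.
Proof.
apply: (app2 K2_mul); first by apply: (app1 K1_exp2); arg.
apply: (app1 K1_succ); apply: (computable_ext (f := fun a => nth 0 a 1 + nth 0 a 1)).
  by move=> a _; rewrite addnn.
by apply: (app2 K2_add); arg.
Qed.

(** [code (a :: l)] is [2 ^ a * (2 * code l + 1)], so the head is the 2-adic valuation, and [v]
    steps of search suffice to find it. *)
Definition chead v :=
  iter v (fun j => cond (odd (iter j half v)) j j.+1) 0.

Definition ctail v := (iter (chead v) half v)./2.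

Lemma K2_shift : K2 (fun j v => iter j half v).
Proof. exact: K2_iter K1_half. Qed.

Lemma K1_chead : K1 chead.
Proof.
have K : K2 (fun j v => cond (odd (iter j half v)) j j.+1).
  apply: (app3 K3_cond); last by apply: (app1 K1_succ); arg.
    by apply: (app1 K1_odd); apply: (app2 K2_shift); arg.
  by arg.
by apply: (app3 (K3_iter K)); [arg | apply: computable_const | arg].
Qed.

Lemma K1_ctail : K1 ctail.
Proof.
apply: (app1 K1_half); apply: (app2 K2_shift); last by arg.
by apply: (app1 K1_chead); arg.
Qed.

Lemma iter_half_exp a j c : j <= a -> iter j half (2 ^ a * c) = 2 ^ (a - j) * c.
Proof.
elim: j => [|j IH] ja; first by rewrite subn0.
by rewrite iterS IH 1?ltnW // -(subnSK ja) expnS -mulnA mul2n doubleK.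
Qed.

Lemma iter_find (p : nat -> bool) a N : p a -> (forall j, j < a -> p j = false) ->
  iter N (fun j => if p j then j else j.+1) 0 = minn N a.
Proof.
move=> pa pj; elim: N => [|N IH]; first by rewrite min0n.
rewrite iterS IH; case: (ltnP N a) => [Na|aN].
  by rewrite pj // (minn_idPl Na).
by rewrite pa (minn_idPr (leqW aN)).
Qed.

Lemma chead_code a l : chead (code (a :: l)) = a.
Proof.
rewrite /chead /=; set c := (code l).*2.+1; set v := 2 ^ a * c.
transitivity (iter v (fun j => if odd (iter j half v) then j else j.+1) 0).
  by apply: eq_iter => j; rewrite condE.
rewrite (@iter_find (fun j => odd (iter j half v)) a).
- apply/minn_idPr; apply: ltnW; apply: leq_trans (ltn_expl a (leqnn 2)) _.
  by rewrite leq_pmulr.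
- by rewrite iter_half_exp // subnn mul1n /= odd_double.
- move=> j ja; rewrite iter_half_exp 1?ltnW // oddM oddX.
  by rewrite subn_eq0 leqNgt ja.
Qed.

Lemma ctail_code a l : ctail (code (a :: l)) = code l.
Proof.
rewrite /ctail chead_code /= iter_half_exp // subnn mul1n.
by rewrite /= uphalf_double.
Qed.

Lemma ctail0 : ctail 0 = 0. Proof. by []. Qed.

Definition cfold (g : nat -> nat -> nat -> nat) init v p :=
  foldl (fun acc x => g acc x p) init (decode v).

(** The state is a coded list with the accumulator as head and the unread input as tail. An empty
    tail is a fixed point, so extra steps do no harm. *)
Definition fold_step (g : nat -> nat -> nat -> nat) st p :=
  cond (isz (ctail st)) st
    (ccons (g (chead st) (chead (ctail st)) p) (ctail (ctail st))).

Lemma size_code l : size l <= code l.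
Proof.
elim: l => //= x l IH; apply: leq_ltn_trans IH _; rewrite -[X in X < _]mul1n.
apply: leq_trans (_ : 1 * (code l).*2.+1 <= _); first by rewrite !mul1n ltnS -addnn leq_addr.
by rewrite leq_mul2r expn_gt0 orbT.
Qed.

Lemma size_decode v : size (decode v) <= v.
Proof. by rewrite -{2}[v]CodeSeq.decodeK size_code. Qed.

Lemma iter_fold_step g i p l N : size l <= N ->
  chead (iter N ((fold_step g)^~ p) (code (i :: l))) =
  foldl (fun acc x => g acc x p) i l.
Proof.
elim: l i N => [|x l IH] i N sN.
  suff -> : iter N ((fold_step g)^~ p) (code [:: i]) = code [:: i] by rewrite chead_code.
  by elim: N {sN} => //= N ->; rewrite /fold_step -[2 ^ i * _]/(code [:: i]) ctail_code.
case: N sN => // N sN; rewrite iterSr [RHS]/= -(IH _ N) //; congr (chead (iter _ _ _)).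
rewrite /fold_step ctail_code !chead_code ctail_code /isz.
by rewrite [code (x :: l)]/= muln_eq0 expn_eq0.
Qed.

Lemma K3_cfold g : K3 g -> K3 (cfold g).
Proof.
move=> Kg; have Kstep : K2 (fold_step g).
  apply: (app3 K3_cond).
  - by apply: (app1 K1_isz); apply: (app1 K1_ctail); arg.
  - by arg.
  - apply: (app2 K2_cons); last by do 2!apply: (app1 K1_ctail); arg.
    apply: (app3 Kg); last by arg.
      by apply: (app1 K1_chead); arg.
    by apply: (app1 K1_chead); apply: (app1 K1_ctail); arg.
apply: (computable_ext (f := fun a => chead (iter (nth 0 a 1) ((fold_step g)^~ (nth 0 a 2))
    (ccons (nth 0 a 0) (nth 0 a 1))))).
  move=> a _; move: (nth 0 a 0) (nth 0 a 1) (nth 0 a 2) => i v p.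
  by have := iter_fold_step g i p (size_decode v); rewrite /= CodeSeq.decodeK.
apply: (app1 K1_chead); apply: (app3 (K3_iter Kstep)).
- by arg.
- by apply: (app2 K2_cons); arg.
- by arg.
Qed.

Lemma foldl_code (g : nat -> nat -> nat -> nat) (h : seq nat -> nat -> seq nat) a l p :
  (forall acc x, g (code acc) x p = code (h acc x)) ->
  foldl (fun acc x => g acc x p) (code a) l = code (foldl h a l).
Proof. by move=> gh; elim: l a => //= x l IH a; rewrite gh IH. Qed.

Lemma cfoldE (g : nat -> nat -> nat -> nat) (h : seq nat -> nat -> seq nat) a l p :
  (forall acc x, g (code acc) x p = code (h acc x)) ->
  cfold g (code a) (code l) p = code (foldl h a l).
Proof. by move=> gh; rewrite /cfold CodeSeq.codeK; apply: foldl_code. Qed.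

Lemma K1_cfold g : K2 g -> K1 (fun v => cfold (fun acc x _ => g acc x) 0 v 0).
Proof.
move=> Kg; have K : K3 (fun acc x p => g acc x) by apply: (app2 Kg); arg.
exact: (app3 (K3_cfold K) (computable_const 1 0) (@computable_nth 1 0 isT) (computable_const 1 0)).
Qed.

Definition flip (a : nat) := if odd a then a.-1 else a.+1.

Lemma K1_flip : K1 flip.
Proof.
apply: (computable_ext (f := fun a => cond (odd (nth 0 a 0)) (nth 0 a 0).-1 (nth 0 a 0).+1)).
  by move=> a _; rewrite condE.
by apply: (app3 K3_cond); [apply: (app1 K1_odd) | apply: (app1 K1_pred) | apply: (app1 K1_succ)]; arg.
Qed.

Definition winv (l : seq nat) : seq nat := foldl (fun acc x => flip x :: acc) [::] l.

Definition cinv v := cfold (fun acc x _ => ccons (flip x) acc) 0 v 0.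

Lemma K1_cinv : K1 cinv.
Proof.
apply: (@K1_cfold (fun acc x => ccons (flip x) acc)).
by apply: (app2 K2_cons); [apply: (app1 K1_flip)|]; arg.
Qed.

Lemma cinvE l : cinv (code l) = code (winv l).
Proof. exact: (cfoldE [::]). Qed.

Definition crev v := cfold (fun acc x _ => ccons x acc) 0 v 0.

Lemma K1_crev : K1 crev.
Proof. by apply: (@K1_cfold (fun acc x => ccons x acc)); apply: (app2 K2_cons); arg. Qed.

Lemma crevE l : crev (code l) = code (rev l).
Proof.
rewrite /crev (cfoldE (h := fun acc x => x :: acc) [::]) //; congr code.
by rewrite /rev; elim: l [::] => //= x l IH a; rewrite IH.
Qed.

Definition ccat u v := cfold (fun acc x _ => ccons x acc) v (crev u) 0.

Lemma K2_ccat : K2 ccat.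
Proof.
have K : K3 (fun acc x p => ccons x acc) by apply: (app2 K2_cons); arg.
apply: (app3 (K3_cfold K)); [arg | apply: (app1 K1_crev); arg | exact: computable_const].
Qed.

Lemma ccatE u v : ccat (code u) (code v) = code (u ++ v).
Proof.
rewrite /ccat crevE (cfoldE (h := fun acc x => x :: acc) v) //; congr code.
rewrite -{2}[u]revK; elim: (rev u) v => //= x l IH v.
by rewrite IH rev_cons cat_rcons.
Qed.

Definition clookup i v := chead (iter i ctail v).

Lemma K2_clookup : K2 clookup.
Proof. by apply: (app1 K1_chead); exact: (K2_iter K1_ctail). Qed.

Lemma clookupE i l : clookup i (code l) = nth 0 l i.
Proof.
rewrite /clookup; elim: i l => [|i IH] [|x l].
- by [].
- by rewrite chead_code.
- by rewrite iterSr ctail0 (IH [::]) !nth_nil.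
- by rewrite iterSr ctail_code IH.
Qed.

Lemma cheadE l : chead (code l) = head 0 l.
Proof. by case: l => // x l; rewrite chead_code. Qed.

Lemma ctailE l : ctail (code l) = code (behead l).
Proof. by case: l => // x l; rewrite ctail_code. Qed.

(* Lists of letter codes are substituted and reduced as words; [limg ws a] is
   the image of the letter with code [a]. *)
Definition limg (ws : seq nat) a :=
  let w := decode (nth 0 ws a./2) in if odd a then winv w else w.

Definition lsub ws u := foldl (fun acc a => acc ++ limg ws a) [::] u.

Definition cimg a cws := cond (odd a) (cinv (clookup a./2 cws)) (clookup a./2 cws).

Definition csub u cws := cfold (fun acc a p => ccat acc (cimg a p)) 0 u cws.

Lemma K2_csub : K2 csub.
Proof.
have L k e1 e2 : computable k e1 -> computable k e2 ->
    computable k (fun a => clookup (e1 a)./2 (e2 a)).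
  by move=> h1 h2; apply: (app2 K2_clookup) => //; apply: (app1 K1_half).
have K : K3 (fun acc a p => ccat acc (cimg a p)).
  apply: (app2 K2_ccat); first by arg.
  by apply: (app3 K3_cond); [apply: (app1 K1_odd); arg | apply: (app1 K1_cinv); apply: L; arg | apply: L; arg].
exact: (app3 (K3_cfold K) (computable_const 2 0) (@computable_nth 2 0 isT) (@computable_nth 2 1 isT)).
Qed.

Lemma csubE u ws : csub (code u) (code ws) = code (lsub ws u).
Proof.
apply: (cfoldE (h := fun acc a => acc ++ limg ws a) [::]) => acc a.
rewrite -ccatE /cimg condE clookupE /limg; congr ccat.
by case: (odd a); rewrite -[nth 0 ws _ in LHS]CodeSeq.decodeK ?cinvE.
Qed.

(** With [N = n.*2] the codes of the [t_j] are skipped, so the stack reduces the [F_n]-component. *)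
Definition lpush N (acc : seq nat) a :=
  if a < N then
    if (acc != [::]) && (head 0 acc == flip a) then behead acc else a :: acc
  else acc.

Definition lstack N u := foldl (lpush N) [::] u.

Definition cpush acc a N := cond (a < N)
  (cond (isz (isz acc) * (chead acc == flip a)) (ctail acc) (ccons a acc)) acc.

Definition cstack u N := cfold cpush 0 u N.

Lemma K2_cstack : K2 cstack.
Proof.
have K : K3 cpush.
  apply: (app3 K3_cond); last by arg.
    by apply: (app2 K2_leq); [apply: (app1 K1_succ)|]; arg.
  apply: (app3 K3_cond); last by apply: (app2 K2_cons); arg.
    apply: (app2 K2_mul); first by do 2!apply: (app1 K1_isz); arg.
    by apply: (app2 K2_eq); [apply: (app1 K1_chead) | apply: (app1 K1_flip)]; arg.
  by apply: (app1 K1_ctail); arg.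
exact: (app3 (K3_cfold K) (computable_const 2 0) (@computable_nth 2 0 isT) (@computable_nth 2 1 isT)).
Qed.

Lemma cstackE u N : cstack (code u) N = code (lstack N u).
Proof.
apply: (cfoldE [::]) => acc a; rewrite /cpush condE /lpush; case: (a < N) => //.
rewrite /isz eqb0 mulnb condE cheadE ctailE.
suff -> : (code acc != 0) = (acc != [::]) by case: ifP.
by case: acc => //= x l; rewrite muln_eq0 expn_eq0.
Qed.

Definition ccount u a := cfold (fun acc x p => acc + (x == p)) 0 u a.

Lemma K2_ccount : K2 ccount.
Proof.
have K : K3 (fun acc x p => acc + (x == p)).
  by apply: (app2 K2_add); [arg | apply: (app2 K2_eq); arg].
exact: (app3 (K3_cfold K) (computable_const 2 0) (@computable_nth 2 0 isT) (@computable_nth 2 1 isT)).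
Qed.

Lemma ccountE u a : ccount (code u) a = count_mem a u.
Proof.
rewrite /ccount /cfold CodeSeq.codeK -[RHS]add0n.
by elim: u 0 => [|x u IH] i /=; rewrite ?addn0 // IH addnA.
Qed.

(** * Checking a certificate *)

Section Check.

Variables n m : nat.

(** [q] lists the two exponents and then a conjugator [z]. Conjugacy amounts to [z^-1 X z Y^-1]
    being trivial in the free group and to a balance of each [t_j]. *)
Definition lcheck (q x y ws : seq nat) : bool :=
  let z := behead (behead q) in
  let X := iter (head 0 q) (lsub ws) x in
  let Y := iter (head 0 (behead q)) (lsub ws) y in
  (lstack n.*2 (winv z ++ X ++ z ++ winv Y) == [::]) &&
  all (fun j => count_mem (n + j).*2 (X ++ winv Y) == count_mem (n + j).*2.+1 (X ++ winv Y))
    (iota 0 m).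

Definition citer r x ws := iter r (csub^~ ws) x.

Definition creduce q x y ws :=
  cstack (ccat (cinv (ctail (ctail q))) (ccat (citer (chead q) x ws)
    (ccat (ctail (ctail q)) (cinv (citer (chead (ctail q)) y ws))))) n.*2.

Definition cquot q x y ws :=
  ccat (citer (chead q) x ws) (cinv (citer (chead (ctail q)) y ws)).

Definition ccheck q x y ws := foldr (fun j acc =>
    (ccount (cquot q x y ws) (n + j).*2 == ccount (cquot q x y ws) (n + j).*2.+1) * acc)
  (isz (creduce q x y ws)) (iota 0 m).

Lemma K4_ccheck : K4 ccheck.
Proof.
have Kit := K3_iter K2_csub.
have KX k e1 e2 e3 : computable k e1 -> computable k e2 -> computable k e3 ->
  computable k (fun a => citer (e1 a) (e2 a) (e3 a)) by move=> *; apply: (app3 Kit).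
have K1z : computable 4 (fun a => ctail (ctail (nth 0 a 0))).
  by do 2!apply: (app1 K1_ctail); arg.
have KXx : computable 4 (fun a => citer (chead (nth 0 a 0)) (nth 0 a 1) (nth 0 a 3)).
  by apply: KX; [apply: (app1 K1_chead) | |]; arg.
have KYy : computable 4 (fun a => citer (chead (ctail (nth 0 a 0))) (nth 0 a 2) (nth 0 a 3)).
  by apply: KX; [apply: (app1 K1_chead); apply: (app1 K1_ctail) | |]; arg.
have Kq : K4 cquot by apply: (app2 K2_ccat) => //; apply: (app1 K1_cinv).
have Kr : K4 creduce.
  apply: (app2 K2_cstack); last exact: computable_const.
  apply: (app2 K2_ccat); first exact: (app1 K1_cinv).
  by do 2!(apply: (app2 K2_ccat) => //); apply: (app1 K1_cinv).
rewrite /ccheck; elim: (iota 0 m) => [|j js IH] /=; first exact: (app1 K1_isz).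
apply: (app2 K2_mul) => //.
by apply: (app2 K2_eq); apply: (app2 K2_ccount) => //; apply: computable_const.
Qed.

Lemma citerE r x ws : citer r (code x) (code ws) = code (iter r (lsub ws) x).
Proof. by elim: r => //= r; rewrite /citer /= => ->; rewrite csubE. Qed.

Lemma ccheckE q x y ws : ccheck (code q) (code x) (code y) (code ws) = lcheck q x y ws.
Proof.
rewrite /ccheck /lcheck /creduce /cquot !ctailE !cheadE !citerE !cinvE !ccatE cstackE.
have -> l : isz (code l) = (l == [::]).
  by rewrite /isz; case: l => //= a l; rewrite muln_eq0 expn_eq0.
rewrite andbC; elim: (iota 0 m) => //= j js ->.
by rewrite !ccountE mulnb andbA.
Qed.

Definition csearch_step q p :=
  cond (ccheck q (chead p) (chead (ctail p)) (ctail (ctail p))) q q.+1.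

(* [K] is the height of a tower of exponentials that bounds a certificate. *)
Definition csearch K x y ws :=
  iter (iter K (expn 2) (x + y + ws).+1).+1 (csearch_step^~ (ccons x (ccons y ws))) 0.

(** The candidate is tested again, since an exhausted search ends just above the bound; 0 codes the
    empty list, hence [None]. *)
Definition canswer K x y ws :=
  let q := csearch K x y ws in
  cond (ccheck q x y ws) (ccons (chead q) (ccons (chead (ctail q)) 0)) 0.

Lemma K3_canswer K : K3 (canswer K).
Proof.
have Kstep : K2 csearch_step.
  apply: (app3 K3_cond); last by apply: (app1 K1_succ); arg.
    apply: (app4 K4_ccheck); first by arg.
    - by apply: (app1 K1_chead); arg.
    - by apply: (app1 K1_chead); apply: (app1 K1_ctail); arg.
    - by do 2!apply: (app1 K1_ctail); arg.
  by arg.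
have Ks : K3 (csearch K).
  apply: (app3 (K3_iter Kstep)); last 1 first.
  - by apply: (app2 K2_cons); [arg | apply: (app2 K2_cons); arg].
  - apply: (app1 K1_succ); elim: K => [|K IH].
      by apply: (app1 K1_succ); apply: (app2 K2_add); [apply: (app2 K2_add)|]; arg.
    exact: (app1 K1_exp2).
  - exact: computable_const.
apply: (app3 K3_cond); last exact: computable_const.
  by apply: (app4 K4_ccheck) => //; arg.
apply: (app2 K2_cons); first exact: (app1 K1_chead).
apply: (app2 K2_cons); last exact: computable_const.
by apply: (app1 K1_chead); apply: (app1 K1_ctail).
Qed.

Lemma canswerP K (x y ws : seq nat) :
  let b := iter K (expn 2) (code x + code y + code ws).+1 in
  (exists2 q, lcheck q x y ws & canswer K (code x) (code y) (code ws) =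
     code [:: head 0 q; head 0 (behead q)]) \/
  (canswer K (code x) (code y) (code ws) = 0 /\ forall q, code q <= b -> ~~ lcheck q x y ws).
Proof.
move=> b; set q := csearch K (code x) (code y) (code ws).
have qE : q = iter b.+1 (fun j => if lcheck (decode j) x y ws then j else j.+1) 0.
  apply: eq_iter => j; rewrite /csearch_step.
  rewrite -[ccons (code y) _]/(code (code y :: ws)) -[ccons _ _]/(code [:: code x, code y & ws]).
  by rewrite !ctail_code !chead_code -{1}[j]CodeSeq.decodeK ccheckE condE.
rewrite /canswer -/q -[q in ccheck q]CodeSeq.decodeK ccheckE condE.
case: ifP => qc; [left | right; split=> // l lb].
  by exists (decode q) => //; rewrite -{1 2}[q]CodeSeq.decodeK ctailE !cheadE.
apply/negP => lc; have ex : exists j, lcheck (decode j) x y ws.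
  by exists (code l); rewrite CodeSeq.codeK.
case: (ex_minnP ex) => a ac amin.
have ab : a <= b by apply: leq_trans lb; apply: amin; rewrite CodeSeq.codeK.
move: qc; rewrite qE (@iter_find (fun j => lcheck (decode j) x y ws) a) //.
  by rewrite (minn_idPr (leqW ab)) ac.
by move=> j ja; apply: contraTF ja => /amin; rewrite -leqNgt.
Qed.

End Check.

(** * Tower bounds *)

(** The exact bounds need not be programmed: towers of fixed height are easy to compute and dominate
    everything built from sums, products, powers and factorials. *)
Definition tower_bounded (f : nat -> nat) := exists K, forall s, f s <= iter K (expn 2) s.

Lemma leq_tower K s : s <= iter K (expn 2) s.
Proof. by elim: K => //= K IH; apply: leq_trans IH _; apply: ltnW; apply: ltn_expl. Qed.

Lemma tower_mono K s t : s <= t -> iter K (expn 2) s <= iter K (expn 2) t.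
Proof. by move=> st; elim: K => //= K IH; rewrite leq_exp2l. Qed.

Lemma tb_le f g : (forall s, f s <= g s) -> tower_bounded g -> tower_bounded f.
Proof. by move=> fg [K gK]; exists K => s; apply: leq_trans (fg s) _. Qed.

Lemma tb_id : tower_bounded id.
Proof. by exists 0. Qed.

Lemma tb_const c : tower_bounded (fun=> c).
Proof.
exists c => s; apply: leq_trans (tower_mono c (leq0n s)).
by elim: c => //= c IH; apply: leq_ltn_trans IH _; apply: ltn_expl.
Qed.

Lemma tb_join2 f g h K : tower_bounded f -> tower_bounded g ->
  (forall a b y, a <= y -> b <= y -> h a b <= iter K (expn 2) y) ->
  tower_bounded (fun s => h (f s) (g s)).
Proof.
move=> [J fJ] [L gL] hK; exists (K + (J + L)) => s; rewrite iterD; apply: hK.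
  by rewrite addnC iterD; apply: leq_trans (fJ s) (leq_tower _ _).
by rewrite iterD; apply: leq_trans (gL s) (leq_tower _ _).
Qed.

Lemma leq_mul2_exp y : 2 * y <= 2 ^ y.
Proof. by case: y => // y; rewrite expnS leq_mul2l /= ltn_expl. Qed.

Lemma tb_add f g : tower_bounded f -> tower_bounded g -> tower_bounded (fun s => f s + g s).
Proof.
move=> hf hg; apply: (@tb_join2 f g addn 1) => // a b y ay byy.
by apply: leq_trans (leq_mul2_exp y); rewrite mul2n -addnn leq_add.
Qed.

Lemma tb_mul f g : tower_bounded f -> tower_bounded g -> tower_bounded (fun s => f s * g s).
Proof.
move=> hf hg; apply: (@tb_join2 f g muln 2) => // a b y ay byy.
apply: leq_trans (_ : 2 ^ y * 2 ^ y <= _).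
  by rewrite leq_mul // ltnW // (leq_ltn_trans _ (ltn_expl y (leqnn 2))).
by rewrite -expnD addnn -mul2n /= leq_exp2l // leq_mul2_exp.
Qed.

Lemma tb_exp f g : tower_bounded f -> tower_bounded g -> tower_bounded (fun s => f s ^ g s).
Proof.
move=> hf hg; have [K H] := tb_mul hg hf.
exists K.+1 => s; apply: leq_trans (_ : (2 ^ f s) ^ g s <= _).
  by case: (g s) => // k; rewrite leq_exp2r // ltnW // ltn_expl.
by rewrite -expnM mulnC iterS leq_exp2l.
Qed.

Lemma tb_succ f : tower_bounded f -> tower_bounded (fun s => (f s).+1).
Proof.
move=> hf; apply: tb_le (tb_add hf (tb_const 1)) => s.
by rewrite addn1.
Qed.

Lemma tb_fact f : tower_bounded f -> tower_bounded (fun s => (f s)`!).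
Proof.
move=> hf; apply: tb_le (tb_exp hf hf) => s; elim: (f s) => // k IH.
rewrite factS expnS leq_mul2l /=; apply: leq_trans IH _.
by case: k => // k; rewrite leq_exp2r.
Qed.

Ltac tb := repeat first
  [ exact: tb_id | assumption | exact: tb_const
  | lazymatch goal with
    | |- tower_bounded (fun s => @?f s ^ @?g s) => apply: (@tb_exp f g)
    | |- tower_bounded (fun s => @?f s * @?g s) => apply: (@tb_mul f g)
    | |- tower_bounded (fun s => @?f s + @?g s) => apply: (@tb_add f g)
    | |- tower_bounded (fun s => (@?f s)`!) => apply: (@tb_fact f)
    | |- tower_bounded (fun s => (@?f s).+1) => apply: (@tb_succ f)
    end ].

Section Certificates.

Variables n m : nat.

Lemma tb_coef_degree : tower_bounded (coef_degree n m).
Proof. by rewrite /coef_degree; tb. Qed.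

Lemma tb_coef_shift q : tower_bounded (fun s =>
  coef_shift_bound q (period n m) (coef_degree n m s) s (stable_from n m)).
Proof.
have hc := tb_coef_degree; have hD : tower_bounded (fun s => size (words q (coef_degree n m s))).
  by apply: (tb_le (fun s => size_words q (coef_degree n m s))); tb.
have hp R : tower_bounded R ->
    tower_bounded (fun s => power_bound (size (words q (coef_degree n m s))) (R s)).
  by move=> hR; rewrite /power_bound; tb.
have hR : tower_bounded (fun s => let D := size (words q (coef_degree n m s)) in
    coef_degree n m s * (coef_degree n m s).+1 ^
    (s ^ (stable_from n m + (2 * D + 2) * (period n m).+1) * s)) by rewrite /=; tb.
by have hpR := hp _ hR; rewrite /coef_shift_bound /shift_bound /=; tb.
Qed.

Lemma tb_exponent_bound : tower_bounded (exponent_bound n m).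
Proof. by have h1 := tb_coef_shift (n + m); have h2 := tb_coef_shift n; rewrite /exponent_bound; tb. Qed.

(** [code_leq] for a certificate: its entries are exponents or letter codes below [n.*2], and its
    length is 2 plus that of the conjugator. *)
Definition certificate_bound s := (2 ^ (exponent_bound n m s + n.*2) * 3) ^
  (2 + 3 * (s ^ exponent_bound n m s * s)).

Lemma tb_certificate_bound : tower_bounded certificate_bound.
Proof. by have h := tb_exponent_bound; rewrite /certificate_bound; tb. Qed.

End Certificates.

(** The factor 3 absorbs [2 * c + 1 <= 3 * b] for [c <= b] and [b > 0]. *)
Lemma code_leq e l : all (leq^~ e) l -> CodeSeq.code l <= (2 ^ e * 3) ^ size l.
Proof.
elim: l => //= a l IH /andP[ae /IH le]; rewrite expnS -mulnA leq_mul ?leq_exp2l //.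
have : 0 < (2 ^ e * 3) ^ size l by rewrite expn_gt0 muln_gt0 expn_gt0.
by move: le; move: (_ ^ size l) (CodeSeq.code l) => b c; clear; lia.
Qed.

(** * The algorithm *)

Section Decoding.

Variables n m : nat.
Notation W := (FZword n m).

Definition enc_letter q (l : letter 'I_q) : nat := (l.1 : nat).*2 + l.2.
Definition enc q (u : word 'I_q) : seq nat := [seq enc_letter l | l <- u].

(* Codes that are not those of x-letters are ignored. *)
Definition dec_letter (a : nat) : option (letter 'I_n) :=
  omap (fun i => (i, odd a)) (insub a./2).
Definition dec (l : seq nat) : word 'I_n := pmap dec_letter l.

Lemma half_enc q (l : letter 'I_q) : (enc_letter l)./2 = l.1.
Proof. by rewrite /enc_letter addnC half_bit_double. Qed.

Lemma odd_enc q (l : letter 'I_q) : odd (enc_letter l) = l.2.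
Proof. by rewrite /enc_letter oddD odd_double; case: l.2. Qed.

Lemma enc_letter_inj q : injective (@enc_letter q).
Proof.
move=> [i b] [j c] E; have := half_enc (i, b); have := odd_enc (i, b).
by rewrite E half_enc odd_enc /= => -> /ord_inj ->.
Qed.

Lemma flip_enc q (l : letter 'I_q) : flip (enc_letter l) = enc_letter (letter_inv l).
Proof. by rewrite /flip odd_enc /enc_letter; case: l => i [] /=; rewrite ?addn1 ?addn0. Qed.

Lemma dec_letterP a : (forall l, dec_letter a = Some l -> a = enc_letter l /\ a < n.*2) /\
  (dec_letter a = None -> a < n.*2 = false).
Proof.
rewrite /dec_letter; case: insubP => [i _ ia|a2] /=; split=> //.
  move=> l [<-]; rewrite /enc_letter /= ia addnC odd_double_half; split=> //.
  by rewrite -ltn_half_double -ia ltn_ord.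
by move=> _; rewrite -ltn_half_double; apply/negbTE.
Qed.

Lemma dec_enc_letter (l : letter 'I_n) : dec_letter (enc_letter l) = Some l.
Proof. by rewrite /dec_letter half_enc odd_enc valK /=; case: l. Qed.

Lemma dec_enc (u : word 'I_n) : dec (enc u) = u.
Proof. by elim: u => //= l u IH; rewrite dec_enc_letter /= IH. Qed.

Lemma dec_xproj (u : W) : dec (enc u) = xproj u.
Proof.
rewrite /dec /enc /xproj; elim: u => //= -[i b] u ->; congr oapp.
rewrite /dec_letter half_enc odd_enc /=; case: (split_ordP i) => j ->.
  by rewrite xletter_l /= insubT //= => jn; congr (Some (_, _)); apply/val_inj.
by rewrite xletter_r insubF //= ltnNge leq_addr.
Qed.

Lemma winvE l : winv l = rev (map flip l).
Proof.
by rewrite /winv /rev; elim: l [::] => /=.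
Qed.

Lemma enc_inv q (u : word 'I_q) : enc (word_inv u) = winv (enc u).
Proof.
rewrite winvE /enc /word_inv map_rev -!map_comp; congr rev; apply: eq_map => l /=.
by rewrite flip_enc.
Qed.

Lemma dec_flip a : dec_letter (flip a) = omap (@letter_inv _) (dec_letter a).
Proof.
have [H N] := dec_letterP a; case E : (dec_letter a) => [l|] /=.
  by have [-> _] := H l E; rewrite flip_enc dec_enc_letter.
case F : (dec_letter (flip a)) => [l|] //; have [/(_ l F)[fa fn] _] := dec_letterP (flip a).
by move: (N E) fn; rewrite /flip; case: ifP => ao; move: ao; clear; lia.
Qed.

Lemma dec_cat l l' : dec (l ++ l') = dec l ++ dec l'.
Proof. exact: pmap_cat. Qed.

Lemma dec_winv l : dec (winv l) = word_inv (dec l).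
Proof.
rewrite winvE; elim: l => // a l IH; rewrite /= rev_cons -cats1 dec_cat IH /dec /= dec_flip.
by case: (dec_letter a) => [b|] /=; rewrite ?cats0 // -[b :: _]cat1s word_inv_cat.
Qed.

Lemma lpushE (st : word 'I_n) a : lpush n.*2 (enc st) a =
  enc (if dec_letter a is Some l then push st l else st).
Proof.
rewrite /lpush; have [H N] := dec_letterP a; case E : (dec_letter a) => [l|]; last by rewrite N.
have [-> ->] := H l E; case: st => //= l' st.
by rewrite flip_enc (inj_eq (@enc_letter_inj n)); case: eqP.
Qed.

Lemma lstackE l : lstack n.*2 l = enc (stack [::] (dec l)).
Proof.
rewrite /lstack -[[::] in LHS]/(enc ([::] : word 'I_n)).
elim: l [::] => //= a l IH st; rewrite lpushE IH /dec /=.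
by case: (dec_letter a).
Qed.

Lemma count_enc q (i : 'I_q) (b : bool) (u : word 'I_q) :
  count_mem (i.*2 + b) (enc u) = count_mem (i, b) u.
Proof.
rewrite count_map; apply: eq_count => l /=.
exact: (inj_eq (@enc_letter_inj q) l (i, b)).
Qed.

Variable ws : endo_words n m.
Notation ws_codes := [seq code_word w | w <- ws].

Lemma limg_enc (l : letter 'I_(n + m)) :
  limg ws_codes (enc_letter l) = enc (letter_image (tnth ws) l).
Proof.
rewrite /limg half_enc odd_enc (nth_map [::]) ?size_tuple // CodeSeq.codeK -tnth_nth.
by rewrite -/(enc _) /letter_image; case: l.2 => //; rewrite enc_inv.
Qed.

Lemma lsub_enc u : lsub ws_codes (enc u) = enc (subw (tnth ws) u).
Proof.
rewrite /lsub /subw /enc map_flatten -map_comp -[RHS]cat0s.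
elim: u [::] => [|l u IH] acc /=; first by rewrite cats0.
by rewrite IH limg_enc catA.
Qed.

Lemma iter_lsub_enc k u : iter k (lsub ws_codes) (enc u) = enc (iter k (subw (tnth ws)) u).
Proof. by elim: k => //= k ->; rewrite lsub_enc. Qed.

(** Entries of [q] that code no x-letter are dropped by [dec] and by the stack alike, so the
    equivalence holds for arbitrary [q]. *)
Lemma lcheckP q (x y : W) : let c := xlift m (dec (behead (behead q))) in
  lcheck n m q (enc x) (enc y) ws_codes <->
  FZ_eq (word_inv c ++ iter (head 0 q) (subw (tnth ws)) x ++ c)
        (iter (head 0 (behead q)) (subw (tnth ws)) y).
Proof.
move=> c; rewrite /lcheck !iter_lsub_enc; set X := iter _ _ x; set Y := iter _ _ y.
set z := behead (behead q) in c *.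
have countE : all (fun j => count_mem (n + j).*2 (enc X ++ winv (enc Y)) ==
      count_mem (n + j).*2.+1 (enc X ++ winv (enc Y))) (iota 0 m) <->
    (forall j : 'I_m, expo (rshift n j) X = expo (rshift n j) Y).
  have E (j : 'I_m) : (count_mem (n + j).*2 (enc X ++ winv (enc Y)) ==
      count_mem (n + j).*2.+1 (enc X ++ winv (enc Y))) =
      (expo (rshift n j) X == expo (rshift n j) Y).
    rewrite -enc_inv /enc -map_cat -/(enc (X ++ word_inv Y)).
    have := count_enc (rshift n j) false (X ++ word_inv Y); rewrite addn0 => ->.
    have := count_enc (rshift n j) true (X ++ word_inv Y); rewrite addn1 => ->.
    rewrite -[RHS]GRing.subr_eq0 -expo_inv -expo_cat /expo GRing.subr_eq0.
    by rewrite eqz_nat.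
  split=> [/allP H j|H]; first by apply/eqP; rewrite -E; apply: H; rewrite mem_iota add0n ltn_ord.
  by apply/allP => j; rewrite mem_iota => jm; rewrite (E (Ordinal jm)) H.
have stackE : lstack n.*2 (winv z ++ enc X ++ z ++ winv (enc Y)) == [::] <->
    free_eq (word_inv (dec z) ++ xproj X ++ dec z) (xproj Y).
  rewrite lstackE !dec_cat !dec_winv !dec_xproj; set w := _ ++ _.
  have -> : free_eq (word_inv (dec z) ++ xproj X ++ dec z) (xproj Y) <-> free_eq w [::].
    rewrite /free_eq -!weltP /w !welt_cat !welt_inv; set a := welt _ (dec z).
    rewrite (_ : welt _ [::] = 1%g) //; split=> [H|H].
      by rewrite !monoid.mulgA -(monoid.mulgA (a^-1)%g) H monoid.mulgV.
    apply: (monoid.mulIg (welt _ (xproj Y))^-1%g).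
    by rewrite monoid.mulgV -H !monoid.mulgA.
  rewrite reduceP /=; case: (stack _ w) => [|l st]; split=> //.
split=> [/andP[/stackE st /countE cn]|H].
  apply: FZ_eq_of_xproj => [j|]; last by rewrite !xproj_cat xproj_inv xliftK.
  by rewrite !expo_cat expo_inv cn GRing.addrCA GRing.addNr GRing.addr0.
apply/andP; split.
  by apply/stackE; have := xproj_conj H; rewrite xliftK.
apply/countE => j; have := expo_FZ_eq (rshift n j) H.
by rewrite !expo_cat expo_inv GRing.addrCA GRing.addNr GRing.addr0.
Qed.

End Decoding.

Theorem theorem3p9 (n m : nat) :
  exists P : recfun, solves_two_sided_BrCP n m P.
Proof.
have [K KP] := tb_certificate_bound n m; have [P PP] := K3_canswer n m K.
exists P => x y ws Phi reprP Phi_inj.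
pose out_code := canswer n m K (code_word x) (code_word y) (code_endo ws).
have PE : reval P [:: code_word x; code_word y; code_endo ws] out_code by apply: PP.
have PhiE k u : iter k Phi (FZelt u) = FZelt (iter k (subw (tnth ws)) u) by apply: Phi_iter.
have conjE r t (c : FZword n m) :
    (iter r Phi (FZelt x) ^ FZelt c)%g = iter t Phi (FZelt y) <->
    FZ_eq (word_inv c ++ iter r (subw (tnth ws)) x ++ c) (iter t (subw (tnth ws)) y).
  by rewrite !PhiE /FZ_eq -weltP monoid.conjgE !welt_cat welt_inv.
have [[q qc outE]|[out0 none]] :=
    canswerP n m K (enc x) (enc y) [seq code_word w | w <- ws].
  exists (Some (head 0 q, head 0 (behead q))); split.
    by have <- : out_code = code_answer (Some (head 0 q, head 0 (behead q))) := outE.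
  exists (FZelt (xlift m (dec n (behead (behead q))))).
  exact/conjE/lcheckP.
exists None; split; first by have <- : out_code = code_answer None := out0.
(* [s] is the number on which the search bound is built; it also bounds the lengths of all input
   words, as a list is no longer than its code. *)
case=> r [t [g gE]]; set s := (code_word x + code_word y + code_endo ws).+1 in none.
rewrite -(wreprK g) in gE; move/conjE: gE => gE.
have size_word (u : FZword n m) : size u <= code_word u.
  by rewrite -(size_map (@enc_letter _) u) size_code.
have xs : size x <= s by apply: leq_trans (size_word x) _; rewrite /s -addnA leqW // leq_addr.
have ys : size y <= s.
  by apply: leq_trans (size_word y) _; rewrite /s addnAC leqW // leq_addl.
have wss i : size (tnth ws i) <= s.
  apply: leq_trans (size_word _) _; apply: leq_trans (_ : code_endo ws <= _).
    have /allP H := CodeSeq.ltn_code [seq code_word w | w <- ws].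
    by apply/ltnW/H/map_f/mem_tnth.
  by rewrite /s leqW // leq_addl.
have tt := xproj_t_trivial reprP Phi_inj.
have [r' [t' [z [r'e t'e zs zE]]]] := conjugate_bounded (fun n2 j => tt j n2) (ltn0Sn _) wss xs ys gE.
(* A solution would yield a certificate below the search bound, which the failed search excludes. *)
apply: (negP (none [:: r', t' & enc z] _)); last by apply/lcheckP; rewrite /= dec_enc.
apply: leq_trans (KP s); set e := exponent_bound n m s.
apply: leq_trans (code_leq (e := e + n.*2) _) _ => /=.
  rewrite (leq_trans r'e (leq_addr _ _)) (leq_trans t'e (leq_addr _ _)) /=; apply/allP => a /mapP[l _ ->].
  by apply: leq_trans (leq_addl _ _); rewrite ltnW // -ltn_half_double half_enc.
rewrite leq_pexp2l ?muln_gt0 ?expn_gt0 // size_map add2n !ltnS.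
exact: leq_trans zs _.
Qed.
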